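(* For $c>2$ let $W_c$ denote the set $W_{\mathcal{A}}$ for the constant sequence $\mathcal{A}=(c,c,c,\dots)$. Then $$\dim_{\sf box}(W_c)=\frac{\ln(2c)}{\ln(c)},$$ which tends to $1$ as $c\to+\infty$. In general, for every sequence $\mathcal{A}=\{a_i\}_{i=1}^\infty$ of real numbers $a_i>2$, $$\dim_{\sf box}(W_{\mathcal{A}})=1+\lim_{n\to+\infty}\frac{n\ln(2)}{\sum_{i=1}^n\ln(a_i)}.$$
   Context: **Minkowski dimension.** For a bounded set $S\subset\mathbb{R}^n$ and $\epsilon>0$ let $N(\epsilon)$ be the (minimal) number of boxes (cubes; squares if $n=2$) of side length $\epsilon$ required to cover $S$. The upper and lower Minkowski dimensions of $S$ are the $\limsup$ and $\liminf$ of $\ln(N(\epsilon))/\ln(1/\epsilon)$ as $\epsilon\to0^+$; when they agree, the common value is the Minkowski dimension $\dim_{\sf box}(S)$. **Lakes of Wada in the modified Cantor way.** Let $\mathcal{A}=\{a_i\}_{i\ge1}$ be a sequence of real numbers $a_i>2$. Put $t_0=1$, $t_n=\prod_{i=1}^na_i^{-1}$ and $w_n=t_{n-1}(1-\frac2{a_n})$ for $n\ge1$. One constructs closed canals $C_1,C_2,\dots\subset[0,1]^2$ (with $C_n$ dug on Day $n$); the island after Day $n$ is $I_n:=\overline{[0,1]^2\setminus(C_1\cup\dots\cup C_n)}$, with $I_0=[0,1]^2$. For every $n\ge1$, $I_n$ is a rectilinear strip of constant width $t_n$: a finite chain of axis-parallel straight pieces of width $t_n$ joined at right angles by $t_n\times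 t_n$ corner squares, having two end edges of length $t_n$ and two long sides. The canals have width $w_n$ and are as follows. - Day 1: $C_1=[0,1-\frac1{a_1}]\times[\frac1{a_1},1-\frac1{a_1}]$. The two end edges of $I_1$ lie on the left side $\{x=0\}$ of the square. - Days $n=2,3$: $C_n$ enters $I_{n-1}$ from the left side $\{x=0\}$ through one of the two end edges of $I_{n-1}$ (the lower one if $n=2$; either one if $n=3$), runs along the middle of the whole strip, leaving land of width $t_n$ on both sides, and stops at distance $t_n$ from the other end edge. - Days $n\ge4$: a peak point of a canal is the midpoint of an edge (of length equal to the width of the canal) in which the canal terminates; $C_1,C_2,C_3$ have one peak point each, and each $C_n$ with $n\ge4$ has two. Choose one peak point $p$ of $C_{n-3}$; it lies on a long side of the strip $I_{n-1}$. The canal $C_n$ starts at $p$, crosses the wall of the strip perpendicularly (by a connecting piece of width $w_n$ with axis through $p$) to the middle of the strip, separates there into two opposite directions, and runs in both directions along the middle of the strip, leaving land of width $t_n$ on both sides, until it stops at distance $t_n$ from each of the two end edges of $I_{n-1}$. (After Day $n$ every point of the island is at distance at most $\sqrt2\,t_n$ from the lake extended on Day $n$.) The lakes $B_{3k+1}$, $R_{3k+2}$, $G_{3k+3}$ ($k\ge0$) are the interiors of $\bigcup_{j=0}^kC_{3j+1}$, $\bigcup_{j=0}^kC_{3j+2}$, $\bigcup_{j=0}^kC_{3j+3}$ respectively. Let $U_B=\bigcup_kB_{3k+1}$, $U_R=\bigcup_kR_{3k+2}$, $U_G=\bigcup_kG_{3k+3}$. These have the same boundary in $(0,1)^2$,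 and $$W_{\mathcal{A}}:=(0,1)^2\cap\partial U_B=(0,1)^2\cap\partial U_R=(0,1)^2\cap\partial U_G.$$ *)

(* Defs.v *)
From HB Require Import structures.
From mathcomp Require Import all_boot all_order all_algebra.
From mathcomp Require Import all_classical all_reals all_analysis.
Set Implicit Arguments.
Unset Strict Implicit.
Unset Printing Implicit Defensive.
Import Order.TTheory GRing.Theory Num.Theory.
Import numFieldNormedType.Exports.
Local Open Scope classical_set_scope.
Local Open Scope ring_scope.

Section Minkowski.
Variable R : realType.
Implicit Types (S : set (R * R)) (e d : R).

(* A square of side length [e] is closed and axis-parallel, given by its
   lower left corner. *)
Definition square (x : R * R) e : set (R * R) :=
  [set y | x.1 <= y.1 <= x.1 + e /\ x.2 <= y.2 <= x.2 + e].

Definition coverable S e (k : nat) : Prop :=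
  exists x : 'I_k -> R * R, S `<=` \bigcup_i square (x i) e.

(* Junk value 0 when no finite cover exists, i.e. when [S] is unbounded. *)
Definition covering_number S e : nat :=
  xget 0%N [set k | coverable S e k /\ forall j, coverable S e j -> (k <= j)%N].

Definition box_ratio S e : \bar R :=
  (ln (covering_number S e)%:R / ln (e^-1))%:E.

Definition upper_minkowski S : \bar R := limf_esup (box_ratio S) (0^'+).
Definition lower_minkowski S : \bar R := limf_einf (box_ratio S) (0^'+).

Definition has_minkowski_dim S d : Prop :=
  upper_minkowski S = d%:E /\ lower_minkowski S = d%:E.

End Minkowski.

Section Strips.
Variable R : realType.
Implicit Types (u v p q : R * R) (c : seq (R * R)) (t : R).

Definition seg_len u v : R := `|u.1 - v.1| + `|u.2 - v.2|.

(* Straight piece of width [t] around the axis-parallel segment from [u] to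
   [v], cut off flat at both ends. *)
Definition straight u v t : set (R * R) :=
  [set z |
    (u.2 = v.2 /\ Num.min u.1 v.1 <= z.1 <= Num.max u.1 v.1
               /\ `|z.2 - u.2| <= t / 2) \/
    (u.1 = v.1 /\ Num.min u.2 v.2 <= z.2 <= Num.max u.2 v.2
               /\ `|z.1 - u.1| <= t / 2)].

Definition corner v t : set (R * R) :=
  [set z | `|z.1 - v.1| <= t / 2 /\ `|z.2 - v.2| <= t / 2].

Definition vertex c (i : nat) : R * R := nth (0, 0) c i.

(* [c] lists the vertices of a centre line: its two extremities are the
   midpoints of the end edges, the other vertices are the centres of the corner
   squares. The i-th piece runs along the i-th segment of [c] and includes the
   corner squares at its ends. *)
Definition piece c t (i : nat) : set (R * R) :=
  [set z | [\/ straight (vertex c i) (vertex c i.+1) t z,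
               (0 < i)%N /\ corner (vertex c i) t z |
               (i.+2 < size c)%N /\ corner (vertex c i.+1) t z ]].

Definition strip c t : set (R * R) :=
  [set z | exists2 i : nat, (i.+1 < size c)%N & piece c t i z].

Definition horizontal c (i : nat) : bool :=
  (vertex c i).2 == (vertex c i.+1).2.
Definition vertical c (i : nat) : bool :=
  (vertex c i).1 == (vertex c i.+1).1.

Definition dx c (i : nat) : R := (vertex c i.+1).1 - (vertex c i).1.
Definition dy c (i : nat) : R := (vertex c i.+1).2 - (vertex c i).2.

(* No two of the segments i, ..., j of [c] have opposite directions. *)
Definition monotone_between c (i j : nat) : Prop :=
  forall k l : nat, (i <= k <= j)%N -> (i <= l <= j)%N ->
    0 <= dx c k * dx c l /\ 0 <= dy c k * dy c l.

(* [c] is the centre line of a rectilinear strip of width [t]: nondegenerate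
   segments, alternately horizontal and vertical; the end segments protrude
   from the corner squares; the strip never meets itself. In a staircase a step
   may be shorter than [t], and then corner squares overlap; hence the
   exception for pieces joined by a monotone part of the chain. Such short
   steps do occur in the islands when the canals are narrow. *)
Definition centre_line c t : Prop :=
  [/\ (1 < size c)%N,
      forall i, (i.+1 < size c)%N -> horizontal c i (+) vertical c i,
      forall i, (i.+2 < size c)%N -> horizontal c i != horizontal c i.+1,
      (2 < size c)%N ->
        t / 2 < seg_len (vertex c 0) (vertex c 1) /\
        t / 2 < seg_len (vertex c (size c).-2) (vertex c (size c).-1) &
      forall i j, (i < j)%N -> (j.+1 < size c)%N ->
        piece c t i `&` piece c t j !=set0 -> monotone_between c i j].

Definition move_towards u v (r : R) : R * R :=
  (u.1 + r / seg_len u v * (v.1 - u.1), u.2 + r / seg_len u v * (v.2 - u.2)).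

(* Shortening a centre line by length [r] at its first, resp. last, extremity. *)
Definition trim_first c (r : R) : seq (R * R) :=
  if c is u :: v :: s then move_towards u v r :: v :: s else c.
Definition trim_last c (r : R) : seq (R * R) := rev (trim_first (rev c) r).

(* [q] is on the [i]-th segment of [c], straight across from the point [p] of a
   long side of the strip of width [t]. *)
Definition across c t p q (i : nat) : Prop :=
  [/\ (i.+1 < size c)%N, seg_len p q = t / 2 &
      if horizontal c i
      then [/\ q.2 = (vertex c i).2, p.1 = q.1 &
               Num.min (vertex c i).1 (vertex c i.+1).1 <= q.1
                 <= Num.max (vertex c i).1 (vertex c i.+1).1]
      else [/\ q.1 = (vertex c i).1, p.2 = q.2 &
               Num.min (vertex c i).2 (vertex c i.+1).2 <= q.2
                 <= Num.max (vertex c i).2 (vertex c i.+1).2]].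

End Strips.

Section Wada.
Variable R : realType.
(* Sequences are indexed from 1: [a 0], [C 0] and [P 0] are never used. *)
Implicit Types (a : nat -> R) (C P : nat -> set (R * R)).

Definition wall a (n : nat) : R := \prod_(1 <= i < n.+1) (a i)^-1.
Definition width a (n : nat) : R := wall a n.-1 * (1 - 2 / a n).

Definition closed_unit_square : set (R * R) :=
  [set z | 0 <= z.1 <= 1 /\ 0 <= z.2 <= 1].
Definition open_unit_square : set (R * R) :=
  [set z | 0 < z.1 < 1 /\ 0 < z.2 < 1].

Definition island C (n : nat) : set (R * R) :=
  closure (closed_unit_square `\` \bigcup_(i in [set i | (1 <= i <= n)%N]) C i).

(* [Cn] is the canal of day [n] and [Pn] its set of peak points, that is, of
   midpoints of the edges in which it terminates. *)
Definition canal1 a (Cn Pn : set (R * R)) : Prop :=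
  Cn = [set z | 0 <= z.1 <= 1 - (a 1)^-1 /\ (a 1)^-1 <= z.2 <= 1 - (a 1)^-1] /\
  Pn = [set (1 - (a 1)^-1, 1 / 2)].

Definition canal23 a C (n : nat) (Cn Pn : set (R * R)) : Prop :=
  exists c : seq (R * R),
    let u := vertex c 0 in let v := vertex c (size c).-1 in
    let m := trim_last c (wall a n) in
    [/\ centre_line c (wall a n.-1) /\ island C n.-1 = strip c (wall a n.-1),
        u.1 = 0, (n = 2 -> u.2 < v.2),
        Cn = strip m (width a n) &
        Pn = [set vertex m (size m).-1]].

Definition canal4 a C P (n : nat) (Cn Pn : set (R * R)) : Prop :=
  exists (c : seq (R * R)) (p q : R * R) (i : nat),
    let m := trim_first (trim_last c (wall a n)) (wall a n) in
    [/\ centre_line c (wall a n.-1) /\ island C n.-1 = strip c (wall a n.-1),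
        P (n - 3)%N p, across c (wall a n.-1) p q i,
        Cn = straight p q (width a n) `|` strip m (width a n) &
        Pn = [set vertex m 0; vertex m (size m).-1]].

(* [C] is the sequence of canals, and [P] that of their sets of peak points, for
   some run of the construction: the free choices (an end edge on day 3, a peak
   point on each later day) are existentially quantified in the rules. *)
Definition wada_canals a C P : Prop :=
  [/\ canal1 a (C 1) (P 1),
      forall n, (2 <= n <= 3)%N -> canal23 a C n (C n) (P n) &
      forall n, (4 <= n)%N -> canal4 a C P n (C n) (P n)].

(* r = 1, 2, 3 for the blue, red and green lake. *)
Definition lake C (r k : nat) : set (R * R) :=
  interior (\bigcup_(j in [set j | (j <= k)%N]) C (3 * j + r)%N).
Definition full_lake C (r : nat) : set (R * R) := \bigcup_k lake C r k.

Definition boundary (A : set (R * R)) : set (R * R) := closure A `\` interior A.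

(* The three lakes have the same boundary in the open square; letting [r] be
   any of 1, 2, 3 covers all the expressions for it. *)
Definition is_wada_set a (W : set (R * R)) : Prop :=
  exists (C P : nat -> set (R * R)) (r : nat),
    [/\ wada_canals a C P, (1 <= r <= 3)%N &
        W = open_unit_square `&` boundary (full_lake C r)].

End Wada.

(* Main.v *)
Require Import Defs.
From mathcomp Require Import all_boot all_order all_algebra.
From mathcomp Require Import all_classical all_reals all_analysis.
From mathcomp Require Import ring lra zify.

(** Proof idea. Let [T = wall a n] be the width of the strip [I_n] and [L_n] the
length of its centre line.

Lengths. The strip is tiled by rectangles obtained by pushing each straight piece
forward by [T / 2], so its area is exactly [T * L_n]. Comparing the areas of [I_n],
of [I_(n+1)] and of the canal between them yields
[2 L_n - O(T) <= L_(n+1) <= 2 L_n + 2], hence [L_n] is of the order of [2 ^ n].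

Lower count. Every point [q] of the centre line has a neighbour at distance [T / 2]
that the next canal misses: move backwards along the segment of [q] and forwards
along an adjacent one; the part of the canal before [q] and the part after [q] then
lie on the other sides. Every point of an island is near the boundary of each lake:
it is near a canal of that lake, and near a point of all later islands, which no
lake contains. Sweeping the strip with these points shows that at least a multiple
of [2 ^ n / e] squares of side [e] are needed if [wall a n.+1 <= e <= wall a n].

Upper count. A boundary point is near [I_n] or on the frontier of one of the first
[n] canals. All these sets lie in shells of thickness [O(e)] of unions of boxes
centred on curves of length [O(2 ^ n)]. Within one quadrant around a point of the
curve, such a shell is an antichain up to [O(e)], so it has few bands along the
diagonal; the total is at most a multiple of [2 ^ n / e].

So [ln N(e) / ln (1 / e) = 1 + (n ln 2 + O(1)) / ln (1 / e)] in this range of [e]. *)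

Set Implicit Arguments.
Unset Strict Implicit.
Unset Printing Implicit Defensive.
Import Order.TTheory GRing.Theory Num.Theory.
Import numFieldNormedType.Exports.
Local Open Scope classical_set_scope.
Local Open Scope ring_scope.
Local Arguments vertex : simpl never.

(** * Boxes and rectilinear chains *)

Section Boxes.
Variable R : realType.
Implicit Types (p q z : R * R) (b : bool) (r : R).

(** Uniformity in [a] shapes everything. If [a n.+1] is huge, [e] ranges over a huge interval
    between two walls, so counts are needed at every such [e], not only at [e = wall a n]. It also
    makes a canal nearly as wide as its strip: the connecting piece then has area of order [T ^+ 2],
    while the length recursion divides by the new width [t'] and tolerates only [O(T * t')]. Only
    what this piece removes outside the rest of the canal counts, and that is a thin shell. If
    [a n.+1] is close to 2, canals are thin and the strips contain staircases with steps shorter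
    than their width, whose pieces overlap; so arguments use the order along the chain, not
    disjointness of pieces. A strip appears in three guises: as pieces (as defined), as cells with
    disjoint interiors (for areas), and as boxes centred on the line shortened by [T / 2] (for
    shells). Since [T / 2 = w / 2 + t'], the same centres serve an island and the canal of width [w]
    inside it. The third guise needs strips that are not too short, which holds because the side
    [x = 1] of the square is never dug. *)

Definition co b z : R := if b then z.1 else z.2.
Definition mkpt b (x y : R) : R * R := if b then (x, y) else (y, x).
Definition box q r : set (R * R) := [set z | forall b, `|co b z - co b q| <= r].

Lemma co_mk b x y : co b (mkpt b x y) = x. Proof. by case: b. Qed.
Lemma co_mkN b x y : co (~~ b) (mkpt b x y) = y. Proof. by case: b. Qed.

Lemma mkpt_co b p : mkpt b (co b p) (co (~~ b) p) = p.
Proof. by case: b; case: p. Qed.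

Lemma boxE b q r z : `|co b z - co b q| <= r ->
  `|co (~~ b) z - co (~~ b) q| <= r -> box q r z.
Proof. by case: b => h1 h2 [] //=. Qed.

Lemma box_sym p q r : box p r q -> box q r p.
Proof. by move=> h b; rewrite distrC. Qed.

Lemma box_trans p q z r1 r2 : box p r1 q -> box q r2 z -> box p (r1 + r2) z.
Proof.
move=> h1 h2 b; have := h1 b; have := h2 b.
have := ler_distD (co b q) (co b z) (co b p); lra.
Qed.

Lemma box_le q r1 r2 : r1 <= r2 -> box q r1 `<=` box q r2.
Proof. by move=> h z hz b; apply: le_trans (hz b) h. Qed.

Lemma norm_leP (x r : R) : `|x| <= r <-> - r <= x /\ x <= r.
Proof. by rewrite ler_norml; split=> [/andP //|[-> ->]]. Qed.

Lemma clamp (lo hi y h : R) : lo <= hi -> lo <= y + h -> y <= hi + h -> 0 <= h ->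
  exists x, [/\ lo <= x, x <= hi, - h <= y - x & y - x <= h].
Proof.
move=> h1 h2 h3 h4; have [a|a] := leP y lo; first by exists lo; split; lra.
by have [b|b] := leP y hi; [exists y | exists hi]; split; lra.
Qed.

End Boxes.

Section Chains.
Variable R : realType.
Implicit Types (p q z : R * R) (b : bool) (r t w : R) (i j k : nat).

(* The [i]-th segment, from vertex [i] to vertex [i.+1], is parallel to the
   first coordinate axis if [axis i]; [sgn i = 1] or [-1] is its direction. *)
Record chain := Chain {
  nseg : nat; vtx : nat -> R * R; axis : nat -> bool; sgn : nat -> R }.
Implicit Type ch : chain.

(** Displacements along and across the [i]-th segment. Advance is positive in the direction of
    travel, so that one argument serves all four orientations. *)
Definition adv ch i p q : R := sgn ch i * (co (axis ch i) q - co (axis ch i) p).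
Definition lat ch i p q : R := co (~~ axis ch i) q - co (~~ axis ch i) p.
Definition seglen ch i : R := adv ch i (vtx ch i) (vtx ch i.+1).
Definition len ch : R := \sum_(i < nseg ch) seglen ch i.

Definition wf ch : Prop :=
  [/\ (0 < nseg ch)%N,
      forall i, (i < nseg ch)%N -> sgn ch i = 1 \/ sgn ch i = -1,
      forall i, (i < nseg ch)%N -> lat ch i (vtx ch i) (vtx ch i.+1) = 0,
      forall i, (i < nseg ch)%N -> 0 < seglen ch i &
      forall i, (i.+1 < nseg ch)%N -> axis ch i.+1 = ~~ axis ch i].

Definition at_first i (x : R) : R := if i == 0%N then x else 0.
Definition at_last ch i (x : R) : R := if i == (nseg ch).-1 then x else 0.

(* Points of the [i]-th segment at distance at least [r] from the extremities of
   the whole chain. *)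
Definition inner ch r i q : Prop :=
  [/\ at_first i r <= adv ch i (vtx ch i) q,
      at_last ch i r <= adv ch i q (vtx ch i.+1) & lat ch i (vtx ch i) q = 0].

(** Exactly what keeps the [t / 2]-inner part of every segment nonempty; the segment of a
    one-segment chain gives up [t / 2] at both ends. *)
Definition roomy ch t : Prop := forall i, (i < nseg ch)%N ->
  at_first i (t / 2) + at_last ch i (t / 2) <= seglen ch i.

Definition ppiece ch t i : set (R * R) := [set z |
  [\/ [/\ 0 <= adv ch i (vtx ch i) z, 0 <= adv ch i z (vtx ch i.+1) &
          `|lat ch i (vtx ch i) z| <= t / 2],
      (0 < i)%N /\ box (vtx ch i) (t / 2) z |
      (i.+1 < nseg ch)%N /\ box (vtx ch i.+1) (t / 2) z]].

Definition pstrip ch t : set (R * R) :=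
  [set z | exists2 i, (i < nseg ch)%N & ppiece ch t i z].

Definition same_way ch i j : Prop := forall k l,
  (i <= k <= j)%N -> (i <= l <= j)%N -> axis ch k = axis ch l ->
  sgn ch k = sgn ch l.

Definition simple ch t : Prop := forall i j, (i < j)%N -> (j < nseg ch)%N ->
  ppiece ch t i `&` ppiece ch t j !=set0 -> same_way ch i j.

Section Basics.
Variables (ch : chain) (hw : wf ch).

Lemma nseg_gt0 : (0 < nseg ch)%N. Proof. by case: hw. Qed.
Lemma sgnP i : (i < nseg ch)%N -> sgn ch i = 1 \/ sgn ch i = -1.
Proof. by case: hw => _ h _ _ _; exact: h. Qed.
Lemma lat_vtx i : (i < nseg ch)%N -> lat ch i (vtx ch i) (vtx ch i.+1) = 0.
Proof. by case: hw => _ _ h _ _; exact: h. Qed.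
Lemma seglen_gt0 i : (i < nseg ch)%N -> 0 < seglen ch i.
Proof. by case: hw => _ _ _ h _; exact: h. Qed.
Lemma axisS i : (i.+1 < nseg ch)%N -> axis ch i.+1 = ~~ axis ch i.
Proof. by case: hw => _ _ _ _ h; exact: h. Qed.

Lemma adv_norm i p q : (i < nseg ch)%N ->
  `|adv ch i p q| = `|co (axis ch i) q - co (axis ch i) p|.
Proof.
by move=> hi; rewrite /adv; case: (sgnP hi) => ->; rewrite ?mul1r // mulN1r normrN.
Qed.

Lemma advD i p q z : adv ch i p q + adv ch i q z = adv ch i p z.
Proof. rewrite /adv; ring. Qed.

Lemma latD i p q z : lat ch i p q + lat ch i q z = lat ch i p z.
Proof. rewrite /lat; ring. Qed.

Lemma advC i p q : adv ch i p q = - adv ch i q p.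
Proof. rewrite /adv; ring. Qed.
Lemma latC i p q : lat ch i p q = - lat ch i q p.
Proof. rewrite /lat; ring. Qed.

Lemma in_boxP i q r z : (i < nseg ch)%N ->
  box q r z <-> `|adv ch i q z| <= r /\ `|lat ch i q z| <= r.
Proof.
move=> hi; rewrite adv_norm //; split; first by move=> h; split; exact: h.
by case; apply: boxE.
Qed.

Lemma inner_le r r' i q : r' <= r -> inner ch r i q -> inner ch r' i q.
Proof.
move=> hr []; rewrite /inner /at_first /at_last.
by case: ifP => _; case: ifP => _ h1 h2 h3; split=> //; lra.
Qed.

(** A point of the box that overshoots an end of the segment falls into the corner square there, and
    [inner] forbids overshooting where the chain itself ends. Together with [pstrip_inner] this
    presents a strip as a union of boxes, the form used in all shell arguments. *)
Lemma inner_box_sub t i q : (i < nseg ch)%N -> inner ch (t / 2) i q ->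
  0 <= t -> box q (t / 2) `<=` ppiece ch t i.
Proof.
move=> hi [h1 h2 h3] ht z /(in_boxP _ _ _ hi)[/norm_leP[a1 a2] bb].
have E1 := advD i (vtx ch i) q z; have E2 := advD i z q (vtx ch i.+1).
have E3 := advC i z q; have E4 := latD i (vtx ch i) q z.
have E5 := lat_vtx hi; have E6 := latD i (vtx ch i.+1) (vtx ch i) z.
have E7 := latC i (vtx ch i.+1) (vtx ch i).
have E8 := advC i (vtx ch i.+1) z.
move: h1 h2; rewrite /at_first /at_last => h1 h2.
have latz : lat ch i (vtx ch i) z = lat ch i q z by lra.
have latz' : lat ch i (vtx ch i.+1) z = lat ch i q z by lra.
have [p1|p1] := leP 0 (adv ch i (vtx ch i) z); last first.
  apply: Or32; move: h1; case: eqP => [_|ne]; first by lra.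
  move=> h1; split; first by lia.
  by apply/(in_boxP _ _ _ hi); rewrite latz; split=> //; apply/norm_leP; lra.
have [p2|p2] := leP 0 (adv ch i z (vtx ch i.+1)); last first.
  apply: Or33; move: h2; case: eqP => [_|ne]; first by lra.
  move=> h2; split; first by have := nseg_gt0; lia.
  by apply/(in_boxP _ _ _ hi); rewrite latz'; split=> //; apply/norm_leP; lra.
by apply: Or31; split=> //; rewrite latz.
Qed.

(** Project [z] to its segment and clamp the advance to the inner range, which [roomy] makes
    nonempty; this shifts it by at most [t / 2]. *)
Lemma pstrip_inner t z : roomy ch t -> 0 <= t -> pstrip ch t z ->
  exists i q, [/\ (i < nseg ch)%N, inner ch (t / 2) i q & box q (t / 2) z].
Proof.
move=> hr ht [i hi]; have hri := hr i hi; have l0 := seglen_gt0 hi.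
have E5 := lat_vtx hi.
case=> [[h1 h2 h3]|[i0 hb]|[i1 hb]].
- exists i.
  have f0 : 0 <= at_first i (t / 2) <= t / 2 by rewrite /at_first; case: ifP => _; lra.
  have g0 : 0 <= at_last ch i (t / 2) <= t / 2 by rewrite /at_last; case: ifP => _; lra.
  have F6 := advD i (vtx ch i) z (vtx ch i.+1); rewrite -/(seglen ch i) in F6.
  have [||||x [xlo xhi x1 x2]] := @clamp R (at_first i (t / 2))
    (seglen ch i - at_last ch i (t / 2)) (adv ch i (vtx ch i) z) (t / 2); try lra.
  pose q := mkpt (axis ch i) (co (axis ch i) (vtx ch i) + sgn ch i * x) (co (~~ axis ch i) (vtx ch i)).
  have ss : sgn ch i * sgn ch i = 1 by case: (sgnP hi) => ->; lra.
  have advq : adv ch i (vtx ch i) q = x.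
    by rewrite /adv co_mk addrAC subrr add0r mulrA ss mul1r.
  have latq : lat ch i (vtx ch i) q = 0 by rewrite /lat co_mkN subrr.
  have F1 := advD i (vtx ch i) q (vtx ch i.+1); have F2 := advD i q (vtx ch i) z.
  have F3 := advC i q (vtx ch i); have F4 := latD i q (vtx ch i) z.
  have F5 := latC i q (vtx ch i); rewrite -/(seglen ch i) in F1.
  exists q; split=> //; first by split; rewrite ?advq //; lra.
  apply/(in_boxP _ _ _ hi); split; last by rewrite -F4 F5 latq oppr0 add0r.
  by rewrite -F2 F3 advq; apply/norm_leP; lra.
- exists i, (vtx ch i); split=> //; split; rewrite ?/lat ?subrr //.
    by rewrite /at_first (gtn_eqF i0) /adv subrr mulr0.
  rewrite -/(seglen ch i); apply: le_trans hri; rewrite lerDr /at_first.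
  by case: ifP => _; lra.
- exists i, (vtx ch i.+1); split=> //; split=> //.
    rewrite -/(seglen ch i); apply: le_trans hri; rewrite lerDl /at_last.
    by case: ifP => _; lra.
  rewrite /at_last ifF ?/adv ?subrr ?mulr0 //; apply/negP => /eqP; lia.
Qed.

Lemma ppiece_near t i z : (i < nseg ch)%N -> 0 <= t -> ppiece ch t i z ->
  exists2 q, inner ch 0 i q & box q (t / 2) z.
Proof.
move=> hi ht; have l0 := seglen_gt0 hi; have E5 := lat_vtx hi.
have v0 : inner ch 0 i (vtx ch i).
  by split; rewrite /at_first /at_last ?if_same ?/lat ?subrr // ?/adv ?subrr ?mulr0 //; apply: ltW.
have v1 : inner ch 0 i (vtx ch i.+1).
  by split; rewrite /at_first /at_last ?if_same // ?/adv ?subrr ?mulr0 //; apply: ltW.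
case=> [[h1 h2 h3]|[i0 hb]|[i1 hb]]; [|by exists (vtx ch i)|by exists (vtx ch i.+1)].
pose q := mkpt (axis ch i) (co (axis ch i) z) (co (~~ axis ch i) (vtx ch i)).
exists q.
  by split; rewrite /at_first /at_last ?if_same /lat /adv ?co_mk ?co_mkN ?subrr.
by apply/(in_boxP _ _ _ hi); rewrite /lat /adv co_mk co_mkN subrr mulr0 normr0; split=> //; lra.
Qed.

(** Telescoping along a monotone staircase: a segment parallel to segment [k] has its direction and
    contributes a positive advance, a perpendicular one contributes 0. *)
Lemma same_way_le i k j p q : (i <= k <= j)%N -> (i < j)%N -> (j < nseg ch)%N ->
  same_way ch i j -> inner ch 0 i p -> inner ch 0 j q -> 0 <= adv ch k p q.
Proof.
move=> /andP[ik kj] ij hj hs [_ p2 p3] [q1 _ q3].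
have hk : (k < nseg ch)%N by exact: leq_ltn_trans hj.
have hi : (i < nseg ch)%N by exact: ltn_trans hj.
have step l : (i <= l <= j)%N -> 0 <= adv ch k (vtx ch l) (vtx ch l.+1).
  move=> hl; have hln : (l < nseg ch)%N by lia.
  have [e|ne] := boolP (axis ch k == axis ch l).
    have es := hs k l _ hl (eqP e); rewrite /adv (eqP e) es; last by rewrite ik kj.
    exact: ltW (seglen_gt0 hln).
  have := lat_vtx hln; rewrite /lat /adv.
  have -> : axis ch k = ~~ axis ch l by move: ne; case: (axis ch k); case: (axis ch l).
  by move=> ->; rewrite mulr0.
have tele m : (i + m.+1 <= j)%N -> 0 <= adv ch k (vtx ch i.+1) (vtx ch (i + m.+1)).
  elim: m => [|m IH] hm; first by rewrite addn1 /adv subrr mulr0.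
  rewrite -(advD k _ (vtx ch (i + m.+1))); apply: addr_ge0; first by apply: IH; lia.
  by rewrite (addnS i m.+1); apply: step; lia.
have tij : 0 <= adv ch k (vtx ch i.+1) (vtx ch j).
  by have := tele (j - i.+1)%N; rewrite addnS -addSn subnKC //; apply; lia.
have hp : 0 <= adv ch k p (vtx ch i.+1).
  have [e|ne] := boolP (axis ch k == axis ch i).
    have es : sgn ch k = sgn ch i by apply: hs (eqP e); lia.
    by move: p2; rewrite /at_last if_same /adv (eqP e) es.
  have := lat_vtx hi; move: p3; rewrite /lat /adv.
  have -> : axis ch k = ~~ axis ch i by move: ne; case: (axis ch k); case: (axis ch i).
  move=> e1 e2; have -> : co (~~ axis ch i) (vtx ch i.+1) - co (~~ axis ch i) p = 0 by lra.
  by rewrite mulr0.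
have hq : 0 <= adv ch k (vtx ch j) q.
  have [e|ne] := boolP (axis ch k == axis ch j).
    have es : sgn ch k = sgn ch j by apply: hs (eqP e); lia.
    by move: q1; rewrite /at_first if_same /adv (eqP e) es.
  move: q3; rewrite /lat /adv.
  have -> : axis ch k = ~~ axis ch j by move: ne; case: (axis ch k); case: (axis ch j).
  by move=> ->; rewrite mulr0.
by rewrite -(advD k _ (vtx ch i.+1)) -(advD k (vtx ch i.+1) (vtx ch j)); lra.
Qed.

End Basics.
End Chains.

(** * Tiling of strips, outer points, trimming, arc length *)

Section Chains2.
Variable R : realType.
Implicit Types (p q z : R * R) (b : bool) (r t w : R) (i j k : nat) (ch : chain R).

(* The rectangle around the [i]-th segment, pushed forward by [t / 2] except at
   the extremities of the chain: these rectangles tile the strip. *)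
Definition cell_lo t i : R := if i == 0%N then 0 else t / 2.
Definition cell_hi ch t i : R := seglen ch i + (if i == (nseg ch).-1 then 0 else t / 2).
Definition cell ch t i : set (R * R) := [set z |
  [/\ cell_lo t i <= adv ch i (vtx ch i) z, adv ch i (vtx ch i) z <= cell_hi ch t i &
      `|lat ch i (vtx ch i) z| <= t / 2]].
Definition ocell ch t i : set (R * R) := [set z |
  [/\ cell_lo t i < adv ch i (vtx ch i) z, adv ch i (vtx ch i) z < cell_hi ch t i &
      `|lat ch i (vtx ch i) z| < t / 2]].

Lemma ocell_sub ch t i : ocell ch t i `<=` cell ch t i.
Proof. by move=> z [? ? ?]; split; apply: ltW. Qed.

(** When a step is shorter than [t], a corner square reaches back beyond its own segment. Whatever
    precedes the cell of that segment lies in the corner square of the previous vertex, so one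
    descends along the chain; at the first segment [roomy] stops the descent. *)
Lemma box_cell ch t i z : wf ch -> roomy ch t -> 0 <= t -> (i.+1 < nseg ch)%N ->
  box (vtx ch i.+1) (t / 2) z -> exists2 j, (j < nseg ch)%N & cell ch t j z.
Proof.
move=> hw hr ht; elim: i => [|i IH] hi hb.
  have h0 : (0 < nseg ch)%N by lia.
  exists 0%N => //; have := hr 0%N h0; rewrite /at_first /at_last eqxx.
  have -> : (0%N == (nseg ch).-1) = false by apply/negP => /eqP; lia.
  move/(in_boxP hw _ _ _ h0): hb => [/norm_leP[b1 b2] b3] hs.
  have F1 := advD ch 0 (vtx ch 0) (vtx ch 1) z; rewrite -/(seglen ch 0) in F1.
  have F2 := latD ch 0 (vtx ch 0) (vtx ch 1) z; rewrite (lat_vtx hw h0) add0r in F2.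
  split; rewrite /cell_lo /cell_hi /= -?F1 -?F2 //; first lra.
  by have -> : (0%N == (nseg ch).-1) = false by [apply/negP => /eqP; lia]; lra.
have h0 : (i.+1 < nseg ch)%N by lia.
have := hb => /(in_boxP hw _ _ _ h0)[/norm_leP[b1 b2] b3].
have F1 := advD ch i.+1 (vtx ch i.+1) (vtx ch i.+2) z; rewrite -/(seglen ch i.+1) in F1.
have F2 := latD ch i.+1 (vtx ch i.+1) (vtx ch i.+2) z; rewrite (lat_vtx hw h0) add0r in F2.
have l0 := seglen_gt0 hw h0.
have [h|h] := leP (t / 2) (adv ch i.+1 (vtx ch i.+1) z).
  exists i.+1 => //; split; rewrite /cell_lo /cell_hi -?F2 //.
  by have -> : (i.+1 == (nseg ch).-1) = false by [apply/negP => /eqP; lia]; lra.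
apply: IH => //; apply/(in_boxP hw _ _ _ h0); rewrite -F2; split=> //.
by apply/norm_leP; lra.
Qed.

Lemma pstrip_cell ch t z : wf ch -> roomy ch t -> 0 <= t -> pstrip ch t z ->
  exists2 j, (j < nseg ch)%N & cell ch t j z.
Proof.
move=> hw hr ht [i hi]; have l0 := seglen_gt0 hw hi.
have key : (0 < i)%N -> box (vtx ch i) (t / 2) z -> exists2 j, (j < nseg ch)%N & cell ch t j z.
  by move: hi; case: i l0 => // i _ hi _; apply: box_cell.
case=> [[h1 h2 h3]|[i0 hb]|[i1 hb]]; [|exact: key|exact: box_cell hb].
have F := advD ch i (vtx ch i) z (vtx ch i.+1); rewrite -/(seglen ch i) in F.
have [h|h] := leP (cell_lo t i) (adv ch i (vtx ch i) z).
  by exists i => //; split=> //; rewrite /cell_hi; case: ifP => _; lra.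
move: h; rewrite /cell_lo; case: eqP => [_|ne]; first lra.
move=> h; apply: key; first lia.
by apply/(in_boxP hw _ _ _ hi); split=> //; apply/norm_leP; lra.
Qed.

Lemma cell_ppiece ch t i : wf ch -> (i < nseg ch)%N -> 0 <= t -> cell ch t i `<=` ppiece ch t i.
Proof.
move=> hw hi ht z [h1 h2 h3].
have F := advD ch i (vtx ch i) z (vtx ch i.+1); rewrite -/(seglen ch i) in F.
have l0 : 0 <= cell_lo t i by rewrite /cell_lo; case: ifP => _; lra.
have [h|h] := leP (adv ch i (vtx ch i) z) (seglen ch i).
  by apply: Or31; split=> //; lra.
move: h2; rewrite /cell_hi; case: eqP => [_|ne]; first lra.
move=> h2; apply: Or33; split; first lia.
have F1 := advD ch i (vtx ch i) (vtx ch i.+1) z; rewrite -/(seglen ch i) in F1.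
have F2 := latD ch i (vtx ch i) (vtx ch i.+1) z; rewrite (lat_vtx hw hi) add0r in F2.
by apply/(in_boxP hw _ _ _ hi); rewrite F2; split=> //; apply/norm_leP; lra.
Qed.

Lemma inner_vtx ch i : wf ch -> (i < nseg ch)%N -> inner ch 0 i (vtx ch i).
Proof.
move=> hw hi; split; rewrite /at_first /at_last ?if_same ?/lat ?subrr //.
  by rewrite /adv subrr mulr0.
exact: ltW (seglen_gt0 hw hi).
Qed.

(** A common point would be more than [t / 2] ahead of vertex [j], by the forward push of the cells.
    It is also within [t / 2] of a point of segment [i], and along a monotone staircase such a point
    is not ahead of vertex [j]. *)
Lemma ocell_disjoint ch t i j z : wf ch -> simple ch t -> 0 <= t ->
  (i < j)%N -> (j < nseg ch)%N -> ocell ch t i z -> ocell ch t j z -> False.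
Proof.
move=> hw hs ht ij hj zi zj; have hi := ltn_trans ij hj.
have pi := cell_ppiece hw hi ht (ocell_sub zi).
have pj := cell_ppiece hw hj ht (ocell_sub zj).
have sw : same_way ch i j by apply: hs => //; exists z.
have [p hp /(_ (axis ch j)) bp] := ppiece_near hw hi ht pi.
have := same_way_le hw _ ij hj sw hp (inner_vtx hw hj) => /(_ j).
rewrite (ltnW ij) leqnn => /(_ isT); case: zj; rewrite /cell_lo.
have -> : (j == 0%N) = false by apply/negP => /eqP; lia.
rewrite -/(adv ch j p z) -(advD ch j (vtx ch j) p z) (advC ch j (vtx ch j) p).
move=> h _ _ h2; move: bp; rewrite -(adv_norm hw p z hj) => /norm_leP[]; lra.
Qed.

(* Any point of the centre line in a piece [j] that does not touch the piece of
   [q] is far; the others lie, along the direction of the segment of [q] or of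
   its neighbour, entirely on one side of [q], hence are avoided by moving from
   [q] backwards along the one and forwards along the other. *)
Lemma outer_point ch T w i q eps : wf ch -> simple ch T -> 0 <= w -> w < T ->
  (i < nseg ch)%N -> inner ch (T / 2) i q -> eps = 1 \/ eps = -1 ->
  exists z, [/\ box q (T / 2) z, adv ch i q z = eps * (T / 2) &
    forall j p, (j < nseg ch)%N -> inner ch 0 j p -> box p (w / 2) z ->
      ppiece ch T j z -> False].
Proof.
move=> hw hs w0 wT hi hq he.
have T0 : 0 <= T by lra.
have hq0 : inner ch 0 i q by apply: inner_le hq; lra.
(* [s] is the direction of the previous segment if [eps = -1], opposite to that of
   the next one if [eps = 1]. *)
pose s : R := if eps == -1 then (if i == 0%N then 1 else sgn ch i.-1)
              else (if i == (nseg ch).-1 then 1 else - sgn ch i.+1).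
have hsg : s = 1 \/ s = -1.
  rewrite /s; case: eqP => _; case: eqP => ne; try (by left).
    by apply: (sgnP hw); lia.
  by have := @sgnP _ _ hw i.+1; rewrite (_ : (i.+1 < nseg ch)%N); [case=> // ->; [right|left; rewrite opprK]|lia].
have ss : sgn ch i * sgn ch i = 1 by case: (sgnP hw hi) => ->; lra.
pose z := mkpt (axis ch i) (co (axis ch i) q + sgn ch i * (eps * (T / 2)))
               (co (~~ axis ch i) q + s * (T / 2)).
have advz : adv ch i q z = eps * (T / 2).
  by rewrite /adv /z co_mk addrAC subrr add0r mulrA ss mul1r.
have latz : lat ch i q z = s * (T / 2).
  by rewrite /lat /z co_mkN addrAC subrr add0r.
have bz : box q (T / 2) z.
  apply/(in_boxP hw _ _ _ hi); rewrite advz latz.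
  by case: he => ->; case: hsg => ->; rewrite ?mulN1r ?mul1r ?normrN ger0_norm; lra.
have pz : ppiece ch T i z := inner_box_sub hw hi hq T0 bz.
exists z; split=> // j p hj hp bp pj.
have bx b : `|co b z - co b p| <= w / 2 := bp b.
have bl := bx (~~ axis ch i); have ba := bx (axis ch i).
have {}ba : `|adv ch i p z| <= w / 2 by rewrite (adv_norm hw).
have {}bl : `|lat ch i p z| <= w / 2 := bl.
move: ba bl => /norm_leP[a1 a2] /norm_leP[l1 l2].
have F1 := advD ch i p q z; have F2 := latD ch i p q z.
have F3 := advC ch i p q.
case: (ltngtP i j) => ij; last first.
- have e : lat ch i p q = 0.
    case: hp hq0 => _ _; rewrite -ij => e1 [_ _ e2].
    by have := latD ch i p (vtx ch i) q; rewrite latC e1 e2; lra.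
  by move: F2; rewrite e latz; case: hsg => ->; lra.
- have sw : same_way ch j i by apply: hs => //; exists z.
  case: he => e.
    have := same_way_le hw _ ij hi sw hp hq0 => /(_ i).
    by rewrite (ltnW ij) leqnn => /(_ isT); rewrite advz e in F1; lra.
  have := same_way_le hw _ ij hi sw hp hq0 => /(_ i.-1).
  have -> : (j <= i.-1 <= i)%N by lia.
  move=> /(_ isT); rewrite /adv.
  have -> : axis ch i.-1 = ~~ axis ch i.
    by have := @axisS _ _ hw i.-1; rewrite prednK; [move=> ->; rewrite ?negbK //; lia|lia].
  rewrite -/(lat ch i p q); move: latz; rewrite /s e eqxx.
  have -> : (i == 0%N) = false by apply/negP => /eqP; lia.
  have hs1 : sgn ch i.-1 = 1 \/ sgn ch i.-1 = -1 by apply: (sgnP hw); lia.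
  by case: hs1 => ->; lra.
- have sw : same_way ch i j by apply: hs => //; exists z.
  case: he => e; last first.
    have := same_way_le hw _ ij hj sw hq0 hp => /(_ i).
    by rewrite (ltnW ij) leqnn => /(_ isT); rewrite advz e in F1; lra.
  have := same_way_le hw _ ij hj sw hq0 hp => /(_ i.+1).
  have -> : (i <= i.+1 <= j)%N by lia.
  move=> /(_ isT); rewrite /adv.
  have -> : axis ch i.+1 = ~~ axis ch i by apply: (axisS hw); lia.
  rewrite -/(lat ch i q p) latC; move: latz; rewrite /s e.
  have -> : ((1 : R) == -1) = false by apply/negP => /eqP; lra.
  have -> : (i == (nseg ch).-1) = false by apply/negP => /eqP; lia.
  have hs1 : sgn ch i.+1 = 1 \/ sgn ch i.+1 = -1 by apply: (sgnP hw); lia.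
  by case: hs1 => ->; lra.
Qed.

Definition slide b p (x : R) := mkpt b (co b p + x) (co (~~ b) p).

Definition trim ch (r0 r : R) : chain R :=
  Chain (nseg ch)
    (fun i => if i == 0%N then slide (axis ch 0) (vtx ch 0) (sgn ch 0 * r0)
              else if i == nseg ch then
                slide (axis ch (nseg ch).-1) (vtx ch (nseg ch)) (- (sgn ch (nseg ch).-1 * r))
              else vtx ch i)
    (axis ch) (sgn ch).

Section Trim.
Variables (ch : chain R) (r0 r T w : R).
Hypotheses (hw : wf ch) (hr0 : 0 <= r0) (hr : 0 <= r).

Lemma trim_vtx i : (i < nseg ch)%N ->
  adv ch i (vtx ch i) (vtx (trim ch r0 r) i) = at_first i r0 /\
  lat ch i (vtx ch i) (vtx (trim ch r0 r) i) = 0.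
Proof.
move=> hi; rewrite /trim /at_first /=.
have ss : sgn ch i * sgn ch i = 1 by case: (sgnP hw hi) => ->; lra.
case: eqP => [e|_].
  by rewrite -e /adv /lat /slide co_mk co_mkN subrr addrAC subrr add0r mulrA ss mul1r.
by rewrite ltn_eqF // /adv /lat !subrr mulr0.
Qed.

Lemma trim_vtxS i : (i < nseg ch)%N ->
  adv ch i (vtx (trim ch r0 r) i.+1) (vtx ch i.+1) = at_last ch i r /\
  lat ch i (vtx (trim ch r0 r) i.+1) (vtx ch i.+1) = 0.
Proof.
move=> hi; rewrite /trim /at_last /=.
have ss : sgn ch i * sgn ch i = 1 by case: (sgnP hw hi) => ->; lra.
case: eqP => [e|ne].
  rewrite ifT; last by apply/eqP; lia.
  have -> : (nseg ch).-1 = i by lia.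
  rewrite -e /adv /lat /slide co_mk co_mkN subrr opprD opprK addrA subrr add0r.
  by rewrite mulrA ss mul1r.
rewrite ifF; last by apply/negP => /eqP; lia.
by rewrite /adv /lat !subrr mulr0.
Qed.

Lemma seglen_trim i : (i < nseg ch)%N ->
  seglen (trim ch r0 r) i = seglen ch i - at_first i r0 - at_last ch i r.
Proof.
move=> hi; have [<- _] := trim_vtx hi; have [<- _] := trim_vtxS hi.
rewrite /seglen /adv /=; ring.
Qed.

Lemma inner_trim h i q : (i < nseg ch)%N ->
  inner (trim ch r0 r) h i q <->
  [/\ at_first i h + at_first i r0 <= adv ch i (vtx ch i) q,
      at_last ch i h + at_last ch i r <= adv ch i q (vtx ch i.+1) &
      lat ch i (vtx ch i) q = 0].
Proof.
move=> hi; have [e1 e2] := trim_vtx hi; have [e3 e4] := trim_vtxS hi.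
have F1 := advD ch i (vtx ch i) (vtx (trim ch r0 r) i) q.
have F2 := advD ch i q (vtx (trim ch r0 r) i.+1) (vtx ch i.+1).
have F3 := latD ch i (vtx ch i) (vtx (trim ch r0 r) i) q.
rewrite e1 in F1; rewrite e3 in F2; rewrite e2 add0r in F3.
have A p p' : adv (trim ch r0 r) i p p' = adv ch i p p' by [].
have B p p' : lat (trim ch r0 r) i p p' = lat ch i p p' by [].
have C : at_last (trim ch r0 r) i h = at_last ch i h by [].
rewrite /inner !A B C F3.
by split; case=> ? ? ?; split=> //; lra.
Qed.

Lemma wf_trim : (forall i, (i < nseg ch)%N -> at_first i r0 + at_last ch i r < seglen ch i) ->
  wf (trim ch r0 r).
Proof.
move=> h; case: (hw) => h1 h2 h3 h4 h5; split=> // i hi.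
  have [_ e2] := trim_vtx hi; have [_ e4] := trim_vtxS hi.
  have := h3 i hi; rewrite /lat /=; move: e2 e4; rewrite /lat /=; lra.
by rewrite seglen_trim //; have := h i hi; lra.
Qed.

Lemma len_trim : len (trim ch r0 r) = len ch - r0 - r.
Proof.
have h0 := nseg_gt0 hw.
rewrite /len /= (eq_bigr (fun i : 'I_(nseg ch) => seglen ch i - at_first i r0 - at_last ch i r)); last first.
  by move=> i _; rewrite seglen_trim.
rewrite !sumrB /at_first /at_last -!big_mkcond /=; congr (_ - _ - _).
  rewrite (big_pred1 (Ordinal h0)) // => i /=; by rewrite -val_eqE.
have h1 : ((nseg ch).-1 < nseg ch)%N by rewrite prednK.
by rewrite (big_pred1 (Ordinal h1)) // => i /=; by rewrite -val_eqE.
Qed.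

Lemma roomy_trim : roomy ch T -> w / 2 + r0 <= T / 2 -> w / 2 + r <= T / 2 ->
  roomy (trim ch r0 r) w.
Proof.
move=> hrm h1 h2 i hi; rewrite seglen_trim //.
have := hrm i hi; rewrite /at_first /at_last /=.
by case: ifP => _; case: ifP => _; lra.
Qed.

Lemma ppiece_trim i : (i < nseg ch)%N -> w <= T ->
  ppiece (trim ch r0 r) w i `<=` ppiece ch T i.
Proof.
move=> hi wT z; have [e1 e2] := trim_vtx hi; have [e3 e4] := trim_vtxS hi.
have f0 : 0 <= at_first i r0 by rewrite /at_first; case: ifP.
have g0 : 0 <= at_last ch i r by rewrite /at_last; case: ifP.
case=> [[h1 h2 h3]|[i0 hb]|[i1 hb]].
- apply: Or31; split.
  + by rewrite -(advD ch i _ (vtx (trim ch r0 r) i)) e1; apply: addr_ge0.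
  + by rewrite -(advD ch i _ (vtx (trim ch r0 r) i.+1)) e3; apply: addr_ge0.
  + rewrite -(latD ch i _ (vtx (trim ch r0 r) i)) e2 add0r.
    apply: le_trans h3 _; lra.
- apply: Or32; split=> //; move: hb; rewrite /= gtn_eqF // ltn_eqF //.
  apply: box_le; lra.
- apply: Or33; split=> //; move: hb; rewrite /= ltn_eqF //.
  apply: box_le; lra.
Qed.

Lemma simple_trim : simple ch T -> w <= T -> simple (trim ch r0 r) w.
Proof.
move=> hs wT i j ij hj [z [zi zj]]; apply: hs => //; exists z; split.
  by apply: ppiece_trim zi => //; apply: ltn_trans hj.
by apply: ppiece_trim zj.
Qed.

End Trim.

(** Arc-length parametrisation, built by appending one segment at a time. Across a joint two points
    are compared through the common vertex. *)
Lemma arc ch : wf ch -> exists g : R -> R * R,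
  (forall x y b, `|co b (g x) - co b (g y)| <= `|x - y|) /\
  (forall i q, (i < nseg ch)%N -> inner ch 0 i q -> exists2 x, 0 <= x <= len ch & g x = q).
Proof.
move=> hw.
suff: forall m, (m <= nseg ch)%N -> exists g : R -> R * R,
  [/\ forall x y b, `|co b (g x) - co b (g y)| <= `|x - y|,
      g (\sum_(i < m) seglen ch i) = vtx ch m &
      forall i q, (i < m)%N -> inner ch 0 i q ->
        exists2 x, 0 <= x <= \sum_(i < m) seglen ch i & g x = q].
  by move=> /(_ _ (leqnn _))[g [g1 g2 g3]]; exists g.
elim=> [|m IH] hm.
  by exists (fun=> vtx ch 0); split=> // x y b; rewrite subrr normr0.
have [|g [g1 g2 g3]] := IH; first exact: ltnW.
set l := \sum_(i < m) seglen ch i in g2 g3.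
have l0 : 0 <= l.
  by apply: sumr_ge0 => i _; apply/ltW/(seglen_gt0 hw)/(ltn_trans (ltn_ord i)).
have s0 := seglen_gt0 hw hm.
have ss : sgn ch m * sgn ch m = 1 by case: (sgnP hw hm) => ->; lra.
pose f x := slide (axis ch m) (vtx ch m) (sgn ch m * (x - l)).
have f1 x y b : `|co b (f x) - co b (f y)| <= `|x - y|.
  rewrite /f /slide; have [->|ne] := eqVneq b (axis ch m).
    rewrite !co_mk opprD addrACA subrr add0r -mulrBr.
    rewrite (_ : x - l - (y - l) = x - y); last by ring.
    by case: (sgnP hw hm) => ->; rewrite ?mul1r ?mulN1r ?normrN.
  have -> : b = ~~ axis ch m by move: ne; case: b; case: axis.
  by rewrite !co_mkN subrr normr0.
have fl : f l = vtx ch m.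
  by rewrite /f /slide subrr mulr0 addr0 mkpt_co.
exists (fun x => if x <= l then g x else f x); split.
- have crs x y b : x <= l -> l < y -> `|co b (g x) - co b (f y)| <= `|x - y|.
    move=> hx hy; have := g1 x l b; have := f1 l y b; rewrite g2 fl => a1 a2.
    have := ler_distD (co b (vtx ch m)) (co b (g x)) (co b (f y)).
    rewrite (ler0_norm (_ : x - y <= 0)) in a1 *; last lra.
    rewrite (ler0_norm (_ : l - y <= 0)) in a1; last lra.
    rewrite (ler0_norm (_ : x - l <= 0)) in a2; lra.
  move=> x y b; have [hx|hx] := leP x l; have [hy|hy] := leP y l => //; first exact: crs.
  by rewrite distrC (distrC x); apply: crs.
- have S : \sum_(i < m.+1) seglen ch i = l + seglen ch m by rewrite big_ord_recr.
  rewrite S ifF; last by apply/negbTE; rewrite -ltNge; lra.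
  have e := lat_vtx hw hm; rewrite /lat in e.
  rewrite /f /slide addrAC subrr add0r /seglen /adv mulrA ss mul1r addrC subrK.
  rewrite (_ : co (~~ axis ch m) (vtx ch m) = co (~~ axis ch m) (vtx ch m.+1)); last lra.
  by rewrite mkpt_co.
- move=> i q; rewrite ltnS leq_eqVlt big_ord_recr /= -/l => /orP[/eqP->|hi] hq; last first.
    have [x /andP[x0 xl] gx] := g3 i q hi hq; exists x; last by rewrite xl.
    by rewrite x0; lra.
  case: hq; rewrite /at_first /at_last !if_same => q1 q2 q3.
  have F := advD ch m (vtx ch m) q (vtx ch m.+1); rewrite -/(seglen ch m) in F.
  exists (l + adv ch m (vtx ch m) q); first lra.
  set x := l + adv ch m (vtx ch m) q.
  have qf : f x = q.
    rewrite /f /slide /x addrAC subrr add0r /adv mulrA ss mul1r addrC subrK.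
    rewrite (_ : co (~~ axis ch m) (vtx ch m) = co (~~ axis ch m) q); last by move: q3; rewrite /lat; lra.
    by rewrite mkpt_co.
  have [h|//] := leP x l; have e : x = l by rewrite /x in h *; lra.
  by rewrite -qf e g2 fl.
Qed.

Lemma len_ge0 ch : wf ch -> 0 <= len ch.
Proof. by move=> hw; apply: sumr_ge0 => i _; apply/ltW/(seglen_gt0 hw). Qed.

Lemma len_net ch rho : wf ch -> 0 < rho -> exists (k : nat) (g : nat -> R * R),
  k%:R <= len ch / rho + 1 /\
  forall i q, (i < nseg ch)%N -> inner ch 0 i q -> exists2 j, (j < k)%N & box (g j) rho q.
Proof.
move=> hw rho0; have [g [g1 g2]] := arc hw; have l0 := len_ge0 hw.
have d0 : 0 <= len ch / rho by apply: divr_ge0 => //; apply: ltW.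
exists (Num.truncn (len ch / rho)).+1, (fun j => g (j%:R * rho)); split.
  by rewrite -natr1 lerD2r truncn_le.
move=> i q hi hq; have [x /andP[x0 xl] <-] := g2 i q hi hq.
have y0 : 0 <= x / rho by apply: divr_ge0 => //; apply: ltW.
exists (Num.truncn (x / rho)).
  rewrite ltnS; apply: le_truncn; rewrite ler_pM2r // invr_gt0 //.
move=> b; apply: le_trans (g1 _ _ b) _.
have /andP[t1 t2] := truncn_itv y0.
move: t1 t2; rewrite ler_pdivlMr // ltr_pdivrMr // -natr1 mulrDl mul1r => t1 t2.
by apply/norm_leP; lra.
Qed.

Lemma len_dist ch i j p q b : wf ch -> (i < nseg ch)%N -> (j < nseg ch)%N ->
  inner ch 0 i p -> inner ch 0 j q -> `|co b p - co b q| <= len ch.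
Proof.
move=> hw hi hj hp hq; have [g [g1 g2]] := arc hw.
have [x hx <-] := g2 i p hi hp; have [y hy <-] := g2 j q hj hq.
by apply: le_trans (g1 _ _ _) _; apply/norm_leP; lra.
Qed.

End Chains2.

(** * Covering numbers *)

Section Covers.
Variable R : realType.
Implicit Types (p q z : R * R) (b : bool) (S G E : set (R * R)) (e r s t B : R).

(** A real bound instead of the minimal number can be relaxed and added freely, and indexing by
    [nat] makes families easy to concatenate. [covering_numberP] returns to the covering number. *)
Definition covered S e B : Prop := exists (k : nat) (x : nat -> R * R),
  k%:R <= B /\ forall z, S z -> exists2 j, (j < k)%N & square (x j) e z.

Lemma squareE x e z : square x e z <-> forall b, co b x <= co b z <= co b x + e.
Proof.
rewrite /square /=; split; first by move=> [h1 h2] [].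
by move=> h; split; [exact: (h true) | exact: (h false)].
Qed.

Lemma coveredS S S' e B : S `<=` S' -> covered S' e B -> covered S e B.
Proof. by move=> h [k [x [hk hx]]]; exists k, x; split=> // z /h /hx. Qed.

Lemma covered_le S e B B' : B <= B' -> covered S e B -> covered S e B'.
Proof. by move=> h [k [x [hk hx]]]; exists k, x; split=> //; exact: le_trans h. Qed.

Lemma coveredU S S' e B B' : covered S e B -> covered S' e B' ->
  covered (S `|` S') e (B + B').
Proof.
move=> [k [x [hk hx]]] [k' [x' [hk' hx']]].
exists (k + k')%N, (fun j => if (j < k)%N then x j else x' (j - k)%N); split.
  by rewrite natrD lerD.
move=> z [/hx|/hx'] [j hj sj].
  by exists j; [rewrite ltn_addr | rewrite hj].
by exists (k + j)%N; rewrite ?ltn_add2l // ltnNge leq_addr /= addKn.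
Qed.

Lemma covered0 e : covered set0 e 0.
Proof. by exists 0%N, (fun=> 0). Qed.

Lemma covered_bigU (n : nat) (S : nat -> set (R * R)) e (B : nat -> R) :
  (forall i, (i < n)%N -> covered (S i) e (B i)) ->
  covered [set z | exists2 i, (i < n)%N & S i z] e (\sum_(i < n) B i).
Proof.
elim: n => [|n IH] h.
  by rewrite big_ord0; apply: coveredS (covered0 e) => z [].
rewrite big_ord_recr /=; apply: coveredS (coveredU (IH _) (h n _)) => //.
  move=> z [i]; rewrite ltnS leq_eqVlt => /orP[/eqP->|hi] hz; first by right.
  by left; exists i.
by move=> i hi; apply: h; rewrite ltnS ltnW.
Qed.

Lemma covered_bigU_cst (n : nat) (S : nat -> set (R * R)) e B :
  (forall i, (i < n)%N -> covered (S i) e B) ->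
  covered [set z | exists2 i, (i < n)%N & S i z] e (n%:R * B).
Proof.
by move=> /covered_bigU; rewrite sumr_const card_ord mulr_natl.
Qed.

Lemma covered_box S q r e : 2 * r <= e -> S `<=` box q r -> covered S e 1.
Proof.
move=> hr hS; exists 1%N, (fun=> (q.1 - r, q.2 - r)); split=> // z /hS hz.
exists 0%N => //; apply/squareE => b; move/norm_leP: (hz b).
by case: b => /=; lra.
Qed.

Lemma covered_refine S e B (m : nat) : 0 < e -> (0 < m)%N ->
  covered S (m%:R * e) B -> covered S e (m%:R ^+ 2 * B).
Proof.
move=> e0 m0 [k [x [hk hx]]].
pose S' i := S `&` square (x i) (m%:R * e).
have : covered [set z | exists2 i, (i < k)%N & S' i z] e (k%:R * m%:R ^+ 2).
  apply: covered_bigU_cst => i _.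
  pose S2 (b c : nat) := S' i `&` [set z | (x i).1 + b%:R * e <= z.1 <= (x i).1 + b.+1%:R * e]
    `&` [set z | (x i).2 + c%:R * e <= z.2 <= (x i).2 + c.+1%:R * e].
  have key (u v : R) : u <= v <= u + m%:R * e ->
      exists2 b, (b < m)%N & u + b%:R * e <= v <= u + b.+1%:R * e.
    move=> /andP[h1 h2]; have [h|h] := leP (u + m.-1%:R * e) v.
      by exists m.-1; rewrite ?prednK ?leqnn // h.
    have d0 : 0 <= (v - u) / e by apply: divr_ge0; lra.
    have := truncn_itv d0; rewrite ler_pdivlMr // ltr_pdivrMr // => /andP[t1 t2].
    exists (Num.truncn ((v - u) / e)).
      rewrite -(ltr_nat R) -(ltr_pM2r e0); apply: le_lt_trans t1 _.
      rewrite -(prednK m0) -natr1 mulrDl mul1r; lra.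
    by lra.
  have : covered [set z | exists2 b, (b < m)%N & [set z | exists2 c, (c < m)%N & S2 b c z] z] e (m%:R * (m%:R * 1)).
    apply: covered_bigU_cst => b _; apply: covered_bigU_cst => c _.
    apply: (@covered_box _ ((x i).1 + b%:R * e + e / 2, (x i).2 + c%:R * e + e / 2) (e / 2)).
      lra.
    move=> z [[_ /= h1] /= h2]; move: h1 h2.
    rewrite -[b.+1%:R]natr1 -[c.+1%:R]natr1 !mulrDl !mul1r => h1 h2.
    by case=> /=; apply/norm_leP; lra.
  rewrite mulr1 -expr2; apply: coveredS => z hz.
  have [_ [/key[b hb zb] /key[c hc zc]]] := hz.
  by exists b => //; exists c => //; split=> //; split.
move=> h; apply: coveredS (covered_le _ h).
  by move=> z zS; have [j hj sj] := hx z zS; exists j => //; split.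
by rewrite mulrC ler_wpM2l // exprn_ge0.
Qed.

Lemma covered_nbhd S e r B : 0 < e -> r <= e -> covered S e B ->
  covered [set z | exists2 y, S y & box y r z] e (9 * B).
Proof.
move=> e0 re [k [x [hk hx]]].
(* Growing a square by [e] on every side triples its side. *)
rewrite (_ : 9 = 3%:R ^+ 2 :> R); last by ring.
apply: covered_refine => //.
exists k, (fun j => ((x j).1 - e, (x j).2 - e)); split=> // z [y /hx[j hj sj] hb].
exists j => //; apply/squareE => b; move/squareE: sj => /(_ b).
by have /norm_leP := hb b; case: b => /=; lra.
Qed.

Lemma covered_segment b (a l s : R) e : 0 < e -> 0 <= s ->
  covered [set z | co b z = a /\ l <= co (~~ b) z <= l + s] e (s / e + 1).
Proof.
move=> e0 s0; have d0 : 0 <= s / e by apply: divr_ge0 => //; exact: ltW.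
exists (Num.truncn (s / e)).+1, (fun j => mkpt b a (l + j%:R * e)); split.
  by rewrite -natr1 lerD2r truncn_le.
move=> z /= [za zl]; have y0 : 0 <= (co (~~ b) z - l) / e by apply: divr_ge0; lra.
exists (Num.truncn ((co (~~ b) z - l) / e)).
  by rewrite ltnS; apply: le_truncn; rewrite ler_pM2r ?invr_gt0 //; lra.
have := truncn_itv y0; rewrite ler_pdivlMr // ltr_pdivrMr // -[(Num.truncn _).+1%:R]natr1 [(_ + 1) * _]mulrDl mul1r => h.
apply/squareE => b'; have [->|ne] := eqVneq b' b; first by rewrite co_mk; lra.
have -> : b' = ~~ b by move: ne; clear; case: b; case: b'.
by rewrite co_mkN; lra.
Qed.

(* Each band [d t <= x - y < (d + 1) t] meets an antichain in a piece of diameter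
   [O(t)]. *)
Lemma covered_antichain G (e1 e2 : R) g s t : 0 < t -> 0 <= s ->
  e1 = 1 \/ e1 = -1 -> e2 = 1 \/ e2 = -1 ->
  (forall z, G z -> 0 <= e1 * (z.1 - g.1) <= s /\ 0 <= e2 * (z.2 - g.2) <= s) ->
  (forall z z', G z -> G z' ->
     2 * t <= e1 * (z.1 - z'.1) -> 2 * t <= e2 * (z.2 - z'.2) -> False) ->
  covered G (8 * t) (2 * s / t + 1).
Proof.
move=> t0 s0 h1 h2 hG hA.
pose u z := e1 * (z.1 - g.1) - e2 * (z.2 - g.2) + s.
pose d z := Num.truncn (u z / t).
have u0 z : G z -> 0 <= u z <= 2 * s by move=> /hG; rewrite /u; lra.
have d0 : 0 <= 2 * s / t by apply: divr_ge0; lra.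
pose y n := xget g [set z | G z /\ d z = n].
exists (Num.truncn (2 * s / t)).+1, (fun n => ((y n).1 - 4 * t, (y n).2 - 4 * t)); split.
  by rewrite -natr1 lerD2r truncn_le.
move=> z zG; exists (d z).
  by rewrite ltnS; apply: le_truncn; rewrite ler_pM2r ?invr_gt0 //; have := u0 z zG; lra.
have [yG yd] : G (y (d z)) /\ d (y (d z)) = d z.
  by apply: (@xgetPex _ g [set z' | G z' /\ d z' = d z]); exists z.
move: (y (d z)) yG yd => z' zG' e.
have /andP[u1 _] := u0 z zG; have /andP[u1' _] := u0 z' zG'.
have v0 : 0 <= u z / t by apply: divr_ge0 => //; exact: ltW.
have v0' : 0 <= u z' / t by apply: divr_ge0 => //; exact: ltW.
have := truncn_itv v0; have := truncn_itv v0'.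
rewrite -/(d z) -/(d z') e !ler_pdivlMr // !ltr_pdivrMr // -[(d _).+1%:R]natr1 mulrDl mul1r.
move=> a1 a2; have A := hA z z' zG zG'; have B := hA z' z zG' zG.
set x := e1 * (z.1 - z'.1) in A *; set y' := e2 * (z.2 - z'.2) in A *.
have E : u z - u z' = x - y' by rewrite /u /x /y'; ring.
have Ex : e1 * (z'.1 - z.1) = - x by rewrite /x; ring.
have Ey : e2 * (z'.2 - z.2) = - y' by rewrite /y'; ring.
rewrite Ex Ey in B.
have [bx by_] : `|x| <= 4 * t /\ `|y'| <= 4 * t.
  have : - t < x - y' < t by lra.
  move: A B; clear -t0 => A B h; rewrite !ler_norml.
  have [X|X] := leP (2 * t) x.
    have [Y|Y] := leP (2 * t) y'; [by case: (A X Y)|lra].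
  have [X'|X'] := leP (2 * t) (- x); last lra.
  have [Y|Y] := leP (2 * t) (- y'); [by case: (B X' Y)|lra].
have unsign (c v : R) : c = 1 \/ c = -1 -> `|c * v| = `|v|.
  by case=> ->; rewrite ?mul1r // mulN1r normrN.
move: bx by_; rewrite !unsign // !ler_norml; clear => bx by_.
by apply/squareE => -[] /=; lra.
Qed.

(* In each quadrant around a point of the net, moving towards that point by [2 t]
   along the diagonal leads [t] deep into the same box; hence the part of [E] in
   the quadrant is an antichain. *)
Lemma covered_shell E T t (k : nat) (g : nat -> R * R) : 0 < T -> 0 < t ->
  (forall z, E z -> exists q j, [/\ (j < k)%N, box (g j) (T / 8) q, box q (T / 2) z &
     forall z', E z' -> ~ box q (T / 2 - t) z']) ->
  covered E (8 * t) (k%:R * (5 * T / t + 4)).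
Proof.
move=> T0 t0 hE.
(* One coordinate of the diagonal move, with [o] the net point. On the far side the gain [2 * t]
   suffices. On the near side [c * (y1 - q) >= - T / 8], which is enough because
   [2 * t <= 5 / 8 * T], the extent of the quadrant. *)
have coord (c y y1 o q q1 : R) : c = 1 \/ c = -1 -> `|q - o| <= T / 8 -> `|q1 - o| <= T / 8 ->
    `|y - q| <= T / 2 -> `|y1 - q1| <= T / 2 -> 0 <= c * (y1 - o) -> 2 * t <= c * (y - y1) ->
    `|y1 - q| <= T / 2 - t.
  move=> he /norm_leP b1 /norm_leP b2 /norm_leP b3 /norm_leP b4 b5 b6; apply/norm_leP.
  by move: he b5 b6 => -[] ->; lra.
pose F j (e1 e2 : R) := [set z | E z /\ [/\ 0 <= e1 * (z.1 - (g j).1), 0 <= e2 * (z.2 - (g j).2) &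
  exists2 q, box (g j) (T / 8) q & box q (T / 2) z /\ forall z', E z' -> ~ box q (T / 2 - t) z']].
(* [5 / 8 = 1 / 8 + 1 / 2]: from the net point to [q], then from [q] to [z]. Four quadrants give
   [5 * T / t + 4]. *)
have hF j e1 e2 : e1 = 1 \/ e1 = -1 -> e2 = 1 \/ e2 = -1 ->
    covered (F j e1 e2) (8 * t) (2 * (5 / 8 * T) / t + 1).
  move=> h1 h2; apply: (@covered_antichain _ e1 e2 (g j)) => //; first lra.
    move=> z [_ [a1 a2 [q bq [qz _]]]].
    have /norm_leP /= := bq true; have /norm_leP /= := bq false.
    have /norm_leP /= := qz true; have /norm_leP /= := qz false.
    by case: h1 => ee1; case: h2 => ee2; subst e1 e2; lra.
  move=> z z' [_ [a1 a2 [q bq [qz nq]]]] [Ez' [a1' a2' [q' bq' [qz' _]]]] X Y.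
  apply: (nq z' Ez').
  by case; [exact: (coord _ _ _ _ _ _ h1 (bq true) (bq' true) (qz true) (qz' true))
           |exact: (coord _ _ _ _ _ _ h2 (bq false) (bq' false) (qz false) (qz' false))].
have o1 : (1 : R) = 1 \/ (1 : R) = -1 by left.
have o2 : (-1 : R) = 1 \/ (-1 : R) = -1 by right.
have h4 : forall j, (j < k)%N -> covered (F j 1 1 `|` F j 1 (-1) `|` F j (-1) 1 `|` F j (-1) (-1)) (8 * t) (5 * T / t + 4).
  move=> j _; have -> : 5 * T / t + 4 = (2 * (5 / 8 * T) / t + 1) + (2 * (5 / 8 * T) / t + 1) +
    (2 * (5 / 8 * T) / t + 1) + (2 * (5 / 8 * T) / t + 1).
    by set v := t^-1; field.
  by do 3 (apply: coveredU; last exact: hF); exact: hF.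
apply: coveredS (covered_bigU_cst h4) => z zE.
have [q [j [hj bq qz nq]]] := hE z zE; exists j => //.
have Q : exists2 q, box (g j) (T / 8) q & box q (T / 2) z /\ forall z', E z' -> ~ box q (T / 2 - t) z' by exists q.
have [X|X] := leP 0 (z.1 - (g j).1); have [Y|Y] := leP 0 (z.2 - (g j).2).
- by left; left; left; split=> //; split=> //; rewrite mul1r.
- by left; left; right; split=> //; split=> //; rewrite ?mul1r // mulN1r oppr_ge0 ltW.
- by left; right; split=> //; split=> //; rewrite ?mul1r // mulN1r oppr_ge0 ltW.
- by right; split=> //; split=> //; rewrite mulN1r oppr_ge0 ltW.
Qed.

End Covers.

(** * Area *)

Section Area.
Variable R : realType.
Implicit Types (p q z : R * R) (b : bool) (r t w e x y : R) (ch : chain R).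
Implicit Types (S U : set (R * R)).
Local Notation RR := (measurableTypeR R * measurableTypeR R)%type.
Local Notation mu := (@lebesgue_measure R \x @lebesgue_measure R)%E.
Local Notation mble := (measurable : set (set RR)).

Lemma mu_rect (i j : interval R) b (a1 b1 a2 b2 : R) : a1 <= b1 -> a2 <= b2 ->
  lebesgue_measure ([set` i] : set (measurableTypeR R)) = (b1 - a1)%:E ->
  lebesgue_measure ([set` j] : set (measurableTypeR R)) = (b2 - a2)%:E ->
  mble [set z | co b z \in i /\ co (~~ b) z \in j] /\
  mu [set z | co b z \in i /\ co (~~ b) z \in j] = ((b1 - a1) * (b2 - a2))%:E.
Proof.
move=> h1 h2 mi mj.
have m1 : measurable ([set` i] : set (measurableTypeR R)) by exact: measurable_itv.
have m2 : measurable ([set` j] : set (measurableTypeR R)) by exact: measurable_itv.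
case: b => /=.
  have -> : [set z : R * R | z.1 \in i /\ z.2 \in j] = [set` i] `*` [set` j] by [].
  split; first exact: measurableX.
  apply: etrans (product_measure1E lebesgue_measure lebesgue_measure m1 m2) _.
  by rewrite EFinM; congr (_ * _)%E; [exact: mi | exact: mj].
have -> : [set z : R * R | z.2 \in i /\ z.1 \in j] = [set` j] `*` [set` i].
  by apply/seteqP; split=> z [].
split; first exact: measurableX.
apply: etrans (product_measure1E lebesgue_measure lebesgue_measure m2 m1) _.
by rewrite mulrC EFinM; congr (_ * _)%E; [exact: mj | exact: mi].
Qed.

Definition rect b (a1 b1 a2 b2 : R) : set (R * R) :=
  [set z | a1 <= co b z <= b1 /\ a2 <= co (~~ b) z <= b2].
Definition orect b (a1 b1 a2 b2 : R) : set (R * R) :=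
  [set z | a1 < co b z < b1 /\ a2 < co (~~ b) z < b2].

Lemma rectP b (a1 b1 a2 b2 : R) : a1 <= b1 -> a2 <= b2 ->
  mble (rect b a1 b1 a2 b2) /\ mu (rect b a1 b1 a2 b2) = ((b1 - a1) * (b2 - a2))%:E.
Proof.
move=> h1 h2; have -> : rect b a1 b1 a2 b2 = [set z | co b z \in `[a1, b1] /\ co (~~ b) z \in `[a2, b2]].
  by apply/seteqP; split=> z; rewrite /rect /= !in_itv /=.
apply: mu_rect => //; rewrite lebesgue_measure_itv /= lte_fin.
  by case: ltgtP h1 => // ->; rewrite subrr.
by case: ltgtP h2 => // ->; rewrite subrr.
Qed.

Lemma orectP b (a1 b1 a2 b2 : R) : a1 <= b1 -> a2 <= b2 ->
  mble (orect b a1 b1 a2 b2) /\ mu (orect b a1 b1 a2 b2) = ((b1 - a1) * (b2 - a2))%:E.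
Proof.
move=> h1 h2; have -> : orect b a1 b1 a2 b2 = [set z | (co b z \in `]a1, b1[) /\ (co (~~ b) z \in `]a2, b2[)].
  by apply/seteqP; split=> z; rewrite /orect /= !in_itv /=.
apply: mu_rect => //; rewrite lebesgue_measure_itv /= lte_fin.
  by case: ltgtP h1 => // ->; rewrite subrr.
by case: ltgtP h2 => // ->; rewrite subrr.
Qed.

(* An upper bound on the outer area, which avoids measurability side conditions. *)
Definition area_le S x : Prop :=
  exists U, [/\ mble U, S `<=` U & (mu U <= x%:E)%E].

Lemma area_leS S S' x x' : S `<=` S' -> x <= x' -> area_le S' x -> area_le S x'.
Proof.
move=> h hx [U [mU hU hu]]; exists U; split=> //; first exact: subset_trans hU.
by apply: le_trans hu _; rewrite lee_fin.
Qed.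

Lemma area_leU S S' x x' : area_le S x -> area_le S' x' -> area_le (S `|` S') (x + x').
Proof.
move=> [U [mU hU hu]] [U' [mU' hU' hu']]; exists (U `|` U'); split.
- exact: measurableU.
- exact: setUSS.
- by apply: le_trans (measureU2 _ mU mU') _; rewrite EFinD leeD.
Qed.

Lemma area_le0 : area_le set0 0.
Proof. by exists set0; split=> //; rewrite measure0. Qed.

Lemma area_le_bigU (n : nat) (S : nat -> set (R * R)) (x : nat -> R) :
  (forall i, (i < n)%N -> area_le (S i) (x i)) ->
  area_le [set z | exists2 i, (i < n)%N & S i z] (\sum_(i < n) x i).
Proof.
elim: n => [|n IH] h.
  by rewrite big_ord0; apply: area_leS area_le0 => // z [].
rewrite big_ord_recr /=; apply: area_leS (area_leU (IH _) (h n _)) => //.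
  move=> z [i]; rewrite ltnS leq_eqVlt => /orP[/eqP->|hi] hz; first by right.
  by left; exists i.
by move=> i hi; apply: h; rewrite ltnS ltnW.
Qed.

Lemma area_le_bigU_cst (n : nat) (S : nat -> set (R * R)) x :
  (forall i, (i < n)%N -> area_le (S i) x) ->
  area_le [set z | exists2 i, (i < n)%N & S i z] (n%:R * x).
Proof. by move=> /area_le_bigU; rewrite sumr_const card_ord mulr_natl. Qed.

Lemma area_le_rect b (a1 b1 a2 b2 : R) : a1 <= b1 -> a2 <= b2 ->
  area_le (rect b a1 b1 a2 b2) ((b1 - a1) * (b2 - a2)).
Proof.
by move=> h1 h2; have [m e] := rectP b h1 h2; exists (rect b a1 b1 a2 b2); split=> //; rewrite e.
Qed.

Lemma area_le_box q r : 0 <= r -> area_le (box q r) ((2 * r) ^+ 2).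
Proof.
move=> r0; apply: area_leS (@area_le_rect true (q.1 - r) (q.1 + r) (q.2 - r) (q.2 + r) _ _).
- move=> z h; have /norm_leP := h true; have /norm_leP := h false => /= h1 h2.
  by split=> /=; lra.
- rewrite le_eqVlt; apply/orP; left; apply/eqP; ring.
- lra.
- lra.
Qed.

Lemma area_le_covered S e (B : R) : 0 <= e -> covered S e B -> area_le S (B * e ^+ 2).
Proof.
move=> e0 [k [x [hk hx]]].
have : area_le [set z | exists2 i, (i < k)%N & square (x i) e z] (k%:R * e ^+ 2).
  apply: area_le_bigU_cst => i _.
  apply: area_leS (@area_le_rect true (x i).1 ((x i).1 + e) (x i).2 ((x i).2 + e) _ _) => //.
  - by rewrite le_eqVlt; apply/orP; left; apply/eqP; ring.
  - lra.
  - lra.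
by move=> h; apply: area_leS h; [move=> z; exact: hx | rewrite ler_wpM2r // sqr_ge0].
Qed.

Lemma cell_hi_lo ch t i : wf ch -> roomy ch t -> 0 <= t -> (i < nseg ch)%N ->
  cell_lo t i <= cell_hi ch t i.
Proof.
move=> hw hr ht hi; have := hr i hi; have := seglen_gt0 hw hi.
rewrite /cell_lo /cell_hi /at_first /at_last.
by case: ifP => _; case: ifP => _; lra.
Qed.

(** The forward push only transfers a length [t / 2] from each segment to the preceding cell, so the
    total length is unchanged. *)
Lemma sum_cells ch t : wf ch -> \sum_(i < nseg ch) (cell_hi ch t i - cell_lo t i) * t = t * len ch.
Proof.
move=> hw; have h0 := nseg_gt0 hw; rewrite -mulr_suml mulrC; congr (_ * _).
rewrite (eq_bigr (fun i : 'I_(nseg ch) => seglen ch i + at_first i (t / 2) - at_last ch i (t / 2))); last first.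
  move=> i _; rewrite /cell_hi /cell_lo /at_first /at_last.
  by case: ifP => _; case: ifP => _; lra.
rewrite sumrB big_split /= /at_first /at_last -!big_mkcond /=.
have h1 : ((nseg ch).-1 < nseg ch)%N by rewrite prednK.
rewrite [X in _ + X - _](big_pred1 (Ordinal h0)); last by move=> i /=; rewrite -val_eqE.
rewrite [X in _ - X](big_pred1 (Ordinal h1)); last by move=> i /=; rewrite -val_eqE.
by rewrite addrK.
Qed.

Lemma slab_rect ch i (lo hi h : R) : wf ch -> (i < nseg ch)%N -> lo <= hi ->
  exists a1 b1 : R, [/\ a1 <= b1, b1 - a1 = hi - lo,
    [set z | [/\ lo <= adv ch i (vtx ch i) z, adv ch i (vtx ch i) z <= hi &
              `|lat ch i (vtx ch i) z| <= h]] =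
      rect (axis ch i) a1 b1 (co (~~ axis ch i) (vtx ch i) - h)
                             (co (~~ axis ch i) (vtx ch i) + h) &
    [set z | [/\ lo < adv ch i (vtx ch i) z, adv ch i (vtx ch i) z < hi &
              `|lat ch i (vtx ch i) z| < h]] =
      orect (axis ch i) a1 b1 (co (~~ axis ch i) (vtx ch i) - h)
                              (co (~~ axis ch i) (vtx ch i) + h)].
Proof.
move=> hw hin hl; set u := co (axis ch i) (vtx ch i).
have L z : `|lat ch i (vtx ch i) z| <= h <->
    co (~~ axis ch i) (vtx ch i) - h <= co (~~ axis ch i) z <=
    co (~~ axis ch i) (vtx ch i) + h.
  by rewrite norm_leP /lat; split=> ?; lra.
have L' z : `|lat ch i (vtx ch i) z| < h <->
    co (~~ axis ch i) (vtx ch i) - h < co (~~ axis ch i) z <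
    co (~~ axis ch i) (vtx ch i) + h.
  by rewrite ltr_norml /lat; split=> ?; lra.
case: (sgnP hw hin) => e.
  exists (u + lo), (u + hi); split; [lra|lra|apply/seteqP; split=> z|apply/seteqP; split=> z].
  - by case; rewrite /adv e -/u => h1 h2 /L; split=> //; lra.
  - by case=> h' /L; split=> //; rewrite /adv e -/u; lra.
  - by case; rewrite /adv e -/u => h1 h2 /L'; split=> //; lra.
  - by case=> h' /L'; split=> //; rewrite /adv e -/u; lra.
exists (u - hi), (u - lo); split; [lra|lra|apply/seteqP; split=> z|apply/seteqP; split=> z].
- by case; rewrite /adv e -/u => h1 h2 /L; split=> //; lra.
- by case=> h' /L; split=> //; rewrite /adv e -/u; lra.
- by case; rewrite /adv e -/u => h1 h2 /L'; split=> //; lra.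
- by case=> h' /L'; split=> //; rewrite /adv e -/u; lra.
Qed.

Lemma cell_rect ch t i : wf ch -> (i < nseg ch)%N -> cell_lo t i <= cell_hi ch t i ->
  exists a1 b1 : R, [/\ a1 <= b1, b1 - a1 = cell_hi ch t i - cell_lo t i,
    cell ch t i = rect (axis ch i) a1 b1 (co (~~ axis ch i) (vtx ch i) - t / 2)
                       (co (~~ axis ch i) (vtx ch i) + t / 2) &
    ocell ch t i = orect (axis ch i) a1 b1 (co (~~ axis ch i) (vtx ch i) - t / 2)
                       (co (~~ axis ch i) (vtx ch i) + t / 2)].
Proof. by move=> hw hi hl; apply: slab_rect. Qed.

Lemma area_le_strip ch t : wf ch -> roomy ch t -> 0 <= t ->
  area_le (pstrip ch t) (t * len ch).
Proof.
move=> hw hr ht; rewrite -(sum_cells t hw).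
apply: (@area_leS _ [set z | exists2 i, (i < nseg ch)%N & cell ch t i z]) => [z hz||].
  exact: pstrip_cell.
  exact: lexx.
apply: (@area_le_bigU (nseg ch) (cell ch t) (fun i => (cell_hi ch t i - cell_lo t i) * t)) => i hi.
have [a1 [b1 [h1 h2 -> _]]] := cell_rect hw hi (cell_hi_lo hw hr ht hi).
have h3 : co (~~ axis ch i) (vtx ch i) - t / 2 <= co (~~ axis ch i) (vtx ch i) + t / 2 by lra.
apply: area_leS (area_le_rect (axis ch i) h1 h3) => //.
rewrite h2 ler_wpM2l ?subr_ge0 ?cell_hi_lo //; lra.
Qed.

Definition ostrip ch t : set (R * R) := [set z | exists2 i, (i < nseg ch)%N & ocell ch t i z].

Lemma ostrip_sub ch t : wf ch -> 0 <= t -> ostrip ch t `<=` pstrip ch t.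
Proof.
by move=> hw ht z [i hi /ocell_sub hz]; exists i => //; apply: cell_ppiece.
Qed.

Lemma ostrip_area ch t : wf ch -> roomy ch t -> simple ch t -> 0 <= t ->
  mble (ostrip ch t) /\ mu (ostrip ch t) = (t * len ch)%:E.
Proof.
move=> hw hr hs ht.
have E : ostrip ch t = \big[setU/set0]_(i < nseg ch) ocell ch t i.
  rewrite -bigcup_mkord; apply/seteqP; split=> z [i hi hz]; by exists i.
have F i : (i < nseg ch)%N -> mble (ocell ch t i) /\
    mu (ocell ch t i) = ((cell_hi ch t i - cell_lo t i) * t)%:E.
  move=> hi; have [a1 [b1 [h1 h2 _ ->]]] := cell_rect hw hi (cell_hi_lo hw hr ht hi).
  have h3 : co (~~ axis ch i) (vtx ch i) - t / 2 <= co (~~ axis ch i) (vtx ch i) + t / 2 by lra.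
  have [m e] := orectP (axis ch i) h1 h3; split=> //; rewrite e h2.
  by rewrite (_ : co _ _ + _ - _ = t) //; lra.
rewrite E; split.
  by apply: bigsetU_measurable => i _; case: (F i (ltn_ord i)).
have := @measure_bigsetU_ord_cond _ _ _ mu (nseg ch) xpredT (fun i => ocell ch t i).
move=> ->.
- rewrite (eq_bigr (fun i : 'I_(nseg ch) => ((cell_hi ch t i - cell_lo t i) * t)%:E)); last first.
    by move=> i _; case: (F i (ltn_ord i)).
  by rewrite sumEFin sum_cells.
- by move=> i _; case: (F i (ltn_ord i)).
- apply/trivIsetP => i j _ _ ij; rewrite -subset0 => z [zi zj].
  have : (i != j :> nat) by [].
  rewrite neq_ltn => /orP[] lij.
    exact: (@ocell_disjoint _ ch t i j z).
  exact: (@ocell_disjoint _ ch t j i z).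
Qed.

Lemma ostrip_le ch t S x : wf ch -> roomy ch t -> simple ch t -> 0 <= t ->
  ostrip ch t `<=` S -> area_le S x -> t * len ch <= x.
Proof.
move=> hw hr hs ht h [U [mU hU hu]]; have [m e] := ostrip_area hw hr hs ht.
rewrite -lee_fin -e; apply: le_trans hu; apply: le_measure; rewrite ?inE //.
exact: subset_trans hU.
Qed.

Lemma ostrip2_le ch t ch' t' S x :
  wf ch -> roomy ch t -> simple ch t -> 0 <= t ->
  wf ch' -> roomy ch' t' -> simple ch' t' -> 0 <= t' ->
  ostrip ch t `&` ostrip ch' t' = set0 ->
  ostrip ch t `<=` S -> ostrip ch' t' `<=` S -> area_le S x ->
  t * len ch + t' * len ch' <= x.
Proof.
move=> hw hr hs ht hw' hr' hs' ht' dj h h' [U [mU hU hu]].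
have [m e] := ostrip_area hw hr hs ht; have [m' e'] := ostrip_area hw' hr' hs' ht'.
rewrite -lee_fin EFinD -e -e'; apply: le_trans hu.
rewrite -(measureU _ m m' dj); apply: le_measure; rewrite ?inE //.
  exact: measurableU.
by move=> z [/h|/h'] /hU.
Qed.

End Area.

(** * Chains from centre lines *)

Section Topology.
Variable R : realType.
Implicit Types (q z : R * R) (A : set (R * R)) (r : R).

Lemma nbhs_boxP q A : nbhs q A <-> exists2 r, 0 < r & box q r `<=` A.
Proof.
split=> [/nbhs_ballP[r /= r0 h]|[r r0 h]].
  exists (r / 2); first lra.
  move=> y hy; apply: h; split; rewrite /ball /= distrC.
    by apply: le_lt_trans (hy true) _; lra.
  by apply: le_lt_trans (hy false) _; lra.
apply/nbhs_ballP; exists r => // y [h1 h2]; apply: h.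
by case; rewrite distrC; apply: ltW.
Qed.

Lemma interior_boxP A z : A° z <-> exists2 r, 0 < r & box z r `<=` A.
Proof. exact: nbhs_boxP. Qed.

Lemma closure_boxP A z : closure A z <-> forall r, 0 < r -> exists2 y, A y & box z r y.
Proof.
split=> [h r r0|h B /nbhs_boxP[r r0 hB]].
  have [|y [Ay zy]] := h (box z r); last by exists y.
  by apply/nbhs_boxP; exists r.
by have [y Ay zy] := h r r0; exists y; split=> //; apply: hB.
Qed.

Lemma box_refl q r : 0 <= r -> box q r q.
Proof. by move=> h b; rewrite subrr normr0. Qed.

Lemma closed_boxP A : (forall z, (forall r, 0 < r -> exists2 y, A y & box z r y) -> A z) ->
  closed A.
Proof.
move=> h; apply/closure_id/seteqP; split; first exact: subset_closure.
by move=> z /closure_boxP; exact: h.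
Qed.

Lemma closed_sep A z : closed A -> ~ A z -> exists2 r, 0 < r & forall y, box z r y -> ~ A y.
Proof.
move=> cA nA; apply: contrapT => h; apply: nA; rewrite (iffLR (closure_id _) cA).
apply/closure_boxP => r r0; apply: contrapT => h'; apply: h; exists r => // y hy Ay.
by apply: h'; exists y.
Qed.

Lemma closed_rect b (a1 b1 a2 b2 : R) : closed (rect b a1 b1 a2 b2).
Proof.
have le_lim (f g : R) : (forall r, 0 < r -> f <= g + r) -> f <= g.
  move=> h; have [//|k] := leP f g; have : 0 < (f - g) / 2 by lra.
  by move/h; lra.
apply: closed_boxP => z h; split; apply/andP; split; apply: le_lim => r r0;
  have [y [h1 h2] /[dup] /(_ b) /norm_leP ? /(_ (~~ b)) /norm_leP ?] := h r r0; lra.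
Qed.

Lemma boxE_rect q r : box q r = rect true (q.1 - r) (q.1 + r) (q.2 - r) (q.2 + r).
Proof.
apply/seteqP; split=> z.
  by move=> h; have /norm_leP /= := h true; have /norm_leP /= := h false; split=> /=; lra.
by case=> /= h1 h2; case=> /=; apply/norm_leP; lra.
Qed.

Lemma closed_ppiece (ch : chain R) w i : wf ch -> (i < nseg ch)%N -> closed (ppiece ch w i).
Proof.
move=> hw hi; have l0 := ltW (seglen_gt0 hw hi).
have -> : ppiece ch w i =
    [set z | [/\ 0 <= adv ch i (vtx ch i) z, adv ch i (vtx ch i) z <= seglen ch i &
              `|lat ch i (vtx ch i) z| <= w / 2]] `|`
    ((if (0 < i)%N then box (vtx ch i) (w / 2) else set0) `|`
     (if (i.+1 < nseg ch)%N then box (vtx ch i.+1) (w / 2) else set0)).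
  have F z : 0 <= adv ch i z (vtx ch i.+1) <-> adv ch i (vtx ch i) z <= seglen ch i.
    have := advD ch i (vtx ch i) z (vtx ch i.+1); rewrite -/(seglen ch i).
    by split; lra.
  apply/seteqP; split=> z.
    case=> [[h1 /F h2 h3]|[h1 h2]|[h1 h2]]; first by left.
      by right; left; rewrite h1.
    by right; right; rewrite h1.
  case=> [[h1 /F h2 h3]|[]]; first by apply: Or31.
    by case: ifP => // h1 h2; apply: Or32.
  by case: ifP => // h1 h2; apply: Or33.
have [a1 [b1 [_ _ -> _]]] := slab_rect (w / 2) hw hi l0.
apply: closedU; first exact: closed_rect.
by apply: closedU; case: ifP => _; rewrite ?boxE_rect; (exact: closed_rect || exact: closed0).
Qed.

Lemma closed_pstrip (ch : chain R) w : wf ch -> closed (pstrip ch w).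
Proof.
move=> hw.
have -> : pstrip ch w = \big[setU/set0]_(i < nseg ch) ppiece ch w i.
  rewrite -bigcup_mkord; apply/seteqP; split=> z [i hi hz]; by exists i.
by apply: closed_bigsetU => i _; apply: closed_ppiece.
Qed.

Lemma closed_unit_squareE : @closed_unit_square R = rect true 0 1 0 1.
Proof. by apply/seteqP; split=> z. Qed.

End Topology.


Section Links.
Variable R : realType.
Implicit Types (ch : chain R) (c : seq (R * R)) (w r t : R).

Lemma straightP ch i w z : wf ch -> (i < nseg ch)%N -> 
  straight (vtx ch i) (vtx ch i.+1) w z <->
  [/\ 0 <= adv ch i (vtx ch i) z, 0 <= adv ch i z (vtx ch i.+1) &
      `|lat ch i (vtx ch i) z| <= w / 2].
Proof.
move=> hw hi; have := lat_vtx hw hi; have := seglen_gt0 hw hi.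
rewrite /straight /seglen /adv /lat /=.
by case: (axis ch i); case: (sgnP hw hi) => -> /=; rewrite ?mul1r ?mulN1r => h1 h2;
  [rewrite [Num.min (vtx ch i).1 _]min_l ?[Num.max (vtx ch i).1 _]max_r; try lra
  |rewrite [Num.min (vtx ch i).1 _]min_r ?[Num.max (vtx ch i).1 _]max_l; try lra
  |rewrite [Num.min (vtx ch i).2 _]min_l ?[Num.max (vtx ch i).2 _]max_r; try lra
  |rewrite [Num.min (vtx ch i).2 _]min_r ?[Num.max (vtx ch i).2 _]max_l; try lra];
  (split; [case=> -[e1 [e2 e3]]; [split=> //; lra | split=> //; lra]
          |case=> e1 e2 e3; (left; split; [lra|split=> //; lra]) || (right; split; [lra|split=> //; lra])]).
Qed.

Lemma seg_lenE ch i : wf ch -> (i < nseg ch)%N ->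
  seg_len (vtx ch i) (vtx ch i.+1) = seglen ch i.
Proof.
move=> hw hi; have e := lat_vtx hw hi; have := seglen_gt0 hw hi => h.
have n := adv_norm hw (vtx ch i) (vtx ch i.+1) hi; rewrite -/(seglen ch i) gtr0_norm // in n.
rewrite n /seg_len; move: e; rewrite /lat.
case: (axis ch i) => /= e; [have -> : (vtx ch i).2 - (vtx ch i.+1).2 = 0 by lra|have -> : (vtx ch i).1 - (vtx ch i.+1).1 = 0 by lra].
  by rewrite normr0 addr0 distrC.
by rewrite normr0 add0r distrC.
Qed.

Definition represents ch c : Prop :=
  size c = (nseg ch).+1 /\ forall i, (i <= nseg ch)%N -> vertex c i = vtx ch i.

Lemma piece_represents ch c w i z : wf ch -> represents ch c -> (i < nseg ch)%N ->
  piece c w i z <-> ppiece ch w i z.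
Proof.
move=> hw [hs hv] hi; have cornerE v y : corner v w y <-> box v (w / 2) y.
  by split=> [[h1 h2] []|h] //; split; [exact: (h true)|exact: (h false)].
rewrite /piece /ppiece hs !ltnS !hv //=; last exact: ltnW.
split; case.
- by move=> h; apply: Or31; have := iffLR (straightP w z hw hi) h.
- by case=> h1 /cornerE h2; apply: Or32.
- by case=> h1 /cornerE h2; apply: Or33.
- by move=> h; apply: Or31; have := iffRL (straightP w z hw hi) h.
- by case=> h1 /cornerE h2; apply: Or32.
- by case=> h1 /cornerE h2; apply: Or33.
Qed.

Lemma strip_represents ch c w : wf ch -> represents ch c -> strip c w = pstrip ch w.
Proof.
move=> hw hc; have [hs hv] := hc; apply/seteqP; split=> z [i]; rewrite ?hs ?ltnS => hi hz.
  by exists i => //; apply/(piece_represents _ _ hw hc).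
by exists i; [rewrite hs | apply/(piece_represents _ _ hw hc)].
Qed.

Definition chain_of c : chain R :=
  Chain (size c).-1 (vertex c) (horizontal c)
    (fun i => if co (horizontal c i) (vertex c i) < co (horizontal c i) (vertex c i.+1)
              then 1 else -1).

Lemma chain_of_represents c : (0 < size c)%N -> represents (chain_of c) c.
Proof. by move=> h; split=> //=; rewrite prednK. Qed.

Lemma chain_of_wf c t : centre_line c t -> wf (chain_of c).
Proof.
case=> h1 h2 h3 h4 h5; split=> /=; first lia.
- by move=> i hi; case: ifP => _; [left|right].
- move=> i hi; rewrite /lat /=; have : horizontal c i (+) vertical c i by apply: h2; lia.
  case hh: (horizontal c i) => /= hv; first by move/eqP: hh => ->; rewrite subrr.
  by move/eqP: hv => ->; rewrite subrr.
- move=> i hi; rewrite /seglen /adv /=; have : horizontal c i (+) vertical c i by apply: h2; lia.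
  case hh: (horizontal c i) => /= hv.
    by move: hv; rewrite /vertical; case: (ltgtP (vertex c i).1 (vertex c i.+1).1) => //; lra.
  by move/negbT: hh; rewrite /horizontal; case: (ltgtP (vertex c i).2 (vertex c i.+1).2) => //; lra.
- move=> i hi; have /= := h3 i; case: (horizontal c i); case: (horizontal c i.+1) => //= /(_ ltac:(lia)) //.
Qed.

Lemma chain_of_simple c t : centre_line c t -> simple (chain_of c) t.
Proof.
move=> hc; have hw := chain_of_wf hc; case: hc => h1 h2 h3 h4 h5.
have hr : represents (chain_of c) c by apply: chain_of_represents; lia.
move=> i j ij hj [z [zi zj]].
have sj : (j.+1 < size c)%N by rewrite /= in hj; lia.
have hi := ltn_trans ij hj.
have hm : monotone_between c i j.
  by apply: h5 => //; exists z; split; apply/(piece_represents _ _ hw hr).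
move=> k l hk hl e.
have hk' : (k < nseg (chain_of c))%N by lia.
have hl' : (l < nseg (chain_of c))%N by lia.
have := seglen_gt0 hw hk'; have := seglen_gt0 hw hl'.
have [m1 m2] := hm k l hk hl.
have {m1 m2} : 0 <= (co (axis (chain_of c) k) (vtx (chain_of c) k.+1) - co (axis (chain_of c) k) (vtx (chain_of c) k))
  * (co (axis (chain_of c) l) (vtx (chain_of c) l.+1) - co (axis (chain_of c) l) (vtx (chain_of c) l)).
  by rewrite -e; case: (axis (chain_of c) k).
rewrite /seglen /adv.
by case: (sgnP hw hk') => ->; case: (sgnP hw hl') => ->; nra.
Qed.

(** With several segments the two end segments are distinct, and [centre_line] makes each longer
    than [t / 2]. A single segment has to provide [t / 2] at both ends, whence the bound on the
    length. *)
Lemma chain_of_roomy c t : centre_line c t -> t <= len (chain_of c) ->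
  0 <= t -> roomy (chain_of c) t.
Proof.
move=> hc hl t0 i hi; have hw := chain_of_wf hc; have [h1 h2 h3 h4 h5] := hc.
have s0 := seglen_gt0 hw hi.
have [e|ne] := eqVneq (nseg (chain_of c)) 1%N.
  have i0 : i = 0%N by lia.
  move: hl; rewrite /len e big_ord1 /= -i0 => hl.
  rewrite /at_first /at_last e i0 /=; rewrite i0 in hl; lra.
have hsz : (2 < size c)%N by move: ne hi; rewrite /=; lia.
have [h6 h7] := h4 hsz.
rewrite /at_first /at_last; case: eqP => [e|_].
  have -> : (i == (nseg (chain_of c)).-1) = false by apply/negP => /eqP; lia.
  move: h6; rewrite (_ : seg_len _ _ = seglen (chain_of c) i); last first.
    by rewrite -seg_lenE // e.
  lra.
case: eqP => [e|_]; last lra.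
move: h7; rewrite (_ : seg_len _ _ = seglen (chain_of c) i); last first.
  rewrite -seg_lenE // e /=; congr (seg_len (vertex _ _) (vertex _ _)); lia.
lra.
Qed.

Lemma move_towards_next ch i r : wf ch -> (i < nseg ch)%N ->
  move_towards (vtx ch i) (vtx ch i.+1) r = slide (axis ch i) (vtx ch i) (sgn ch i * r).
Proof.
move=> hw hi; rewrite /move_towards seg_lenE //.
have := seglen_gt0 hw hi; have := lat_vtx hw hi.
rewrite /seglen /adv /lat /slide /mkpt /co.
case: (axis ch i) => /= -> h.
  rewrite mulr0 addr0; congr (_ , _); case: (sgnP hw hi) h => -> h; field; lra.
rewrite mulr0 addr0; congr (_ , _); case: (sgnP hw hi) h => -> h; field; lra.
Qed.

Lemma move_towards_prev ch i r : wf ch -> (i < nseg ch)%N ->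
  move_towards (vtx ch i.+1) (vtx ch i) r = slide (axis ch i) (vtx ch i.+1) (- (sgn ch i * r)).
Proof.
move=> hw hi; rewrite /move_towards (_ : seg_len _ _ = seglen ch i); last first.
  by rewrite -seg_lenE // /seg_len distrC [X in _ + X]distrC.
have := seglen_gt0 hw hi; have := lat_vtx hw hi; have := latC ch i (vtx ch i.+1) (vtx ch i).
rewrite /seglen /adv /lat /slide /mkpt /co.
case: (axis ch i) => /= -> -> h.
  rewrite oppr0 mulr0 addr0; congr (_ , _); case: (sgnP hw hi) h => -> h; field; lra.
rewrite oppr0 mulr0 addr0; congr (_ , _); case: (sgnP hw hi) h => -> h; field; lra.
Qed.

Lemma vertex_trim_first c r i : (1 < size c)%N -> vertex (trim_first c r) i =
  if i == 0%N then move_towards (vertex c 0) (vertex c 1) r else vertex c i.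
Proof. by case: c => [|u [|v s]] // _; case: i. Qed.

Lemma size_trim_first c r : size (trim_first c r) = size c.
Proof. by case: c => [|u [|v s]]. Qed.

Lemma size_trim_last c r : size (trim_last c r) = size c.
Proof. by rewrite /trim_last size_rev size_trim_first size_rev. Qed.

Lemma vertex_rev c i : (i < size c)%N -> vertex (rev c) i = vertex c (size c - i.+1).
Proof. exact: nth_rev. Qed.

Lemma vertex_trim_last c r i : (1 < size c)%N -> (i < size c)%N ->
  vertex (trim_last c r) i =
  if i == (size c).-1 then move_towards (vertex c (size c).-1) (vertex c (size c).-2) r
  else vertex c i.
Proof.
move=> hc hi; rewrite /trim_last vertex_rev ?size_trim_first ?size_rev //.
rewrite vertex_trim_first ?size_rev // !vertex_rev; try lia.
rewrite !subn1 subn2.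
have -> : (size c - i.+1 == 0)%N = (i == (size c).-1) by apply/eqP/eqP; lia.
by case: ifP => // _; congr vertex; lia.
Qed.

Lemma trim_last_represents ch c r : wf ch -> represents ch c ->
  represents (trim ch 0 r) (trim_last c r).
Proof.
move=> hw [hs hv]; have h0 := nseg_gt0 hw; split; first by rewrite size_trim_last.
move=> i hi; rewrite /= in hi; rewrite vertex_trim_last hs //= !hv //; last lia.
case: eqP => [->|ne] /=.
  have -> : (nseg ch == 0)%N = false by apply/negP => /eqP; lia.
  have := @move_towards_prev ch (nseg ch).-1 r hw.
  by rewrite prednK // leqnn => /(_ isT).
case: eqP => [->|_]; last by [].
by rewrite mulr0 /slide addr0 mkpt_co.
Qed.

Lemma trim_first_represents ch c r0 r : wf (trim ch 0 r) -> represents (trim ch 0 r) c ->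
  represents (trim ch r0 r) (trim_first c r0).
Proof.
move=> hw hc; have [hs hv] := hc; have h0 := nseg_gt0 hw; rewrite /= in h0.
split; first by rewrite size_trim_first.
move=> i hi; rewrite /= in hi; rewrite vertex_trim_first ?hs //=.
case: eqP => [e|ne]; last by rewrite hv //=; case: eqP.
rewrite !hv // move_towards_next //= mulr0 /slide addr0 mkpt_co.
by [].
Qed.

End Links.

(** * The days of the construction *)

Section Days.
Variable R : realType.
Implicit Types (ch : chain R) (c : seq (R * R)) (w r t T : R) (p q z : R * R) (X : set (R * R)).

(* The shape of the piece that connects a peak point to the middle of the strip;
   [connector] does not exclude that it protrudes from an end of the strip. *)
Definition connector ch T (P : set (R * R)) X : Prop :=
  exists a1 b1 a2 b2 : R, exists p q i,
  [/\ a1 <= b1 < a1 + T, a2 <= b2 < a2 + T, X = rect true a1 b1 a2 b2,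
      P p /\ X `<=` box p (T / 2) &
      [/\ (i < nseg ch)%N, inner ch 0 i q & X `<=` box q (T / 2)]].

Lemma straight_connector ch T w P c p q i : wf ch -> represents ch c -> 
  (forall i, (i < nseg ch)%N -> horizontal c i = axis ch i) ->
  0 < w < T -> P p -> across c T p q i -> connector ch T P (straight p q w).
Proof.
move=> hw [hs hv] hax /andP[w0 wT] Pp; rewrite /across hs ltnS => -[hi hl].
rewrite hax // !hv //; last exact: ltnW.
have l0 := seglen_gt0 hw hi; have e0 := lat_vtx hw hi.
(* [b] is the coordinate shared by [p] and [q]: the piece has extent [w] in it and [T / 2] in the
   other one. *)
have key : forall b, co b p = co b q -> exists a1 b1 a2 b2 : R,
    [/\ a1 <= b1 < a1 + T, a2 <= b2 < a2 + T, straight p q w = rect true a1 b1 a2 b2 &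
     straight p q w `<=` box p (T / 2) /\ straight p q w `<=` box q (T / 2)].
  have m1 (x y : R) : Num.min x y <= x /\ Num.min x y <= y by rewrite !ge_min !lexx orbT.
  have m2 (x y : R) : x <= Num.max x y /\ y <= Num.max x y by rewrite !le_max !lexx orbT.
  have m3 (x y z : R) : `|x - y| = T / 2 -> Num.max x y = Num.min x y + T / 2 /\
      (Num.min x y <= z <= Num.max x y -> `|z - x| <= T / 2 /\ `|z - y| <= T / 2).
    case: (leP x y) => h e.
      rewrite ler0_norm in e; last lra.
      by split; [lra|move=> h1; split; apply/norm_leP; lra].
    rewrite ger0_norm in e; last lra.
    by split; [lra|move=> h1; split; apply/norm_leP; lra].
  case=> /= e.
    exists (p.1 - w / 2), (p.1 + w / 2), (Num.min p.2 q.2), (Num.max p.2 q.2).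
    have d : `|p.2 - q.2| = T / 2.
      by rewrite -hl /seg_len e subrr normr0 add0r.
    have E : straight p q w = rect true (p.1 - w / 2) (p.1 + w / 2) (Num.min p.2 q.2) (Num.max p.2 q.2).
      apply/seteqP; split=> z.
        case=> -[h1 [h2 /norm_leP h3]]; last by split=> //=; lra.
        by move: d; rewrite h1 subrr normr0; lra.
      by case=> /= h1 h2; right; split=> //; split=> //; apply/norm_leP; lra.
    have [M _] := m3 _ _ p.2 d; split=> //; [lra|rewrite M; lra|].
    by rewrite E; split=> z [/= h1 h2]; have [_ /(_ h2)[? ?]] := m3 _ _ z.2 d; case=> //=; apply/norm_leP; lra.
  exists (Num.min p.1 q.1), (Num.max p.1 q.1), (p.2 - w / 2), (p.2 + w / 2).
  have d : `|p.1 - q.1| = T / 2.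
    by rewrite -hl /seg_len e subrr normr0 addr0.
  have E : straight p q w = rect true (Num.min p.1 q.1) (Num.max p.1 q.1) (p.2 - w / 2) (p.2 + w / 2).
    apply/seteqP; split=> z.
      case=> -[h1 [h2 /norm_leP h3]]; first by split=> //=; lra.
      by move: d; rewrite h1 subrr normr0; lra.
    by case=> /= h1 h2; left; split=> //; split=> //; apply/norm_leP; lra.
  have [M _] := m3 _ _ p.1 d; split=> //; [rewrite M; lra|lra|].
  by rewrite E; split=> z [/= h1 h2]; have [_ /(_ h1)[? ?]] := m3 _ _ z.1 d; case=> //=; apply/norm_leP; lra.
case: ifP => hx [h1 h2 h3].
  have [a1 [b1 [a2 [b2 [E1 E2 E3 [E4 E5]]]]]] := key true h2.
  exists a1, b1, a2, b2, p, q, i; split=> //; split=> //.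
  move: e0 l0 h3; rewrite /inner /seglen /at_first /at_last !if_same /adv /lat hx /= => e0.
  by case: (sgnP hw hi) => -> l0;
    [rewrite min_l ?max_r; try lra | rewrite min_r ?max_l; try lra]; split; lra.
have [a1 [b1 [a2 [b2 [E1 E2 E3 [E4 E5]]]]]] := key false h2.
exists a1, b1, a2, b2, p, q, i; split=> //; split=> //.
move: e0 l0 h3; rewrite /inner /seglen /at_first /at_last !if_same /adv /lat hx /= => e0.
by case: (sgnP hw hi) => -> l0;
  [rewrite min_l ?max_r; try lra | rewrite min_r ?max_l; try lra]; split; lra.
Qed.

Lemma wf_trim_roomy ch T r0 r : wf ch -> roomy ch T -> 0 <= r0 < T / 2 -> 0 <= r < T / 2 ->
  wf (trim ch r0 r).
Proof.
move=> hw hr /andP[? ?] /andP[? ?]; apply: wf_trim => // i hi.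
have := hr i hi; have := seglen_gt0 hw hi; rewrite /at_first /at_last.
by case: ifP => _; case: ifP => _; lra.
Qed.

Variable a : nat -> R.
Hypothesis ha : forall i, (1 <= i)%N -> 2 < a i.

Lemma wall0 : wall a 0 = 1.
Proof. by rewrite /wall big_geq. Qed.

Lemma wallS n : wall a n.+1 = wall a n / a n.+1.
Proof. by rewrite /wall big_nat_recr. Qed.

Lemma wall_gt0 n : 0 < wall a n.
Proof.
elim: n => [|n IH]; first by rewrite wall0.
by rewrite wallS divr_gt0 //; have := @ha n.+1 isT; lra.
Qed.

Lemma wall_half n : 2 * wall a n.+1 < wall a n.
Proof.
have := wall_gt0 n; have := @ha n.+1 isT => h1 h2.
rewrite wallS mulrA ltr_pdivrMr; nra.
Qed.

Lemma wall_lt n : wall a n.+1 < wall a n.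
Proof. have := wall_half n; have := wall_gt0 n.+1; lra. Qed.

Lemma wall_le m n : (m <= n)%N -> wall a n <= wall a m.
Proof.
elim: n => [|n IH]; first by rewrite leqn0 => /eqP->.
rewrite leq_eqVlt => /orP[/eqP->//|/IH]; have := wall_lt n; lra.
Qed.

Lemma wall_le1 n : wall a n <= 1.
Proof. by rewrite -wall0; apply: wall_le. Qed.

Lemma wall_lt_half n : (1 <= n)%N -> wall a n < 1 / 2.
Proof.
by case: n => // n _; have := wall_half n; have := wall_le1 n; lra.
Qed.

Lemma widthS n : width a n.+1 = wall a n - 2 * wall a n.+1.
Proof. by rewrite /width /= wallS; ring. Qed.

Lemma width_gt0 n : 0 < width a n.+1.
Proof. by rewrite widthS; have := wall_half n; lra. Qed.

Lemma width_lt n : width a n.+1 < wall a n.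
Proof. by rewrite widthS; have := wall_gt0 n.+1; lra. Qed.

Lemma island_square (C : nat -> set (R * R)) n : island C n `<=` @closed_unit_square R.
Proof.
rewrite /island closed_unit_squareE => z h.
rewrite (iffLR (closure_id _) (@closed_rect R true 0 1 0 1)).
by apply: closureS h => y [].
Qed.

Lemma island_sub (C : nat -> set (R * R)) m n : (m <= n)%N -> island C n `<=` island C m.
Proof.
move=> mn; apply: closureS => z [h1 h2]; split=> // -[i /= hi hz]; apply: h2.
by exists i => //=; lia.
Qed.

Lemma island_canal (C : nat -> set (R * R)) n i z : (1 <= i <= n)%N -> island C n z -> ~ (C i)° z.
Proof.
move=> hi hz hc; have [y [[_ ny] cy]] := hz _ hc.
by apply: ny; exists i.
Qed.

Lemma island_step (C : nat -> set (R * R)) n z : closed (C n.+1) -> island C n z ->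
  ~ C n.+1 z -> island C n.+1 z.
Proof.
move=> cC hz nz; have [r0 r00 hr0] := closed_sep cC nz.
apply/closure_boxP => r rr0.
have [|y [sy ny] by_] := iffLR (closure_boxP _ _) hz (Num.min r r0); first by rewrite lt_min rr0.
exists y; last by apply: box_le by_; rewrite ge_min lexx.
split=> // -[i /= hi Ci]; move: hi; rewrite [(i <= n.+1)%N]leq_eqVlt ltnS => /andP[i1 /orP[/eqP e|i2]].
  by apply: (hr0 y); [apply: box_le by_; rewrite ge_min lexx orbT | rewrite -e].
by apply: ny; exists i => //=; rewrite i1.
Qed.

Variables C P : nat -> set (R * R).
Hypothesis hC : wada_canals a C P.

(** Normal form of the digging on day [n.+1] in the strip left by day [n]; days 2 and 3 have no
    connecting piece and [r0 = 0], as the canal enters through the end edge. The index [n - 2] is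
    [n.+1 - 3], the day whose peak point is used. *)
Definition day n ch r0 X : Prop :=
  [/\ [/\ wf ch, roomy ch (wall a n), simple ch (wall a n) & island C n = pstrip ch (wall a n)],
      C n.+1 = X `|` pstrip (trim ch r0 (wall a n.+1)) (width a n.+1),
      (r0 = 0 /\ (vtx ch 0).1 = 0 /\ (n <= 2)%N) \/ r0 = wall a n.+1,
      X = set0 \/ (3 <= n)%N /\ connector ch (wall a n) (P (n - 2)%N) X &
      forall p, P n.+1 p -> pstrip (trim ch r0 (wall a n.+1)) (width a n.+1) p].

Lemma pstrip_vtx ch w i : wf ch -> 0 <= w -> (i < nseg ch)%N ->
  pstrip ch w (vtx ch i) /\ pstrip ch w (vtx ch i.+1).
Proof.
move=> hw w0 hi; have l0 := ltW (seglen_gt0 hw hi).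
split; exists i => //; apply: Or31; split; rewrite ?lat_vtx // ?/lat ?subrr ?normr0 //; try lra;
  by rewrite /adv subrr mulr0.
Qed.

Lemma represents_ends ch c w : wf ch -> 0 <= w -> represents ch c ->
  pstrip ch w (vertex c 0) /\ pstrip ch w (vertex c (size c).-1).
Proof.
move=> hw w0 [hs hv]; have h0 := nseg_gt0 hw; rewrite hs /= !hv //; split.
  by have [] := pstrip_vtx hw w0 h0.
have h1 : ((nseg ch).-1 < nseg ch)%N by rewrite prednK.
by have [_] := pstrip_vtx hw w0 h1; rewrite prednK.
Qed.

(** The centre line passes within [T / 2] of both right corners of the square, which are at distance
    1. *)
Lemma len_lower ch T : wf ch -> 0 <= T -> pstrip ch T (1, 0) -> pstrip ch T (1, 1) ->
  1 - T <= len ch.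
Proof.
move=> hw T0 [i hi /(ppiece_near hw hi T0)[p hp bp]] [j hj /(ppiece_near hw hj T0)[q hq bq]].
have /norm_leP /= := len_dist false hw hi hj hp hq.
by have /norm_leP /= := bp false; have /norm_leP /= := bq false; lra.
Qed.

(** The two corners serve only to bound the length of the strip below by [1 - wall a n], which
    exceeds [wall a n]; this is what makes the chain roomy. *)
Lemma dayP n : (1 <= n)%N -> island C n (1, 0) -> island C n (1, 1) ->
  exists ch r0 X, day n ch r0 X.
Proof.
move=> n1 c0 c1; have T0 := wall_gt0 n; have T0' := wall_gt0 n.+1.
have Th := wall_half n; have T1 := wall_lt_half n1; have w0 := width_gt0 n.
have wT := width_lt n.
have base c : centre_line c (wall a n) -> island C n = strip c (wall a n) ->
    [/\ represents (chain_of c) c, wf (chain_of c), roomy (chain_of c) (wall a n) &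
     simple (chain_of c) (wall a n)] /\ island C n = pstrip (chain_of c) (wall a n).
  move=> hc hi; have hw := chain_of_wf hc; have hs := chain_of_simple hc.
  have hr : represents (chain_of c) c by apply: chain_of_represents; case: hc => ? *; lia.
  have e : island C n = pstrip (chain_of c) (wall a n) by rewrite hi (strip_represents _ hw hr).
  split=> //; split=> //; apply: chain_of_roomy => //; last exact: ltW.
  have := len_lower hw (ltW T0); rewrite -e => /(_ c0 c1); lra.
have [n2|n3] := leqP n 2.
  have [_ /(_ n.+1) h _] := hC; have [|c [[hc hi] u0 _ hS hP]] := h; first by rewrite !ltnS n1.
  have [[hr hw hroom hs] e] := base c hc hi.
  have hw' : wf (trim (chain_of c) 0 (wall a n.+1)) by apply: (wf_trim_roomy hw hroom); lra.
  have hr' := trim_last_represents (wall a n.+1) hw hr.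
  exists (chain_of c), 0, set0; split=> //.
  - by rewrite set0U hS (strip_represents _ hw' hr').
  - by left.
  - by left.
  - by move=> p; rewrite hP => ->; have [] := represents_ends hw' (ltW w0) hr'.
have [_ _ /(_ n.+1) h] := hC.
have [|c [p [q [i [[hc hi] Pp hac hS hP]]]]] := h; first by rewrite !ltnS.
have [[hr hw hroom hs] e] := base c hc hi.
have hw' : wf (trim (chain_of c) 0 (wall a n.+1)) by apply: (wf_trim_roomy hw hroom); lra.
have hw2 : wf (trim (chain_of c) (wall a n.+1) (wall a n.+1)) by apply: (wf_trim_roomy hw hroom); lra.
have hr' := trim_last_represents (wall a n.+1) hw hr.
have hr2 := trim_first_represents (wall a n.+1) hw' hr'.
exists (chain_of c), (wall a n.+1), (straight p q (width a n.+1)); split=> //.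
- by rewrite hS (strip_represents _ hw2 hr2).
- by right.
- right; split=> //; apply: straight_connector hac => //.
  by rewrite w0 wT.
- by move=> p'; rewrite hP => -[] ->; have [] := represents_ends hw2 (ltW w0) hr2.
Qed.

End Days.

(** * Geometry of one day; the right side of the square survives *)

Section Wada1.
Variable R : realType.
Implicit Types (ch : chain R) (w r t T : R) (p q z : R * R) (X : set (R * R)).
Variable a : nat -> R.
Hypothesis ha : forall i, (1 <= i)%N -> 2 < a i.
Variables C P : nat -> set (R * R).
Hypothesis hC : wada_canals a C P.

Section OneDay.
Variables (n : nat) (ch : chain R) (r0 : R) (X : set (R * R)).
Hypothesis hd : day a C P n ch r0 X.
Local Notation T := (wall a n).
Local Notation t' := (wall a n.+1).
Local Notation w := (width a n.+1).
Local Notation tr := (trim ch r0 t').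

Lemma day_wf : wf ch. Proof. by case: hd => -[]. Qed.
Lemma day_roomy : roomy ch T. Proof. by case: hd => -[]. Qed.
Lemma day_simple : simple ch T. Proof. by case: hd => -[]. Qed.
Lemma day_island : island C n = pstrip ch T. Proof. by case: hd => -[]. Qed.
Lemma day_canal : C n.+1 = X `|` pstrip tr w. Proof. by case: hd. Qed.

Lemma day_r0 : 0 <= r0 <= t'.
Proof.
by have := wall_gt0 ha n.+1; case: hd => _ _ [[-> _]|->] _ _; lra.
Qed.

Lemma day_r00 : 0 <= r0. Proof. by case/andP: day_r0. Qed.
Lemma day_t0 : 0 <= t'. Proof. exact: ltW (wall_gt0 ha n.+1). Qed.

Lemma day_trim_wf : wf tr.
Proof.
have := day_r0; have := wall_half ha n; have := wall_gt0 ha n.+1 => *.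
by apply: (wf_trim_roomy day_wf day_roomy); lra.
Qed.

Lemma day_trim_roomy : roomy tr w.
Proof.
have := day_r0; have := widthS a n; have := wall_gt0 ha n.+1 => *.
by apply: (roomy_trim day_wf _ _ day_roomy); lra.
Qed.

Lemma day_trim_simple : simple tr w.
Proof.
have := day_r0; have := width_lt ha n; have := wall_gt0 ha n.+1 => *.
by apply: (simple_trim day_wf _ _ day_simple); lra.
Qed.

(** By [T / 2 = w / 2 + t'] and [r0 <= t']. Hence the boxes that make up the island contain
    concentric boxes, smaller by [t'], that lie in the next canal. *)
Lemma day_inner_trim i q : (i < nseg ch)%N -> inner ch (T / 2) i q -> inner tr (w / 2) i q.
Proof.
move=> hi [h1 h2 h3]; have := day_r0; have := widthS a n => e hr0.
apply/(inner_trim day_wf day_r00 day_t0 _ _ hi); split=> //; move: h1 h2; rewrite /at_first /at_last.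
  by do ?case: ifP => _; lra.
by do ?case: ifP => _; lra.
Qed.

Lemma day_inner_sub i q : (i < nseg ch)%N -> inner tr 0 i q -> inner ch 0 i q.
Proof.
move=> hi /(inner_trim day_wf day_r00 day_t0 _ _ hi)[h1 h2 h3]; have := day_r0; have := wall_gt0 ha n.+1.
move: h1 h2; rewrite /inner /at_first /at_last !if_same !add0r => h1 h2 g1 g2.
by split=> //; [apply: le_trans h1|apply: le_trans h2]; case: ifP => _; lra.
Qed.

Lemma day_box_canal i q : (i < nseg ch)%N -> inner ch (T / 2) i q -> box q (w / 2) `<=` C n.+1.
Proof.
move=> hi hq z hz; rewrite day_canal; right; exists i => //.
apply: (inner_box_sub day_trim_wf hi (day_inner_trim hi hq)) => //.
exact: ltW (width_gt0 ha n).
Qed.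

Lemma day_box_island i q : (i < nseg ch)%N -> inner ch (T / 2) i q ->
  box q (T / 2) `<=` island C n.
Proof.
move=> hi hq z hz; rewrite day_island; exists i => //.
by apply: (inner_box_sub day_wf hi hq) => //; exact: ltW (wall_gt0 ha n).
Qed.

Lemma day_inner_square i q b : (i < nseg ch)%N -> inner ch (T / 2) i q ->
  T / 2 <= co b q <= 1 - T / 2.
Proof.
move=> hi hq; have T0 := wall_gt0 ha n.
have h (e : R) : e = 1 \/ e = -1 -> 0 <= co b q + e * (T / 2) <= 1.
  move=> he; have : box q (T / 2) (mkpt b (co b q + e * (T / 2)) (co (~~ b) q)).
    apply: (boxE (b := b)); rewrite ?co_mk ?co_mkN ?subrr ?normr0; last lra.
    by rewrite addrAC subrr add0r; apply/norm_leP; case: he => ->; lra.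
  move/(day_box_island hi hq)/island_square => [].
  by case: b => /=; lra.
by have := h 1 (or_introl erefl); have := h (-1) (or_intror erefl); lra.
Qed.

Lemma closed_connector : closed X.
Proof.
case: hd => _ _ _ [->|[_ [a1 [b1 [a2 [b2 [p [q [i [_ _ -> _ _]]]]]]]]]] _; first exact: closed0.
exact: closed_rect.
Qed.

Lemma day_closed : closed (C n.+1).
Proof.
by rewrite day_canal; apply: closedU; [exact: closed_connector|apply: closed_pstrip day_trim_wf].
Qed.

(** [outer_point] provides two candidates, one ahead of [q] and one behind, whose advances differ by
    exactly [T]. The connecting piece has both sides shorter than [T], so it cannot contain both. *)
Lemma day_outer i q : (i < nseg ch)%N -> inner ch (T / 2) i q -> exists z eps,
  [/\ island C n.+1 z, box q (T / 2) z, eps = 1 \/ eps = -1 & adv ch i q z = eps * (T / 2)].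
Proof.
move=> hi hq; have T0 := wall_gt0 ha n.
have w0 := width_gt0 ha n; have wT := width_lt ha n.
have o e : e = 1 \/ e = -1 -> exists z, [/\ box q (T / 2) z, adv ch i q z = e * (T / 2) &
    ~ pstrip tr w z].
  move=> he; have [z [z1 z2 z3]] := outer_point day_wf day_simple (ltW w0) wT hi hq he.
  exists z; split=> // -[j hj zj].
  have [p hp bp] := ppiece_near day_trim_wf hj (ltW w0) zj.
  apply: (z3 j p) => //; first exact: day_inner_sub hp.
  have := day_r0; have := wall_gt0 ha n.+1 => g1 g2.
  by apply: (ppiece_trim day_wf _ _ hj (ltW wT) zj); lra.
have fin e z : e = 1 \/ e = -1 -> box q (T / 2) z -> adv ch i q z = e * (T / 2) ->
    ~ pstrip tr w z -> ~ X z -> exists z eps,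
    [/\ island C n.+1 z, box q (T / 2) z, eps = 1 \/ eps = -1 & adv ch i q z = eps * (T / 2)].
  move=> he z1 z2 z3 z4; exists z, e; split=> //.
  apply: island_step day_closed _ _; first exact: (day_box_island hi hq).
  by rewrite day_canal => -[].
have [z [z1 z2 z3]] := o 1 (or_introl erefl).
have [y [y1 y2 y3]] := o (-1) (or_intror erefl).
have [Xz|nX] := pselect (X z); last by apply: (fin 1 z) => //; left.
have [Xy|nX] := pselect (X y); last by apply: (fin (-1) y) => //; right.
exfalso; case: hd => _ _ _ [X0|[_ [a1 [b1 [a2 [b2 [p [q' [i' [h1 h2 h3 _ _]]]]]]]]]] _.
  by move: Xz; rewrite X0.
have F := advD ch i y q z; rewrite (advC ch i y q) y2 z2 in F.
have : `|adv ch i y z| = T by rewrite -F; rewrite ger0_norm; lra.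
rewrite (adv_norm day_wf) // => /eqP; move: Xz Xy; rewrite h3 => -[/= u1 u2] [/= v1 v2].
by apply/negP; rewrite lt_eqF // ltr_norml; case: (axis ch i) => /=; lra.
Qed.

Lemma day_near z : island C n z -> exists i q,
  [/\ (i < nseg ch)%N, inner ch (T / 2) i q & box q (T / 2) z].
Proof.
rewrite day_island; apply: pstrip_inner; [exact: day_wf|exact: day_roomy|].
exact: ltW (wall_gt0 ha n).
Qed.

Lemma day_next z : island C n z -> exists2 z', island C n.+1 z' & box z T z'.
Proof.
move=> /day_near[i [q [hi hq bz]]]; have [z' [e [z1 z2 _ _]]] := day_outer hi hq.
exists z' => //; rewrite (_ : T = T / 2 + T / 2); last lra.
exact: box_trans (box_sym bz) z2.
Qed.

(** Inner centres stay [T / 2] away from the sides of the square, which leaves [T / 2 - w / 2 = t'].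
    The only other centres are near the entrance of a canal of day 2 or 3, close to the side
    [x = 0]. *)
Lemma day_strip_margin z : (1 <= n)%N -> pstrip tr w z -> z.1 <= 1 - t'.
Proof.
move=> n1; have T0 := wall_gt0 ha n; have T1 := wall_lt_half ha n1.
have w0 := width_gt0 ha n; have e := widthS a n; have t0 := wall_gt0 ha n.+1.
move/(pstrip_inner day_trim_wf day_trim_roomy (ltW w0)) => [i [q [hi hq bz]]].
have /norm_leP /= := bz true.
have := hq => /(inner_trim day_wf day_r00 day_t0 _ _ hi)[h1 h2 h3].
have good : inner ch (T / 2) i q -> q.1 <= 1 - T / 2.
  by move=> /(day_inner_square true hi) /=; lra.
have hr0 := day_r0.
have lst : at_last ch i (T / 2) <= adv ch i q (vtx ch i.+1).
  by move: h2; rewrite /at_last; case: ifP => _; lra.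
have [g|g] := leP (at_first i (T / 2)) (adv ch i (vtx ch i) q).
  have : q.1 <= 1 - T / 2 by apply: good; split.
  lra.
case: hd => _ _ [[r00 [v0 _]]|r1] _ _; last first.
  by move: g h1; rewrite r1 /at_first; case: ifP => _; lra.
move: g h1; rewrite r00 /at_first; case: eqP => [i0|_] g h1; last lra.
have : box (vtx ch i) (T / 2) q.
  apply/(in_boxP day_wf _ _ _ hi); rewrite h3 normr0; split; last lra.
  by apply/norm_leP; lra.
by move=> /(_ true) /norm_leP /=; rewrite i0 v0; lra.
Qed.

End OneDay.

(** This induction resolves a circularity: the shape of the next canal is known from [dayP] only if
    the right corners are still land. A connecting piece stays off [x = 1] because it lies within
    [T / 2] of a peak point of an earlier day, whose margin is at least [T]. *)
Lemma canal_margin n : (1 <= n)%N ->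
  (forall p, P n p -> p.1 <= 1 - wall a n) /\ (forall z, C n z -> z.1 < 1).
Proof.
elim/ltn_ind: n => -[|n] // IH _; have t0 := wall_gt0 ha n.+1.
case: n IH t0 => [|n] IH t0.
  have e : wall a 1 = (a 1)^-1 by rewrite wallS wall0 mul1r.
  have [[h1 h2] _ _] := hC; rewrite e in t0 *; split.
    by move=> p; rewrite h2 => -> /=.
  by move=> z; rewrite h1 => -[/= h3 h4]; lra.
have cor b : 0 <= b <= 1 -> island C n.+1 (1, b).
  move=> hb; apply: subset_closure; split; first by split=> //=; rewrite ler01 lexx.
  move=> [i /= hi /(proj2 (IH i _ _))] /=; rewrite ltxx => h; exfalso.
  by apply: notF; apply: h; lia.
have [|||ch [r0 [X hd]]] := @dayP _ _ ha _ _ hC n.+1 => //; try by apply: cor; lra.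
have mg := day_strip_margin hd isT; split.
  by move=> p; case: hd => _ _ _ _ hP /hP; apply: mg.
move=> z; rewrite (day_canal hd) => -[Xz|/mg]; last lra.
case: hd => _ _ _ [X0|[n3 [a1 [b1 [a2 [b2 [p [q [i [_ _ _ [Pp bp] _]]]]]]]]]] _.
  by move: Xz; rewrite X0.
have /norm_leP /= := bp _ Xz true.
have : p.1 <= 1 - wall a (n.+1 - 2) by apply: (proj1 (IH _ _ _)) => //; lia.
have := @wall_le _ _ ha (n.+1 - 2) n.+1 ltac:(lia); have := wall_gt0 ha n.+1; lra.
Qed.

Lemma corners n b : (1 <= n)%N -> 0 <= b <= 1 -> island C n (1, b).
Proof.
move=> n1 hb; apply: subset_closure; split; first by split=> //=; rewrite ler01 lexx.
by move=> [i /= /andP[i1 _] /(proj2 (canal_margin i1))] /=; rewrite ltxx.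
Qed.

Lemma days n : (1 <= n)%N -> exists ch r0 X, day a C P n ch r0 X.
Proof. by move=> n1; apply: dayP => //; apply: corners => //; lra. Qed.

Lemma day_len n ch r0 X : (1 <= n)%N -> day a C P n ch r0 X -> 1 / 2 < len ch.
Proof.
move=> n1 hd; have T0 := wall_gt0 ha n; have := wall_lt_half ha n1.
have := len_lower (day_wf hd) (ltW T0); rewrite -(day_island hd).
have c b : 0 <= b <= 1 -> island C n (1, b) by exact: corners.
by move=> h; have := h (c 0 _) (c 1 _); rewrite !lexx ler01 => /(_ isT isT); lra.
Qed.

End Wada1.

(** * Recursion for the lengths of the strips *)

Section Lengths.
Variable R : realType.
Implicit Types (ch : chain R) (w r t T e : R) (p q z : R * R) (X : set (R * R)).

Lemma orect_interior b (a1 b1 a2 b2 : R) z : orect b a1 b1 a2 b2 z ->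
  exists2 r, 0 < r & box z r `<=` orect b a1 b1 a2 b2.
Proof.
move=> [/andP[h1 h2] /andP[h3 h4]].
pose m := Num.min (Num.min (co b z - a1) (b1 - co b z))
                  (Num.min (co (~~ b) z - a2) (b2 - co (~~ b) z)).
have m0 : 0 < m by rewrite !lt_min !subr_gt0 h1 h2 h3.
have : m <= m by [].
rewrite {2}/m !le_min => /andP[/andP[m1 m2] /andP[m3 m4]].
exists (m / 2); first lra.
move=> y hy; have /norm_leP ? := hy b; have /norm_leP ? := hy (~~ b).
by split; lra.
Qed.

Lemma ostrip_interior ch t z : wf ch -> roomy ch t -> 0 <= t -> ostrip ch t z ->
  exists2 r, 0 < r & box z r `<=` pstrip ch t.
Proof.
move=> hw hr ht [i hi hz].
have [a1 [b1 [h1 h2 e1 e2]]] := cell_rect hw hi (cell_hi_lo hw hr ht hi).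
rewrite e2 in hz; have [r r0 hr0] := orect_interior hz.
exists r => // y /hr0; rewrite -e2 => /ocell_sub hy; exists i => //.
exact: cell_ppiece hy.
Qed.

Lemma covered_net S (q : R * R) r : 0 < r -> S `<=` box q (8 * r) ->
  exists (k : nat) (g : nat -> R * R), k%:R <= (64 : R) /\
    forall z, S z -> exists2 j, (j < k)%N & box (g j) r z.
Proof.
move=> r0 hS.
have : covered S (8%:R * (2 * r)) 1 by apply: (covered_box _ hS); lra.
move/(covered_refine _ _) => [||k [x [hk hx]]] //; first by rewrite mulr_gt0.
exists k, (fun j => ((x j).1 + r, (x j).2 + r)); split.
  by apply: le_trans hk _; rewrite mulr1 -natrX ler_nat.
move=> z /hx[j hj /squareE sj]; exists j => // b; have := sj b.
by case: b => /= h; apply/norm_leP; lra.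
Qed.

Variable a : nat -> R.
Hypothesis ha : forall i, (1 <= i)%N -> 2 < a i.
Variables C P : nat -> set (R * R).
Hypothesis hC : wada_canals a C P.

Section TwoDays.
Variables (n : nat) (ch ch' : chain R) (r0 r0' : R) (X X' : set (R * R)).
Hypothesis hd : day a C P n ch r0 X.
Hypothesis hd' : day a C P n.+1 ch' r0' X'.
Local Notation T := (wall a n).
Local Notation t' := (wall a n.+1).
Local Notation w := (width a n.+1).
Local Notation tr := (trim ch r0 t').

Let T0 : 0 < T. Proof. exact: wall_gt0 ha n. Qed.
Let t0 : 0 < t'. Proof. exact: wall_gt0 ha n.+1. Qed.
Let w0 : 0 < w. Proof. exact: width_gt0 ha n. Qed.
Let ew : w = T - 2 * t'. Proof. exact: widthS a n. Qed.

Lemma trim_strip_sub : pstrip tr w `<=` pstrip ch T.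
Proof.
move=> z [i hi hz]; exists i => //.
by apply: (ppiece_trim (day_wf hd) (day_r00 ha hd) (day_t0 ha n) hi _ hz); exact: ltW (width_lt ha n).
Qed.

Lemma len_trimE : len tr = len ch - r0 - t'.
Proof. exact: (len_trim (day_wf hd) (day_r00 ha hd) (day_t0 ha n)). Qed.

(** The new strip and the strip of the canal are disjoint up to their edges and lie in the old
    strip. Since [T - w = 2 * t'], comparing areas and dividing by [t'] gives the factor 2; the
    trimmed ends cost at most [2 * w <= 2]. *)
Lemma len_upper : len ch' <= 2 * len ch + 2.
Proof.
have ? := T0; have ? := t0; have ? := w0; have ? := ew.
have : t' * len ch' + w * len tr <= T * len ch.
  apply: (@ostrip2_le _ ch' t' tr w (pstrip ch T)); try exact: ltW.
  - exact: day_wf hd'.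
  - exact: day_roomy hd'.
  - exact: day_simple hd'.
  - exact: day_trim_wf hd.
  - exact: day_trim_roomy hd.
  - exact: day_trim_simple hd.
  - rewrite -subset0 => z [/(ostrip_sub (day_wf hd') (ltW t0))].
    rewrite -(day_island hd') => iz.
    move/(ostrip_interior (day_trim_wf ha hd) (day_trim_roomy ha hd) (ltW w0)) => [r rr0 hr].
    apply: (@island_canal _ C n.+1 n.+1 z) => //; first by rewrite leqnn.
    apply/interior_boxP; exists r => //; apply: subset_trans hr _.
    by rewrite (day_canal hd) => y ?; right.
  - apply: subset_trans (ostrip_sub (day_wf hd') (ltW t0)) _.
    by rewrite -(day_island hd) -(day_island hd'); apply: island_sub.
  - by apply: subset_trans (ostrip_sub (day_trim_wf ha hd) (ltW w0)) _; exact: trim_strip_sub.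
  - by apply: area_le_strip; [exact: day_wf hd|exact: day_roomy hd|exact: ltW].
rewrite len_trimE => h; have /andP[h1 h2] := day_r0 ha hd.
have A : w * r0 <= w * t' by rewrite ler_pM2l.
have B : w * t' <= 1 * t'.
  by rewrite ler_pM2r //; apply: le_trans (ltW (width_lt ha n)) (wall_le1 ha n).
have D : w * len ch = T * len ch - 2 * (t' * len ch) by rewrite ew; ring.
rewrite !mulrBr D in h; rewrite -(ler_pM2l t0) mulrDr mulrCA; lra.
Qed.

(** Near a centre [q'] the canal contains the box of half-side [w / 2 = T / 2 - t'], so what the
    connecting piece takes elsewhere is a shell of thickness [t'] in a region of size [O(T)]. A
    bound [O(T ^+ 2)] would not survive the division by [t'] in [len_lower_rec]. *)
Lemma area_connector :
  area_le (X `&` island C n `&` ~` pstrip tr w) ((64 * 576) * T * t').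
Proof.
have ? := T0; have ? := t0; have ? := w0; have ? := ew.
have p0 : 0 <= (64 * 576) * T * t' 
  by apply: mulr_ge0; [apply: mulr_ge0; [apply: mulr_ge0; rewrite ler0n|exact: ltW]|exact: ltW].
case: (hd) => _ _ _ [X0|[n3 [a1 [b1 [a2 [b2 [p [q [i [_ _ _ _ [hi hq bq]]]]]]]]]]] _.
  by apply: area_leS (area_le0 R) => // z [[]]; rewrite X0.
set E := _ `&` _.
have rT : 0 < T / 8 by lra.
have [k [g [hk hg]]] := @covered_net [set y | box q T y] q (T / 8) rT ltac:(by apply: box_le; lra).
have cE : covered E (8 * t') (k%:R * (5 * T / t' + 4)).
  apply: (@covered_shell _ _ _ _ _ g) => // z [[Xz iz] nz].
  have [j [q' [hj hq' bz]]] := day_near ha hd iz.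
  have bq' : box q T q'.
    by rewrite (_ : T = T / 2 + T / 2); [apply: box_trans (bq _ Xz) (box_sym bz)|lra].
  have [l hl bl] := hg _ bq'.
  exists q', l; split=> // z' [_ nz'] bz'; apply: nz'; exists j => //.
  apply: (inner_box_sub (day_trim_wf ha hd) hj (day_inner_trim ha hd hj hq') (ltW w0)).
  by apply: box_le bz'; rewrite ew; lra.
have := area_le_covered _ cE => /(_ ltac:(lra)); apply: area_leS => //.
have tT := wall_half ha n.
have k64 : k%:R * (5 * T / t' + 4) * (8 * t') ^+ 2 = k%:R * (64 * (5 * T * t' + 4 * t' ^+ 2)).
  by field; lra.
(* One factor 64 bounds the number of net points. The other belongs to the area of squares of side
   [8 * t'], and [576 = 64 * 9] by [5 * T * t' + 4 * t' ^+ 2 <= 9 * T * t']. *)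
rewrite k64; apply: (@le_trans _ _ (64 * (64 * (5 * T * t' + 4 * t' ^+ 2)))); last by nra.
by rewrite ler_wpM2r //; nra.
Qed.

(** The old strip is covered by the new strip, the strip of the canal and the extra part of the
    connecting piece; comparing areas and dividing by [t'] leaves an error [O(T)]. *)
Lemma len_lower_rec : 2 * len ch - (64 * 576) * T <= len ch'.
Proof.
have ? := T0; have ? := t0; have ? := w0; have ? := ew.
have : T * len ch <= t' * len ch' + w * len tr + (64 * 576) * T * t'.
  apply: (@ostrip_le _ ch T (pstrip ch T)).
  - exact: day_wf hd.
  - exact: day_roomy hd.
  - exact: day_simple hd.
  - exact: ltW.
  - by apply: ostrip_sub (day_wf hd) (ltW T0).
  - apply: area_leS (lexx _) (area_leU (area_leU (area_le_strip (day_wf hd') (day_roomy hd') (ltW t0))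
      (area_le_strip (day_trim_wf ha hd) (day_trim_roomy ha hd) (ltW w0))) area_connector).
    rewrite -(day_island hd) -(day_island hd') => z iz.
    have [Sz|nS] := pselect (pstrip tr w z); first by left; right.
    have [Xz|nX] := pselect (X z); first by right.
    left; left; apply: island_step (day_closed ha hd) iz _.
    by rewrite (day_canal hd) => -[].
rewrite len_trimE => h; have /andP[h1 h2] := day_r0 ha hd.
have A : 0 <= w * r0 by rewrite mulr_ge0 // ltW.
have B : 0 <= w * t' by rewrite mulr_ge0 // ltW.
have D : w * len ch = T * len ch - 2 * (t' * len ch) by rewrite ew; ring.
have E : (64 * 576) * T * t' = t' * ((64 * 576) * T) by ring.
rewrite !mulrBr D E in h; rewrite -(ler_pM2l t0) mulrBr mulrCA; lra.
Qed.

End TwoDays.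
End Lengths.

(** * The common boundary *)

Section Lakes.
Variable R : realType.
Implicit Types (ch : chain R) (w t T e : R) (p q z x : R * R) (X U : set (R * R)).

(** Take the supremum of the parameters outside [U]: it is itself outside because [U] is open, and
    all later parameters up to [q] are in [U]. *)
Lemma segment_boundary U x q : (forall z, U z -> exists2 r, 0 < r & box z r `<=` U) ->
  U q -> ~ U x -> exists s : R, [/\ 0 <= s <= 1,
    ~ U (x.1 + s * (q.1 - x.1), x.2 + s * (q.2 - x.2)) &
    closure U (x.1 + s * (q.1 - x.1), x.2 + s * (q.2 - x.2))].
Proof.
move=> oU Uq nx; pose g (s : R) := (x.1 + s * (q.1 - x.1), x.2 + s * (q.2 - x.2)).
pose D : R := `|q.1 - x.1| + `|q.2 - x.2| + 1.
have D0 : 0 < D by have := normr_ge0 (q.1 - x.1); have := normr_ge0 (q.2 - x.2); rewrite /D; lra.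
have gl s s' r : `|s' - s| * D <= r -> box (g s) r (g s').
  move=> h; have n1 := normr_ge0 (q.1 - x.1); have n2 := normr_ge0 (q.2 - x.2).
  have n3 := normr_ge0 (s' - s); apply: (boxE (b := true)) => /=.
    rewrite opprD addrACA subrr add0r -mulrBl normrM; apply: le_trans h.
    by rewrite ler_wpM2l // /D; lra.
  rewrite opprD addrACA subrr add0r -mulrBl normrM; apply: le_trans h.
  by rewrite ler_wpM2l // /D; lra.
have g0 : g 0 = x by rewrite /g !mul0r !addr0; case: (x).
have g1 : g 1 = q by rewrite /g !mul1r !(addrC x.1) !(addrC x.2) !subrK; case: (q).
pose S := [set s : R | 0 <= s <= 1 /\ ~ U (g s)].
have S0 : S 0 by rewrite /S /= g0 lexx ler01.
have hS : has_sup S by split; [exists 0|exists 1 => s [/andP[_ ?] _]].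
pose m := sup S.
have ubS s : S s -> s <= m by move=> ?; apply: ub_le_sup => //; case: hS.
have m0 : 0 <= m by exact: ubS.
have m1 : m <= 1 by apply: ge_sup; [exists 0|move=> s [/andP[_ ?] _]].
have nU : ~ U (g m).
  move=> /oU[r r0 hr]; have e0 : 0 < r / D by exact: divr_gt0.
  have [s Ss sm] := sup_adherent e0 hS; have sm' := ubS s Ss.
  case: (Ss) => _; apply; apply: hr; apply: gl.
  rewrite -ler_pdivlMr // ler0_norm; last lra.
  by rewrite -/m in sm; lra.
exists m; split=> //; first by rewrite m0.
have mlt : m < 1.
  by rewrite lt_neqAle m1 andbT; apply/eqP => e; apply: nU; rewrite e g1.
apply/closure_boxP => r r0; have e0 : 0 < r / D by exact: divr_gt0.
pose s := Num.min 1 (m + r / D).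
have sm : m < s by rewrite lt_min mlt /=; lra.
have s1 : s <= 1 by rewrite ge_min lexx.
have sr : s <= m + r / D by rewrite ge_min lexx orbT.
exists (g s).
  apply: contrapT => nUs; have : s <= m by apply: ubS; split=> //; rewrite s1 andbT; lra.
  lra.
by apply: gl; rewrite -ler_pdivlMr // ger0_norm; lra.
Qed.

Variable a : nat -> R.
Hypothesis ha : forall i, (1 <= i)%N -> 2 < a i.
Variables C P : nat -> set (R * R).
Hypothesis hC : wada_canals a C P.
Variable r : nat.
Hypothesis hr : (1 <= r <= 3)%N.
Local Notation U := (full_lake C r).

Lemma canal_lake k : (C (3 * k + r)%N)° `<=` U.
Proof.
move=> z hz; exists k => //; apply: interiorS hz => y hy; exists k => //=.
Qed.

Lemma lake_open z : U z -> exists2 rho, 0 < rho & box z rho `<=` U.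
Proof.
move=> [k _ hz]; have : nbhs z (lake C r k) by exact: nbhs_interior hz.
move=> /nbhs_boxP[rho r0 h]; exists rho => // y /h hy; by exists k.
Qed.

Lemma island_not_lake x : (forall m, island C m x) -> ~ U x.
Proof.
move=> hx [k _ hk]; have [y [[_ ny] [j /= jk Cy]]] := hx (3 * k + r)%N _ hk.
by apply: ny; exists (3 * j + r)%N => //=; lia.
Qed.

Lemma island_chain n z (g : nat -> R * R) : g 0%N = z ->
  (forall k, box (g k) (wall a (n + k)) (g k.+1)) ->
  forall k l, box (g k) (2 * (wall a (n + k) - wall a (n + k + l))) (g (k + l)%N).
Proof.
move=> g0 hg k; elim=> [|l IH]; first by rewrite !addn0 subrr mulr0; exact: box_refl.
rewrite !addnS; apply: box_le (box_trans IH (hg (k + l)%N)).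
by rewrite addnA; have := wall_half ha (n + k + l); lra.
Qed.

Lemma island_seq n z : (1 <= n)%N -> island C n z -> exists g : nat -> R * R,
  [/\ g 0%N = z, forall k, island C (n + k) (g k) & forall k, box (g k) (wall a (n + k)) (g k.+1)].
Proof.
move=> n1 hz.
pose S k y := [set y' | island C (n + k).+1 y' /\ box y (wall a (n + k)) y'].
pose g := fix g k := if k is l.+1 then xget z (S l (g l)) else z.
have key k : island C (n + k) (g k) -> S k (g k) (g k.+1).
  move=> hk; apply: xgetPex.
  have [|ch [r0 [X hd]]] := days ha hC (n := (n + k)%N); first lia.
  by have [y h1 h2] := day_next ha hd hk; exists y.
have hg k : island C (n + k) (g k).
  elim: k => [|k IH]; first by rewrite addn0.
  by rewrite addnS; case: (key k IH).
by exists g; split=> // k; case: (key k (hg k)).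
Qed.

Lemma wall_geo n : wall a n * n.+1%:R <= 1.
Proof.
elim: n => [|n IH]; first by rewrite wall0 mulr1.
apply: le_trans IH; have := wall_half ha n; have := wall_gt0 ha n.+1.
have : (1 : R) <= n.+1%:R by rewrite ler1n.
by rewrite -[n.+2%:R]natr1; move: n.+1%:R => N; nra.
Qed.

Lemma wall_small e : 0 < e -> exists n, wall a n < e.
Proof.
move=> e0; exists (Num.truncn e^-1).
have i0 : 0 <= e^-1 by rewrite invr_ge0 ltW.
have /andP[_ h] := truncn_itv i0.
have := wall_geo (Num.truncn e^-1); have := wall_gt0 ha (Num.truncn e^-1).
move: (wall a _) (_.+1%:R) h => W N h W0 hN.
rewrite -(ltr_pM2r e0) mulVf ?gt_eqF // in h.
nra.
Qed.

(** The walls at least halve each day, so the points chosen in successive islands drift by at most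
    [2 * wall a n] in total. Their limit lies in every island because islands are closed and
    decreasing. *)
Lemma limit_point n z : (1 <= n)%N -> island C n z ->
  exists x, (forall m, island C m x) /\ box z (2 * wall a n) x.
Proof.
move=> n1 hz; have [g [g0 g1 g2]] := island_seq n1 hz.
have gkl := island_chain g0 g2.
(* Lower ends of the intervals of radius [2 * wall a (n + k)] around the coordinates of [g k]; the
   supremum lies in all these intervals. *)
pose A b := [set y | exists k, y = co b (g k) - 2 * wall a (n + k)].
have A0 b : A b !=set0 by exists (co b (g 0%N) - 2 * wall a (n + 0)); exists 0%N.
have Aub b l y : A b y -> y <= co b (g l) + 2 * wall a (n + l).
  move=> [k ->]; have := wall_gt0 ha (n + k); have := wall_gt0 ha (n + l).
  have [kl|lk] := leqP k l.
    have := gkl k (l - k)%N b; rewrite -addnA subnKC // => /norm_leP; lra.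
  have := gkl l (k - l)%N b; rewrite -addnA subnKC; last exact: ltnW.
  by move=> /norm_leP; lra.
pose x := (sup (A true), sup (A false)).
have xb b : co b x = sup (A b) by case: b.
have gx k : box (g k) (2 * wall a (n + k)) x.
  move=> b; rewrite xb; apply/norm_leP; split.
    have : co b (g k) - 2 * wall a (n + k) <= sup (A b).
      by apply: ub_le_sup; [exists (co b (g 0%N) + 2 * wall a (n + 0)) => y; exact: Aub|exists k].
    lra.
  have : sup (A b) <= co b (g k) + 2 * wall a (n + k) by apply: ge_sup => // y; exact: Aub.
  lra.
exists x; split; last by have := gx 0%N; rewrite g0 addn0.
move=> m; rewrite /island (iffLR (closure_id _) (@closed_closure _ _)) -/(island C m).
apply/closure_boxP => rho rho0.
have [k hk] := @wall_small (rho / 2) ltac:(lra).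
exists (g (m + k)%N); first by apply: island_sub (g1 _); lia.
apply/box_sym; apply: box_le (gx _).
by have := @wall_le _ _ ha k (n + (m + k)) ltac:(lia); lra.
Qed.

Lemma lake_near n z : (3 <= n)%N -> island C n z ->
  exists q, U q /\ box z (3 * wall a n) q.
Proof.
move=> n3 hz; have [|g [g0 g1 g2]] := island_seq _ hz; first lia.
have [j [k e]] : exists j k, (n + j).+1 = (3 * k + r)%N.
  (* The delay [j <= 2] until a canal of lake [r] is dug: [n + j + 1] is congruent to
     [3 * n + r + 3], hence to [r], modulo 3. *)
  by exists ((2 * n + r + 2) %% 3)%N, ((n + ((2 * n + r + 2) %% 3) + 1 - r) %/ 3)%N; lia.
have [|ch [r0 [X hd]]] := days ha hC (n := (n + j)%N); first lia.
have [i [q [hi hq bq]]] := day_near ha hd (g1 j).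
exists q; split.
  apply: (@canal_lake k); rewrite -e; apply/interior_boxP.
  exists (width a (n + j).+1 / 2); first by have := width_gt0 ha (n + j); lra.
  exact: (day_box_canal ha hd hi hq).
have := island_chain g0 g2 0 j; rewrite addn0 g0 add0n => h.
apply: box_le (box_trans h (box_sym bq)).
by have := @wall_le _ _ ha n (n + j) ltac:(lia); have := wall_gt0 ha n; have := wall_gt0 ha (n + j); lra.
Qed.

(** Join a nearby point of all islands, which is outside the lake, to a nearby point of the lake:
    the segment meets the boundary and stays in the box by convexity. *)
Lemma boundary_near n z : (3 <= n)%N -> island C n z ->
  exists x, boundary U x /\ box z (3 * wall a n) x.
Proof.
move=> n3 hz; have [q [Uq bq]] := lake_near n3 hz.
have [|x [hx bx]] := limit_point _ hz; first lia.
have bx' : box z (3 * wall a n) x by apply: box_le bx; have := wall_gt0 ha n; lra.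
have [s [/andP[s0 s1] nU cU]] := segment_boundary lake_open Uq (island_not_lake hx).
eexists; split; first by split; [exact: cU|move=> /interior_subset].
apply: (boxE (b := true)) => /=.
  have := bq true; have := bx' true => /norm_leP /= ? /norm_leP /= ?.
  by apply/norm_leP; nra.
have := bq false; have := bx' false => /norm_leP /= ? /norm_leP /= ?.
by apply/norm_leP; nra.
Qed.

End Lakes.

(** * Counting boxes *)

Section Counts.
Variable R : realType.
Implicit Types (ch : chain R) (w t T e B : R) (p q z x : R * R) (X U E : set (R * R)).

(** For closed [E], the case of all canals, this is the topological boundary. *)
Definition frontier E : set (R * R) := E `\` E°.

Lemma frontierU E E' : frontier (E `|` E') `<=` frontier E `|` frontier E'.
Proof.
move=> z [[h|h] n]; [left|right]; split=> // k; apply: n; apply: interiorS k => y ?.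
  by left.
by right.
Qed.

Lemma covered_frontier_rect (a1 b1 a2 b2 s e : R) : a1 <= b1 <= a1 + s -> a2 <= b2 <= a2 + s ->
  0 < e -> covered (frontier (rect true a1 b1 a2 b2)) e (4 * (s / e + 1)).
Proof.
move=> h1 h2 e0; have s0 : 0 <= s by lra.
have -> : 4 * (s / e + 1) = (s / e + 1) + (s / e + 1) + (s / e + 1) + (s / e + 1) by ring.
apply: coveredS (coveredU (coveredU (coveredU
  (covered_segment true a1 a2 e0 s0) (covered_segment true b1 a2 e0 s0))
  (covered_segment false a2 a1 e0 s0)) (covered_segment false b2 a1 e0 s0)) => z [[/= u v] n].
have [e1|n1] := eqVneq z.1 a1; first by left; left; left; split=> //=; lra.
have [e2|n2] := eqVneq z.1 b1; first by left; left; right; split=> //=; lra.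
have [e3|n3] := eqVneq z.2 a2; first by left; right; split=> //=; lra.
have [e4|n4] := eqVneq z.2 b2; first by right; split=> //=; lra.
exfalso; apply: n; have [|r r0 hr] := @orect_interior R true a1 b1 a2 b2 z.
  by split; apply/andP; split=> /=; rewrite lt_neqAle ?n2 ?n4 /= ?[a1 == _]eq_sym ?[a2 == _]eq_sym ?n1 ?n3 /=; lra.
apply/interior_boxP; exists r => // y /hr [/= /andP[? ?] /andP[? ?]].
by split=> /=; rewrite !ltW.
Qed.

Lemma covered_shell_chain E ch T e : wf ch -> 0 < e -> e <= T ->
  (forall z, E z -> exists i q, [/\ (i < nseg ch)%N, inner ch 0 i q, box q (T / 2) z &
    forall z', E z' -> ~ box q (T / 2 - 2 * e) z']) ->
  covered E e (256 * (52 * (len ch / e) + 3 * (T / e) + 4)).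
Proof.
move=> hw e0 eT hE; have T0 : 0 < T by lra.
have T8 : 0 < T / 8 by lra.
have [k [g [hk hg]]] := len_net hw T8.
have c : covered E (8 * (2 * e)) (k%:R * (5 * T / (2 * e) + 4)).
  apply: (@covered_shell _ _ _ _ _ g) => //; first lra.
  move=> z /hE[i [q [hi hq bq nq]]]; have [j hj bj] := hg i q hi hq.
  by exists q, j.
have e16 : 8 * (2 * e) = 16%:R * e by ring.
rewrite e16 in c; apply: covered_le (covered_refine e0 _ c) => //.
have l0 := len_ge0 hw.
have -> : 16%:R ^+ 2 = 256 :> R by ring.
rewrite ler_wpM2l ?ler0n //.
have p0 : 0 <= 5 * T / (2 * e) + 4 by apply: addr_ge0 => //; apply: divr_ge0; lra.
apply: le_trans (ler_wpM2r p0 hk) _.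
(* A net of mesh [T / 8] and shells with [t = 2 * e] lead to squares of side [16 * e], hence
   [256 = 16 ^ 2]. By [e <= T] the term [32 * (len ch / T)] joins the first one: [52 = 20 + 32]. *)
have -> : (len ch / (T / 8) + 1) * (5 * T / (2 * e) + 4) =
    20 * (len ch / e) + 32 * (len ch / T) + (5 / 2) * (T / e) + 4.
  by field; lra.
have : len ch / T <= len ch / e by rewrite ler_wpM2l // lef_pV2 // posrE.
have : 0 <= T / e by apply: divr_ge0; lra.
lra.
Qed.

Lemma covered_frontier_strip ch w e : wf ch -> roomy ch w -> 0 < w -> 0 < e ->
  covered (frontier (pstrip ch w)) e (256 * (52 * (len ch / e) + 3 * (w / e) + 10)).
Proof.
move=> hw hr w0 e0.
(* The previous lemma is applied to boxes of side [w + 2 * e]. This is at least [e] even if [e]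
   exceeds [w], and the forbidden boxes get half-side [w / 2 - e]: around their points a box of
   half-side [e] lies in the strip. *)
have -> : 52 * (len ch / e) + 3 * (w / e) + 10 =
  52 * (len ch / e) + 3 * ((w + 2 * e) / e) + 4 by field; lra.
apply: covered_shell_chain => //; first lra.
move=> z [hz nz]; have [i [q [hi hq bq]]] := pstrip_inner hw hr (ltW w0) hz.
exists i, q; split=> //.
- by apply: inner_le hq; lra.
- by apply: box_le bq; lra.
- move=> z' [_ nz'] bz'; apply: nz'; apply/interior_boxP; exists e => //.
  move=> y hy; exists i => //; apply: (inner_box_sub hw hi hq (ltW w0)).
  by apply: box_le (box_trans bz' hy); lra.
Qed.

Variable a : nat -> R.
Hypothesis ha : forall i, (1 <= i)%N -> 2 < a i.
Variables C P : nat -> set (R * R).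
Hypothesis hC : wada_canals a C P.
Variable r : nat.
Hypothesis hr : (1 <= r <= 3)%N.
Local Notation U := (full_lake C r).
Local Notation W := (@open_unit_square R `&` boundary U).

Lemma closed_canal i : (1 <= i)%N -> closed (C i).
Proof.
case: i => [|[|i]] // _; last first.
  by have [ch [r0 [X hd]]] := days ha hC (n := i.+1) isT; exact: (day_closed ha hd).
have [[-> _] _ _] := hC.
by have := @closed_rect R true 0 (1 - (a 1)^-1) (a 1)^-1 (1 - (a 1)^-1).
Qed.

(** Apart from its connecting piece a canal lies in the island where it is dug; the connecting piece
    lies in a box around a point of the centre line of that island. *)
Lemma later_canal n j y : (1 <= n < j)%N -> C j y ->
  exists2 u, island C n u & box u (wall a n / 2) y.
Proof.
move=> /andP[n1]; case: j => // j nj.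
have [|ch [r0 [X hd]]] := days ha hC (n := j); first lia.
have sub : island C j `<=` island C n by apply: island_sub; lia.
have nj' : (n <= j)%N by lia.
have wj := wall_le ha nj'; have w0 := wall_gt0 ha j.
rewrite (day_canal hd) => -[Xy|Sy]; last first.
  exists y; last by apply: box_refl; lra.
  by apply: sub; rewrite (day_island hd); apply: (trim_strip_sub ha hd).
case: (hd) => _ _ _ [X0|[_ [a1 [b1 [a2 [b2 [p [q [i [_ _ _ _ [hi hq bq]]]]]]]]]]] _.
  by move: Xy; rewrite X0.
exists q; last by apply: box_le (bq _ Xy); lra.
apply: sub; rewrite (day_island hd); exists i => //.
case: hq; rewrite /at_first /at_last !if_same => h1 h2 h3.
by apply: Or31; split=> //; rewrite h3 normr0; lra.
Qed.

(** A boundary point is not in the lake, so if it lies on an early canal of lake [r] it is on the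
    frontier of that canal. Otherwise points of the lake arbitrarily close to it come from later
    canals, which stay near the island. *)
Lemma boundary_sub n x : (1 <= n)%N -> boundary U x ->
  (exists2 y, island C n y & box y (wall a n) x) \/
  (exists2 i, (i < n)%N & frontier (C i.+1) x).
Proof.
move=> n1 [cx nx]; apply: contrapT => /not_orP[far nfr].
have w0 := wall_gt0 ha n.
have nU : ~ U x by move=> /lake_open[rho r0 h]; apply: nx; apply/interior_boxP; exists rho.
(* Only the early canals of lake [r] itself are kept; [C i.+1] is dug on day [i.+1], hence the
   shift. *)
pose F i := if (i.+1 %% 3 == r %% 3)%N then C i.+1 else set0.
pose K := \big[setU/set0]_(i < n) F i.
have cK : closed K.
  by apply: closed_bigsetU => i _; rewrite /F; case: ifP => _; [exact: closed_canal|exact: closed0].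
have nK : ~ K x.
  rewrite /K -bigcup_mkord => -[i /= hi]; rewrite /F; case: eqP => // e Cx.
  have [hx|hx] := pselect ((C i.+1)° x); last by apply: nfr; exists i.
  apply: nU; have [k ek] : exists k, i.+1 = (3 * k + r)%N by exists ((i.+1 - r) %/ 3)%N; lia.
  by move: hx; rewrite ek; apply: canal_lake.
have [rho r0 hrho] := closed_sep cK nK.
have m0 : 0 < Num.min rho (wall a n / 4) by rewrite lt_min r0 /=; lra.
have [y [k _ /interior_subset [j /= jk Cy]] bxy] := iffLR (closure_boxP _ _) cx _ m0.
have b1 : box x rho y by apply: box_le bxy; rewrite ge_min lexx.
have b2 : box x (wall a n / 4) y by apply: box_le bxy; rewrite ge_min lexx orbT.
have [le|gt] := leqP (3 * j + r) n.
  apply: (hrho y b1); rewrite /K -bigcup_mkord; exists (3 * j + r).-1%N => /=; first lia.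
  by rewrite /F prednK; [rewrite (_ : _ == _) //; apply/eqP; lia|lia].
have [|u hu bu] := later_canal _ Cy (n := n); first by rewrite n1.
apply: far; exists u => //; apply: box_le (box_trans bu (box_sym b2)); lra.
Qed.

Lemma covered_frontier_canal n ch r0 X e : (1 <= n)%N -> day a C P n ch r0 X -> 0 < e -> e <= 1 ->
  covered (frontier (C n.+1)) e (256 * 60 * ((len ch + 1) / e)).
Proof.
move=> n1 hd e0 e1; have T1 := wall_le1 ha n; have w0 := width_gt0 ha n.
have wT := width_lt ha n; have T0 := wall_gt0 ha n.
have ie : 1 <= e^-1 by rewrite invf_ge1.
have hX : covered (frontier X) e (4 * (1 / e + 1)).
  case: (hd) => _ _ _ [->|[_ [a1 [b1 [a2 [b2 [p [q [i [h1 h2 -> _ _]]]]]]]]]] _; last first.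
    by apply: covered_frontier_rect => //; lra.
  apply: coveredS (covered_le _ (covered0 e)) => [z []//|].
  by rewrite mulr_ge0 // addr_ge0 // divr_ge0 // ltW.
have hS := covered_frontier_strip (day_trim_wf ha hd) (day_trim_roomy ha hd) w0 e0.
rewrite (day_canal hd); apply: coveredS (@frontierU _ _) (covered_le _ (coveredU hX hS)).
have ln : len (trim ch r0 (wall a n.+1)) <= len ch.
  by rewrite (len_trimE ha hd); have := day_r0 ha hd; have := wall_gt0 ha n.+1; lra.
have A : len (trim ch r0 (wall a n.+1)) / e <= len ch / e by rewrite ler_pM2r // invr_gt0.
have B : width a n.+1 / e <= e^-1 by rewrite ler_piMl ?invr_ge0; lra.
have D : (len ch + 1) / e = len ch / e + e^-1 by rewrite mulrDl mul1r.
have L0 : 0 <= len ch / e by rewrite divr_ge0 ?len_ge0 ?ltW //; exact: day_wf hd.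
rewrite D mul1r; lra.
Qed.

Lemma covered_frontier_canal1 e : 0 < e -> e <= 1 -> covered (frontier (C 1)) e (256 * 60 * (1 / e)).
Proof.
move=> e0 e1; have ie : 1 <= e^-1 by rewrite invf_ge1.
have [[-> _] _ _] := hC; have a2 := @ha 1 isT.
have ia : 0 < (a 1)^-1 < 1 / 2 by rewrite invr_gt0 invf_plt ?posrE; lra.
have := @covered_frontier_rect 0 (1 - (a 1)^-1) (a 1)^-1 (1 - (a 1)^-1) 1 e.
move=> /(_ ltac:(lra) ltac:(lra) e0); apply: covered_le; lra.
Qed.

(** Since [t' <= e], a box of half-side [T / 2 - e] around an inner centre lies in the canal. So the
    new island is a shell in the old strip, of thickness [O(e)]. *)
Lemma covered_island n ch r0 X e : day a C P n ch r0 X -> wall a n.+1 <= e -> e <= wall a n ->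
  covered (island C n.+1) e (256 * (52 * (len ch / e) + 3 * (wall a n / e) + 4)).
Proof.
move=> hd h1 h2; have t0 := wall_gt0 ha n.+1; have ew := widthS a n.
apply: covered_shell_chain => //; [exact: day_wf hd|lra|] => z hz.
have [|i [q [hi hq bq]]] := day_near ha hd (z := z); first by apply: island_sub hz.
exists i, q; split=> //; first by apply: inner_le hq; have := wall_gt0 ha n; lra.
move=> z' hz' bz'; apply: (@island_canal _ C n.+1 n.+1 z') => //; first by rewrite leqnn.
apply/interior_boxP; exists e; first lra.
move=> y hy; apply: (day_box_canal ha hd hi hq).
by apply: box_le (box_trans bz' hy); lra.
Qed.

End Counts.

(** * Two-sided counts between consecutive walls *)

Section Growth.
Variable R : realType.
Implicit Types (w t T e B : R) (p q z x : R * R) (E : set (R * R)).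
Variable a : nat -> R.
Hypothesis ha : forall i, (1 <= i)%N -> 2 < a i.
Variables C P : nat -> set (R * R).
Hypothesis hC : wada_canals a C P.

Section LowerCount.
Variable r : nat.
Hypothesis hr : (1 <= r <= 3)%N.
Local Notation W := (@open_unit_square R `&` boundary (full_lake C r)).

(* [y] ranges over the [i]-th cell of the strip; it lies at distance [T / 2] ahead
   of the projection [q] of an outer point [z], near which there is a point of
   [W]. Along the direction of the segment [y] is within [O(e)] of [W], up to a
   translation by one of [0, T, - T]; hence the gain over the trivial [T ^+ 2]. *)
Lemma lower_count n (ch : chain R) r0 X e B : (2 <= n)%N -> day a C P n ch r0 X ->
  wall a n.+1 <= e -> e <= wall a n -> covered W e B -> len ch <= 378 * (B * e) + 16.
Proof.
move=> n2 hd e1 e2 [k [x [hk hx]]].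
have T0 := wall_gt0 ha n; have t0 := wall_gt0 ha n.+1; have T1 := wall_le1 ha n.
have tT := wall_half ha n.
set T := wall a n in e2 T0 T1 tT *.
(* [d] is the offset of [y] from the outer point along [b]. The outer point is within
   [3 * wall a n.+1 <= 3 * e] of the square [j], and across the segment it is within [T] of [y]. The
   area is [7 * e * (7 * e + 2 * T) <= 63 * e * T]. *)
pose Q b (d : R) j : set (R * R) := rect b (co b (x j) - 3 * e + d) (co b (x j) + 4 * e + d)
  (co (~~ b) (x j) - 3 * e - T) (co (~~ b) (x j) + 4 * e + T).
have aQ b d j : area_le (Q b d j) (63 * e * T).
  have s1 : co b (x j) - 3 * e + d <= co b (x j) + 4 * e + d by lra.
  have s2 : co (~~ b) (x j) - 3 * e - T <= co (~~ b) (x j) + 4 * e + T by lra.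
  apply: area_leS (area_le_rect b s1 s2) => //.
  rewrite (_ : (_ - _) * (_ - _) = 7 * e * (7 * e + 2 * T)); last by ring.
  by nra.
pose Q6 j := Q true 0 j `|` Q true T j `|` Q true (- T) j `|`
             (Q false 0 j `|` Q false T j `|` Q false (- T) j).
have aQ6 j : area_le (Q6 j) (6 * (63 * e * T)).
  have -> : 6 * (63 * e * T) = (63 * e * T + 63 * e * T + 63 * e * T) +
    (63 * e * T + 63 * e * T + 63 * e * T) by ring.
  by apply: area_leU; apply: area_leU; (try apply: area_leU); exact: aQ.
have aF b (u : R) : 0 <= u -> area_le (rect b u (u + 3 * T) 0 1) (3 * T).
  move=> u0; apply: area_leS (@area_le_rect R b u (u + 3 * T) 0 1 _ _) => //; lra.
(* Near the sides of the square the boundary point found for [y] might leave the open square. This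
   frame has area at most [12 * T], which costs only a constant after division by [T]. *)
pose F := rect true 0 (0 + 3 * T) 0 1 `|` rect true (1 - 3 * T) (1 - 3 * T + 3 * T) 0 1 `|`
  (rect false 0 (0 + 3 * T) 0 1 `|` rect false (1 - 3 * T) (1 - 3 * T + 3 * T) 0 1).
have sub : pstrip ch T `<=` [set z | exists2 j, (j < k)%N & Q6 j z] `|` (box (vtx ch 0) T `|` F).
  move=> y Sy; have iy : island C n y by rewrite (day_island hd).
  have [/= sq1 sq2] := island_square iy.
  have [Fy|nF] := pselect (F y); first by right; right.
  have far b : 3 * T < co b y < 1 - 3 * T.
    apply: contrapT => h; apply: nF; rewrite /F.
    have [h1|h1] := leP (co b y) (3 * T).
      by case: b h h1 => /= h h1; [left; left|right; left]; split=> /=; lra.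
    have [h2|h2] := leP (1 - 3 * T) (co b y); last by case: h; rewrite h1 h2.
    by case: b h h1 h2 => /= h h1 h2; [left; right|right; right]; split=> /=; lra.
  have [i hi [lo hii lt]] := pstrip_cell (day_wf hd) (day_roomy hd) (ltW T0) Sy.
  rewrite -/T in lo hii lt.
  have ss : sgn ch i * sgn ch i = 1 by case: (sgnP (day_wf hd) hi) => ->; lra.
  pose q := mkpt (axis ch i) (co (axis ch i) y - sgn ch i * (T / 2)) (co (~~ axis ch i) (vtx ch i)).
  have qy : adv ch i q y = T / 2.
    by rewrite /adv co_mk opprB addrC subrK mulrA ss mul1r.
  have lq : lat ch i (vtx ch i) q = 0 by rewrite /lat co_mkN subrr.
  have F1 := advD ch i (vtx ch i) q y; have F2 := advD ch i q y (vtx ch i.+1).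
  have F3 := advD ch i (vtx ch i) y (vtx ch i.+1); rewrite -/(seglen ch i) in F3.
  have F4 := latD ch i (vtx ch i) q y.
  (* Cells begin [T / 2] after their vertex, so [q], taken [T / 2] behind [y], is inner. The first
     cell begins at the vertex itself; its beginning is left to the box around [vtx ch 0]. *)
  have [ex|nex] := pselect (i = 0%N /\ adv ch i (vtx ch i) y < T).
    right; left; case: ex => i0 h; clear nF; subst i.
    apply/(in_boxP (day_wf hd) _ _ _ hi); split; last lra.
    by move: lo; rewrite /cell_lo /= => lo; apply/norm_leP; lra.
  have hq : inner ch (T / 2) i q.
    split=> //.
      move: lo; rewrite /at_first /cell_lo; case: eqP => [e0|_] lo; last lra.
      have [h|h] := leP T (adv ch i (vtx ch i) y); first lra.
      by case: nex.
    by move: hii; rewrite /at_last /cell_hi; case: ifP => _; lra.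
  have by_ : box q (T / 2) y.
    apply/(in_boxP (day_wf hd) _ _ _ hi); rewrite qy; split; last by rewrite -F4 lq add0r in lt.
    by apply/norm_leP; lra.
  have [z [eps [iz bz he az]]] := day_outer ha hd hi hq.
  have [w [wb bw]] := boundary_near ha hC hr (n := n.+1) n2 iz.
  have yw b : `|co b w - co b y| < 3 * T.
    have /norm_leP := bw b; have /norm_leP := bz b; have /norm_leP := by_ b.
    by rewrite -/T => ? ? ?; rewrite ltr_norml; lra.
  have Ww : W w.
    split=> //; split; [have := yw true; have := far true|have := yw false; have := far false];
      by rewrite /= ltr_norml; lra.
  have [j hj /squareE sj] := hx w Ww.
  left; exists j => //.
  have g (b : bool) (d : R) : b = axis ch i -> co b y - co b z = d -> Q b d j y.
    move=> eb ed; split.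
      by have := sj b; have /norm_leP := bw b; lra.
    have := sj (~~ b); have /norm_leP := bw (~~ b); have /norm_leP := bz (~~ b).
    by have /norm_leP := by_ (~~ b); rewrite -/T; lra.
  have F5 := advD ch i q z y; rewrite qy az in F5.
  have dz : co (axis ch i) y - co (axis ch i) z = 0 \/ co (axis ch i) y - co (axis ch i) z = T \/
      co (axis ch i) y - co (axis ch i) z = - T.
    move: F5; rewrite /adv -/T; case: (sgnP (day_wf hd) hi) => ->; case: he => -> h.
    - by left; lra.
    - by right; left; lra.
    - by left; lra.
    - by right; right; lra.
  case eb: (axis ch i) dz => -[h|[h|h]].
  - by left; left; left; apply: g.
  - by left; left; right; apply: g.
  - by left; right; apply: g.
  - by right; left; left; apply: g.
  - by right; left; right; apply: g.
  - by right; right; apply: g.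
have : T * len ch <= k%:R * (6 * (63 * e * T)) + ((2 * T) ^+ 2 + (3 * T + 3 * T + (3 * T + 3 * T))).
  apply: (@ostrip_le _ ch T (pstrip ch T)).
  - exact: day_wf hd.
  - exact: day_roomy hd.
  - exact: day_simple hd.
  - exact: ltW.
  - by apply: ostrip_sub (day_wf hd) (ltW T0).
  - apply: area_leS sub (lexx _) _; apply: area_leU; first by apply: area_le_bigU_cst.
    apply: area_leU; first by apply: area_le_box; exact: ltW.
    have T3 : 0 <= 1 - 3 * T.
      have n2' : (2 <= n)%N by [].
      have := wall_le ha n2'; have := wall_half ha 0; have := wall_half ha 1; rewrite wall0 -/T; lra.
    by apply: area_leU; apply: area_leU; apply: aF; lra.
have -> : k%:R * (6 * (63 * e * T)) + ((2 * T) ^+ 2 + (3 * T + 3 * T + (3 * T + 3 * T))) =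
  T * (378 * (k%:R * e) + 4 * T + 12) by ring.
rewrite ler_pM2l // => h; apply: le_trans h _.
have : k%:R * e <= B * e by rewrite ler_wpM2r //; lra.
lra.
Qed.
End LowerCount.

Section Chosen.
Variables (ch : nat -> chain R) (r0 : nat -> R) (X : nat -> set (R * R)).
Hypothesis hday : forall n, (1 <= n)%N -> day a C P n (ch n) (r0 n) (X n).
Local Notation L n := (len (ch n)).

Lemma growth_upper n : (1 <= n)%N -> L n + 2 <= (L 1 + 2) * 2 ^+ n.
Proof.
have l1 := len_ge0 (day_wf (hday (leqnn 1))).
elim: n => // -[|n] IH _; first by rewrite expr1; lra.
have := IH isT; have := len_upper ha (hday (n := n.+1) isT) (hday (n := n.+2) isT).
by rewrite [2 ^+ n.+2]exprS; lra.
Qed.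

(** The quantity [L n - K * wall a n] at least doubles each day, because walls decrease. It is at
    least [1 / 4] once [K * wall a n < 1 / 4], as every strip is longer than [1 / 2]. *)
Lemma growth_lower : exists delta n0, 0 < delta /\
  forall n, (n0 <= n)%N -> delta * 2 ^+ n <= L n.
Proof.
pose K : R := 64 * 576.
have K0 : 0 < K by apply: mulr_gt0; rewrite ltr0n.
have K4 : 0 < 4 * K by lra.
have [n1 hn1] := @wall_small _ _ ha (1 / (4 * K)) ltac:(exact: divr_gt0 ltr01 K4).
pose n0 := n1.+1.
have hn0 : K * wall a n0 < 1 / 4.
  have : wall a n0 < 1 / (4 * K) by apply: le_lt_trans hn1; apply: wall_le.
  by rewrite ltr_pdivlMr // => h; lra.
have step k : 1 / 4 * 2 ^+ k <= L (n0 + k) - K * wall a (n0 + k).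
  elim: k => [|k IH].
    rewrite addn0 expr0; have := day_len ha hC (n := n0) isT (hday (n := n0) isT); lra.
  have := len_lower_rec ha (hday (n := (n0 + k)%N) isT) (hday (n := (n0 + k).+1) isT).
  have : K * wall a (n0 + k).+1 <= K * wall a (n0 + k) by rewrite ler_pM2l //; exact/ltW/wall_lt.
  by rewrite -/K addnS exprS; lra.
exists (1 / 4 / 2 ^+ n0), n0; split; first by rewrite !divr_gt0 // exprn_gt0.
move=> n hn; have := step (n - n0)%N; rewrite subnKC // => h.
have -> : 1 / 4 / 2 ^+ n0 * 2 ^+ n = 1 / 4 * 2 ^+ (n - n0) :> R.
  by rewrite -{1}(subnK hn) exprD; field; rewrite expf_neq0.
by apply: le_trans h _; rewrite lerBlDr lerDl; apply: mulr_ge0; apply: ltW => //; exact: wall_gt0.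
Qed.

Variable r : nat.
Hypothesis hr : (1 <= r <= 3)%N.
Local Notation W := (@open_unit_square R `&` boundary (full_lake C r)).

Lemma upper_count n e : (1 <= n)%N -> wall a n.+1 <= e -> e <= wall a n ->
  covered W e (256 * 588 * (L 1 + 2) * (2 ^+ n / e)).
Proof.
move=> n1 e1 e2; have t0 := wall_gt0 ha n.+1; have e0 : 0 < e by lra.
have T1 := wall_le1 ha n; have e11 : e <= 1 by lra.
pose A := L 1 + 2.
have l1 := len_ge0 (day_wf (hday (leqnn 1))).
have A2 : 2 <= A by rewrite /A; lra.
have ie0 : 0 < e^-1 by rewrite invr_gt0.
have ie1 : 1 <= e^-1 by rewrite invf_ge1.
have c60 : (0 : R) <= 256 * 60 by lra.
pose b (i : nat) := 256 * 60 * (A * (2 ^+ i / e)).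
have hb i : (i < n.+1)%N -> covered (frontier (C i.+1)) e (b i).
  case: i => [|i] hi.
    apply: covered_le (covered_frontier_canal1 ha hC e0 e11).
    rewrite /b expr0 ler_wpM2l // !mul1r ler_peMl //; lra.
  apply: covered_le (covered_frontier_canal ha _ (hday (n := i.+1) isT) e0 e11) => //.
  rewrite /b ler_wpM2l // mulrA ler_pM2r //.
  by have := growth_upper (n := i.+1) isT; rewrite -/A; lra.
have h1 := covered_nbhd e0 e1 (covered_island ha (hday n1) e1 e2).
have h2 := covered_bigU hb.
apply: coveredS (covered_le _ (coveredU h1 h2)).
  move=> z [_ bz]; have [[y iy by_]|[i hi fz]] := boundary_sub ha hC hr (n := n.+1) isT bz.
    by left; exists y.
  by right; exists i.
have sumb : \sum_(i < n.+1) b i <= 256 * 60 * (A * (2 * 2 ^+ n / e)).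
  rewrite /b -mulr_sumr -mulr_sumr -mulr_suml.
  rewrite ler_wpM2l // ler_wpM2l //; first by lra.
  rewrite ler_pM2r // -exprS.
  elim: (n.+1) => [|m IH]; first by rewrite big_ord0 expr0.
  by rewrite big_ord_recr /= [2 ^+ m.+1]exprS; lra.
apply: le_trans (lerD (lexx _) sumb) _.
have g := growth_upper n1; rewrite -/A in g.
have g' : (L n + 2) / e <= A * (2 ^+ n / e) by rewrite mulrA ler_pM2r.
rewrite mulrDl in g'.
have T' : wall a n / e <= e^-1 by rewrite ler_piMl // ltW.
(* [588 = 9 * 52 + 2 * 60]: the island enlarged by [e], and the geometric sum of the frontiers. The
   lower-order terms are absorbed by the 2 in [L n + 2]. *)
rewrite -/A (_ : 256 * 588 * A * (2 ^+ n / e) = 256 * 588 * (A * (2 ^+ n / e))); last by ring.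
rewrite (_ : A * (2 * 2 ^+ n / e) = 2 * (A * (2 ^+ n / e))); last by ring.
move: (A * (2 ^+ n / e)) g' => Y g'; move: (wall a n / e) T' => Z T'.
move: (L n / e) g' => V g'; lra.
Qed.

End Chosen.

Lemma wada_counts r : (1 <= r <= 3)%N -> exists (K delta : R) (n0 : nat),
  [/\ 0 < K, 0 < delta & forall n e, (n0 <= n)%N -> wall a n.+1 <= e -> e <= wall a n ->
    covered (@open_unit_square R `&` boundary (full_lake C r)) e (K * (2 ^+ n / e)) /\
    forall B, covered (@open_unit_square R `&` boundary (full_lake C r)) e B ->
      delta * 2 ^+ n <= B * e].
Proof.
move=> hr.
(* A choice of data for all days at once; index 0 receives those of day 1 as a dummy value. *)
have key n : exists y : chain R * R * set (R * R),
    (1 <= n)%N -> day a C P n y.1.1 y.1.2 y.2.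
  have [n1|n0] := leqP 1 n.
    by have [c [s [Y hd]]] := days ha hC n1; exists (c, s, Y).
  by have [c [s [Y hd]]] := days ha hC (leqnn 1); exists (c, s, Y) => n1; lia.
have [f hf] := choice key.
have l1 := len_ge0 (day_wf (hf 1%N isT)).
have [delta [n0 [d0 hd]]] := @growth_lower (fun n => (f n).1.1) _ _ hf.
(* From day [m] on, the additive 16 of [lower_count] is at most half of [delta * 2 ^+ n]; this turns
   378 into 756. *)
have [m hm] : exists m, 32 <= delta * 2 ^+ m.
  have [_ h] := andP (truncn_itv (ltW (divr_gt0 (ltr0n R 32) d0))).
  exists (Num.truncn (32%:R / delta)).+1.
  rewrite mulrC -ler_pdivrMr //; apply: le_trans (ltW h) _.
  by rewrite -natrX ler_nat; apply/ltnW/ltn_expl.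
exists (256 * 588 * (len (f 1%N).1.1 + 2)), (delta / 756), (maxn (maxn n0 m) 2); split.
- by apply: mulr_gt0; lra.
- by apply: divr_gt0; lra.
move=> n e; rewrite !geq_max => /andP[/andP[nn0 nm] n2] e1 e2; split.
  by apply: (@upper_count (fun n => (f n).1.1) _ _ hf) => //; lia.
move=> B hB; have n1 : (1 <= n)%N by lia.
have := lower_count hr n2 (hf n n1) e1 e2 hB; have := hd n nn0.
have : delta * 2 ^+ m <= delta * 2 ^+ n by rewrite ler_pM2l // ler_eXn2l // ltr1n.
lra.
Qed.

End Growth.

(** * Asymptotics *)

Section Limsup.
Variable R : realType.
Implicit Types (g : R -> R) (x d e : R).

Lemma near_right0P (Q : R -> Prop) :
  (\forall e \near 0^'+, Q e) <-> exists2 e0, 0 < e0 & forall e, 0 < e < e0 -> Q e.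
Proof.
split=> [/nbhs_ballP[e0 /= e00 h]|[e0 e00 h]].
  exists e0 => // e /andP[h1 h2]; apply: (h e) => //=.
  by rewrite /ball /= sub0r normrN gtr0_norm.
apply/nbhs_ballP; exists e0 => //= e; rewrite /ball /= sub0r normrN => h1 h2.
by apply: h; rewrite h2; rewrite gtr0_norm in h1.
Qed.

Lemma limf_esup_le g x (F : set_system R) : (\forall e \near F, g e <= x) ->
  (limf_esup (fun e => (g e)%:E) F <= x%:E)%E.
Proof.
move=> h; apply: ge_ereal_inf; eexists; first by exists [set e | g e <= x].
by apply: ge_ereal_sup => _ [e /= he <-]; rewrite lee_fin.
Qed.

Lemma limf_esup_ge g x (F : set_system R) : ProperFilter F -> (\forall e \near F, x <= g e) ->
  (x%:E <= limf_esup (fun e => (g e)%:E) F)%E.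
Proof.
move=> FF h; apply: le_ereal_inf_tmp => _ [V FV <-].
have [e [Ve he]] := @filter_ex _ F _ _ (filterI FV h).
by apply: le_trans (ereal_sup_ubound _); [|exists e => //]; rewrite lee_fin.
Qed.

Lemma limf_esup_lt g x (F : set_system R) : Filter F ->
  (limf_esup (fun e => (g e)%:E) F < x%:E)%E -> \forall e \near F, g e <= x.
Proof.
move=> FF /ereal_inf_lt[_ [V FV <-] h]; apply: filterS FV => e Ve.
rewrite -lee_fin; apply: le_trans (ltW h); apply: ereal_sup_ubound; exists e => //.
Qed.

Lemma limf_einf_EFin g (F : set_system R) :
  limf_einf (fun e => (g e)%:E) F = (- limf_esup (fun e => (- g e)%:E) F)%E.
Proof. by []. Qed.

Lemma limf_both g d (F : set_system R) : ProperFilter F ->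
  (limf_esup (fun e => (g e)%:E) F = d%:E /\ limf_einf (fun e => (g e)%:E) F = d%:E) <->
  (forall eta, 0 < eta -> \forall e \near F, `|g e - d| <= eta).
Proof.
move=> FF; split=> [[h1 h2] eta eta0|h].
  have l1 : \forall e \near F, g e <= d + eta.
    by apply: limf_esup_lt; rewrite h1 lte_fin; lra.
  have l2 : \forall e \near F, - g e <= - d + eta.
    apply: limf_esup_lt; move: h2; rewrite limf_einf_EFin => /eqP; rewrite eqe_oppLR => /eqP->.
    by rewrite -EFinN lte_fin; lra.
  near=> e; have : g e <= d + eta by near: e.
  have : - g e <= - d + eta by near: e.
  by move=> ? ?; rewrite ler_norml; lra.
have le_of (y : \bar R) (x : R) : (forall eta, 0 < eta -> (y <= (x + eta)%:E)%E) -> (y <= x%:E)%E.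
  by move=> hy; apply/lee_addgt0Pr => eta eta0; rewrite -EFinD; exact: hy.
have ge_of (y : \bar R) (x : R) : (forall eta, 0 < eta -> ((x - eta)%:E <= y)%E) -> (x%:E <= y)%E.
  by move=> hy; apply/lee_subgt0Pr => eta eta0; rewrite -EFinB; exact: hy.
have esup (f : R -> R) (x : R) : (forall eta, 0 < eta -> \forall e \near F, `|f e - x| <= eta) ->
    limf_esup (fun e => (f e)%:E) F = x%:E.
  move=> hf; apply/eqP; rewrite eq_le; apply/andP; split.
    apply: le_of => eta /hf hn; apply: limf_esup_le; apply: filterS hn => e.
    by rewrite ler_norml; lra.
  apply: ge_of => eta /hf hn; apply: limf_esup_ge; apply: filterS hn => e.
  by rewrite ler_norml; lra.
split; first exact: esup.
rewrite limf_einf_EFin (esup _ (- d)) ?EFinN ?oppeK // => eta /h hn.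
apply: filterS hn => e; rewrite !ler_norml; lra.
Unshelve. all: by end_near. Qed.

Lemma coverableP (S : set (R * R)) e (k : nat) :
  coverable S e k <-> exists x : nat -> R * R, forall z, S z -> exists2 j, (j < k)%N & square (x j) e z.
Proof.
split=> [[x hx]|[x hx]].
  exists (fun j => if insub j is Some i then x i else 0) => z /hx[i _ hi].
  by exists i => //; rewrite valK.
by exists (fun i => x i) => z /hx[j hj sj]; exists (Ordinal hj).
Qed.

(** A finite cover exists by hypothesis, so the default value 0 of [covering_number] does not
    occur. *)
Lemma covering_numberP (S : set (R * R)) e B : covered S e B ->
  covered S e (covering_number S e)%:R /\ (covering_number S e)%:R <= B.
Proof.
move=> [k [x [hk hx]]].
have ex : exists k, `[< coverable S e k >] by exists k; apply/asboolP/coverableP; exists x.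
have [m /asboolP cm hm] := ex_minnP ex.
have hmin j : coverable S e j -> (m <= j)%N by move=> /asboolP; exact: hm.
have : [set k | coverable S e k /\ forall j, coverable S e j -> (k <= j)%N] (covering_number S e).
  by apply: xgetPex; exists m.
move=> [/coverableP[y hy] h]; split; first by exists (covering_number S e), y.
by apply: le_trans hk; rewrite ler_nat; apply: h; apply/coverableP; exists x.
Qed.

End Limsup.

Section Asymptotics.
Variable R : realType.
Variable a : nat -> R.
Hypothesis ha : forall i, (1 <= i)%N -> 2 < a i.
Local Notation S n := (\sum_(1 <= i < n.+1) ln (a i)).

Lemma ln_wall n : ln (wall a n) = - S n.
Proof.
elim: n => [|n IH]; first by rewrite wall0 ln1 big_geq // oppr0.
have an := @ha n.+1 isT; have w0 := wall_gt0 ha n.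
by rewrite wallS ln_div ?posrE // ?IH; [rewrite [in RHS]big_nat_recr //= opprD|lra].
Qed.

Lemma sum_ln_ge n : n%:R * ln 2 <= S n.
Proof.
elim: n => [|n IH]; first by rewrite mul0r big_geq.
rewrite big_nat_recr //= -natr1 mulrDl mul1r lerD // ler_ln ?posrE //.
  by have := @ha n.+1 isT; lra.
by have := @ha n.+1 isT; lra.
Qed.

Lemma level N e : 0 < e -> e < wall a N ->
  exists n, [/\ (N <= n)%N, wall a n.+1 <= e & e <= wall a n].
Proof.
move=> e0 eN; have [m hm] := wall_small ha e0.
have ex : exists m, wall a m <= e by exists m; exact: ltW.
have [k hk hmin] := ex_minnP ex.
have kN : (N < k)%N.
  rewrite ltnNge; apply/negP => kN; have := wall_le ha kN; lra.
case: k hk hmin kN => // k hk hmin kN; exists k; split=> //.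
rewrite leNgt; apply/negP => h; have := hmin k (ltW h); rewrite ltnn //.
Qed.

Variables (W : set (R * R)) (K delta : R) (n0 : nat).
Hypotheses (K0 : 0 < K) (delta0 : 0 < delta).
Hypothesis counts : forall n e, (n0 <= n)%N -> wall a n.+1 <= e -> e <= wall a n ->
  covered W e (K * (2 ^+ n / e)) /\ forall B, covered W e B -> delta * 2 ^+ n <= B * e.

Let rho (e : R) : R := ln (covering_number W e)%:R / ln (e^-1).
Let c1 : R := `|ln K| + `|ln delta|.

Lemma rho_bound n e : (n0 <= n)%N -> (1 <= n)%N -> wall a n.+1 <= e -> e <= wall a n ->
  0 < ln (e^-1) /\ `|rho e - (1 + n%:R * ln 2 / ln (e^-1))| <= c1 / ln (e^-1).
Proof.
move=> hn n1 e1 e2; have [cov low] := counts hn e1 e2.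
have w0 := wall_gt0 ha n.+1; have e0 : 0 < e by lra.
have el1 : e < 1 by have := wall_lt_half ha n1; lra.
have [cN hN] := covering_numberP cov; have hN' := low _ cN.
set N : R := (covering_number W e)%:R in cN hN hN' *.
have p2 : 0 < 2 ^+ n :> R by rewrite exprn_gt0.
have N0 : 0 < N.
  have : 0 < N * e by apply: lt_le_trans hN'; rewrite mulr_gt0.
  by rewrite pmulr_lgt0.
have ie0 : 0 < e^-1 by rewrite invr_gt0.
have s0 : 0 < ln (e^-1) by apply: ln_gt0; rewrite invf_gt1.
split=> //; rewrite /rho -/N; set s := ln (e^-1) in s0 *.
have up : ln N <= ln K + n%:R * ln 2 + s.
  have -> : ln K + n%:R * ln 2 + s = ln (K * (2 ^+ n / e)).
    by rewrite !lnM ?posrE ?mulr_gt0 // lnXn // -[ln 2 *+ n]mulr_natl addrA.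
  by rewrite ler_ln ?posrE // !mulr_gt0.
have lo : ln delta + n%:R * ln 2 + s <= ln N.
  have -> : ln delta + n%:R * ln 2 + s = ln (delta * (2 ^+ n / e)).
    by rewrite !lnM ?posrE ?mulr_gt0 // lnXn // -[ln 2 *+ n]mulr_natl addrA.
  rewrite ler_ln ?posrE // ?mulr_gt0 // mulrA ler_pdivrMr //.
have -> : ln N / s - (1 + n%:R * ln 2 / s) = (ln N - s - n%:R * ln 2) / s by field; lra.
rewrite normrM [`|s^-1|]gtr0_norm ?invr_gt0 // ler_pM2r ?invr_gt0 // /c1.
have := ler_norm (ln K); have := ler_norm (- ln delta); rewrite normrN.
have := normr_ge0 (ln K); have := normr_ge0 (ln delta).
by move=> *; rewrite ler_norml; lra.
Qed.

(** The constants of the counts are divided by [ln (1 / e)], and vanish in the limit since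
    [S n >= n * ln 2]; what remains is to compare [n * ln 2 / ln (1 / e)] with the terms of the
    sequence. *)
Lemma dim_iff d : has_minkowski_dim W d <->
  (1 + n%:R * ln 2 / S n) @[n --> \oo] --> d.
Proof.
have l2 : 0 < ln 2 :> R by apply: ln_gt0; lra.
have c10 : 0 <= c1 by rewrite addr_ge0.
have Sbig (eta : R) : 0 < eta -> exists2 N, (1 <= N)%N & forall n, (N <= n)%N -> 0 < S n /\ (ln 2 + c1) / S n <= eta.
  move=> eta0; pose M := (ln 2 + c1) / eta / ln 2.
  have M0 : 0 <= M by rewrite !divr_ge0 // ?ltW //; lra.
  have /andP[_ hM] := truncn_itv M0.
  exists (Num.truncn M).+1 => // n hn.
  have n1 : 0 < n%:R :> R by rewrite ltr0n; lia.
  have Mn : M <= n%:R by apply: le_trans (ltW hM) _; rewrite ler_nat.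
  have hS := sum_ln_ge n; have S0 : 0 < S n by apply: lt_le_trans hS; rewrite mulr_gt0.
  split=> //; rewrite ler_pdivrMr // -ler_pdivrMl // mulrC; apply: le_trans hS.
  by rewrite -ler_pdivrMr.
have lne n e : wall a n.+1 <= e -> e <= wall a n -> S n <= ln (e^-1) <= S n.+1.
  move=> h1 h2; have w1 := wall_gt0 ha n.+1; have w2 := wall_gt0 ha n.
  have e0 : 0 < e by lra.
  rewrite lnV ?posrE // -[S n]opprK -[S n.+1]opprK -!ln_wall !lerN2.
  by rewrite !ler_ln ?posrE // h1 h2.
rewrite /has_minkowski_dim /upper_minkowski /lower_minkowski.
apply: iff_trans (limf_both rho d _) _.
split=> h.
  apply/cvgrPdist_le => eta eta0.
  have [e0 e00 he] := iffLR (near_right0P _) (h (eta / 2) ltac:(lra)).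
  have [N N1 hN] := Sbig (eta / 2) ltac:(lra).
  have [m hm] := wall_small ha e00.
  near=> n.
  have [nm nN nn0] : [/\ (m <= n)%N, (N <= n)%N & (n0 <= n)%N].
    by split; near: n; exact: nbhs_infty_ge.
  have w0 := wall_gt0 ha n; have wm := wall_le ha nm.
  (* At [e = wall a n] the logarithm [ln (1 / e)] is exactly [S n], so the dimension yields the
     limit along the walls. *)
  have hr := he (wall a n) ltac:(lra).
  have n1 := leq_trans N1 nN.
  have [_] := rho_bound nn0 n1 (ltW (wall_lt ha n)) (lexx _).
  rewrite lnV ?posrE // ln_wall opprK => hb.
  have [S0 hS] := hN n nN.
  have : c1 / S n <= (ln 2 + c1) / S n by rewrite ler_pM2r ?invr_gt0 //; lra.
  move: hr hb; rewrite !ler_norml; lra.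
move=> eta eta0; apply/near_right0P.
have [m _ hm] := iffLR (cvgrPdist_le _ _) h (eta / 2) ltac:(lra).
have [N N1 hN] := Sbig (eta / 2) ltac:(lra).
pose M := maxn (maxn m N) n0.
exists (wall a M) => [|e /andP[e0 eM]]; first exact: wall_gt0.
have [n [Mn e1 e2]] := level e0 eM.
have [mn Nn n0n] : [/\ (m <= n)%N, (N <= n)%N & (n0 <= n)%N] by move: Mn; rewrite /M !geq_max => /andP[/andP[? ?] ?].
have n1 := leq_trans N1 Nn.
have [s0 hb] := rho_bound n0n n1 e1 e2.
have /andP[s1 s2] := lne n e e1 e2.
have [S0 hS] := hN n Nn; have [S0' hS'] := hN n.+1 (leqW Nn).
have := hm n mn; have := hm n.+1 (leqW mn); rewrite /= => x1 x2.
set s := ln (e^-1) in s0 s1 s2 hb *.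
have p0 m' : 0 <= m'%:R * ln 2 :> R by rewrite mulr_ge0 // ltW.
have l20 := ltW l2.
have u1 : n%:R * ln 2 / s <= n%:R * ln 2 / S n.
  by rewrite ler_wpM2l // lef_pV2 // posrE.
(* [S n.+1 - S n] may be unbounded, so [s] cannot simply be replaced by [S n]. The lower bound uses
   the term of index [n.+1]; the change of numerator costs only [ln 2 / S n]. *)
have u2 : n.+1%:R * ln 2 / S n.+1 - ln 2 / S n <= n%:R * ln 2 / s.
  have : n.+1%:R * ln 2 / S n.+1 <= n.+1%:R * ln 2 / s.
    by rewrite ler_wpM2l // lef_pV2 // posrE.
  have : ln 2 / s <= ln 2 / S n by rewrite ler_wpM2l // lef_pV2 // posrE.
  rewrite -[n.+1%:R]natr1; move: (n%:R) => x; rewrite !mulrDl !mul1r; lra.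
have u3 : c1 / s <= c1 / S n by rewrite ler_wpM2l // lef_pV2 // posrE.
rewrite mulrDl in hS; move: x1 x2 hb; rewrite !ler_norml.
have cS : 0 <= c1 / S n by rewrite divr_ge0 // ltW.
have lS : 0 <= ln 2 / S n by rewrite divr_ge0 // ltW.
lra.
Unshelve. all: by end_near. Qed.

End Asymptotics.

Theorem theorem1p4 (R : realType) :
  (forall (c : R) (W : set (R * R)), 2 < c ->
     is_wada_set (fun=> c) W -> has_minkowski_dim W (ln (2 * c) / ln c)) /\
  ((ln (2 * c) / ln c : R) @[c --> +oo] --> (1 : R)) /\
  (forall (a : nat -> R) (W : set (R * R)) (d : R),
     (forall i : nat, (1 <= i)%N -> 2 < a i) -> is_wada_set a W ->
     (has_minkowski_dim W d <->
      (1 + n%:R * ln 2 / \sum_(1 <= i < n.+1) ln (a i)) @[n --> \oo] --> d)).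
Proof.
have main (a : nat -> R) (W : set (R * R)) (d : R) :
    (forall i : nat, (1 <= i)%N -> 2 < a i) -> is_wada_set a W ->
    (has_minkowski_dim W d <->
     (1 + n%:R * ln 2 / \sum_(1 <= i < n.+1) ln (a i)) @[n --> \oo] --> d).
  move=> ha [C [P [r [hC hr ->]]]].
  have [K [delta [n0 [K0 d0 h]]]] := wada_counts ha hC hr.
  exact: (dim_iff ha K0 d0 h).
have ratio (c : R) : 1 < c -> ln (2 * c) / ln c = 1 + ln 2 / ln c.
  move=> c1; have l := ln_gt0 c1; rewrite lnM ?posrE //; [field; lra|lra].
split; last split=> //.
- move=> c W c2 hW; have c1 : 1 < c by lra.
  apply/(main _ _ _ (fun _ _ => c2) hW); apply/cvgrPdist_le => eta eta0; near=> n.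
  (* For a constant sequence the terms are constant from index 1 on; at index 0 the quotient is 0 by
     the convention for division by 0. *)
  have n1 : (1 <= n)%N by near: n; exact: nbhs_infty_ge.
  have l := ln_gt0 c1; rewrite ratio // sumr_const_nat subSS subn0 -[ln c *+ n]mulr_natl.
  have n0 : 0 < n%:R :> R by rewrite ltr0n.
  rewrite (_ : n%:R * ln 2 / (n%:R * ln c) = ln 2 / ln c); last by field; lra.
  by rewrite subrr normr0 ltW.
- apply/cvgrPdist_le => eta eta0; near=> c.
  have l2 : 0 < ln 2 :> R by apply: ln_gt0; lra.
  have c1 : 1 < c by near: c; apply: nbhs_pinfty_gt; exact: num_real.
  have ce : expR (ln 2 / eta) <= c by near: c; apply: nbhs_pinfty_ge; exact: num_real.
  have l := ln_gt0 c1; rewrite ratio // opprD addrA subrr sub0r normrN.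
  have : ln 2 / eta <= ln c by rewrite -[ln 2 / eta]expRK ler_ln ?posrE ?expR_gt0 //; lra.
  rewrite ler_pdivrMr // => h; rewrite gtr0_norm ?divr_gt0 // ler_pdivrMr //; lra.
Unshelve. all: by end_near. Qed.
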